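(* Let $\nu\in A_\infty(\Lambda)$ and $p\in[1,\infty)$. Suppose that $|\Phi'|^{-p}\Phi(\nu)\in A_\infty(\mathbb{R})$. Then, for a function $F\colon\mathbb{R}_+^2\to\mathbb{C}$, $$F\in H^p\big(\mathbb{R}_+^2,|\Phi'|^{-p}\Phi(\nu)\big)\iff F\cdot\frac{1}{\Phi'}\in H^p\big(\mathbb{R}_+^2,\Phi(\nu)\big),$$ with equivalent norms.
   Context: Let $\gamma\colon\mathbb{R}\to\mathbb{R}$ be Lipschitz with constant $L$, $\eta(x)=x+i\gamma(x)$, $\Lambda=\eta(\mathbb{R})$, and $\Omega=\{z_1+iz_2\in\mathbb{C}: z_2>\gamma(z_1)\}$, so $\partial\Omega=\Lambda$. Arc-length measure on $\Lambda$ is $ds(E)=\int_{\eta^{-1}(E)}|\eta'(t)|\,dt$. Let $\mathbb{R}_+^2=\{x+iy: x\in\mathbb{R},\,y>0\}$ and let $\Phi\colon\mathbb{R}_+^2\to\Omega$ be the conformal mapping with $\Phi(\infty)=\infty$ and $\Phi(i)=z_0$, where $z_0=ix_0$ with $x_0>\gamma(0)$ is fixed. Known: $\Phi$ extends to a homeomorphism $\overline{\mathbb{R}_+^2}\to\overline\Omega$ (still denoted $\Phi$); on $\mathbb{R}=\partial\mathbb{R}_+^2$ it is locally absolutely continuous, and its derivative $\Phi'(x)$ coincides $dx$-a.e. with the non-tangential limit of $\Phi'(z)$ and is nonzero $dx$-a.e. An interval in $\Lambda$ is the image under $\eta$ of an interval of $\mathbb{R}$. Muckenhoupt classes $A_r(\Lambda)$,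 $A_\infty(\Lambda)=\bigcup_{1<r<\infty}A_r(\Lambda)$ are defined as on $\mathbb{R}$, with arc-length $ds$ in place of Lebesgue measure and intervals in $\Lambda$ in place of intervals in $\mathbb{R}$. A measure absolutely continuous with respect to $ds$ (or $dx$) is identified with its density, and belongs to $A_\infty$ if its density does. For $\nu$ absolutely continuous with respect to $ds$, $\Phi(\nu)$ is the measure on $\mathbb{R}$ given by $\Phi(\nu)(E)=\nu(\Phi(E))$; its density with respect to $dx$ is $\nu(\Phi(x))|\Phi'(x)|$. In weights, $|\Phi'|$ denotes the boundary function $|\Phi'(x)|$, $x\in\mathbb{R}$; in $F\cdot\frac1{\Phi'}$, $\Phi'$ is the holomorphic function on $\mathbb{R}_+^2$. For a measure $\mu$ on $\mathbb{R}$ and $\alpha\in(0,\pi/2)$, $H^p(\mathbb{R}_+^2,\mu)$ is the space of analytic functions $h$ in $\mathbb{R}_+^2$ such that $\|h\|_{H^p(\mathbb{R}_+^2,\mu)}:=\|\mathcal{M}_\alpha(h)\|_{L^p(\mathbb{R},\mu)}<\infty$, where $\mathcal{M}_\alpha(h)(x)=\sup_{z\in\Gamma_\alpha(x)}|h(z)|$ and $\Gamma_\alpha(x)=\{z_1+iz_2: z_2>0,\ |x-z_1|<\tan(\alpha)z_2\}$. Different $\alpha$ give the same space with equivalent norms. ''With equivalent norms'' means that $\|F\|_{H^p(\mathbb{R}_+^2,|\Phi'|^{-p}\Phi(\nu))}$ and $\|F/\Phi'\|_{H^p(\mathbb{R}_+^2,\Phi(\nu))}$ are comparable with positive constants independent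 of $F$. *)

(* Defs.v *)
From HB Require Import structures.
From mathcomp Require Import all_boot all_order all_algebra complex.
From mathcomp Require Import all_classical all_reals all_analysis.
Import Order.TTheory GRing.Theory Num.Theory.
Import numFieldNormedType.Exports.

Set Implicit Arguments.
Unset Strict Implicit.
Unset Printing Implicit Defensive.

Local Open Scope classical_set_scope.
Local Open Scope ring_scope.
Local Open Scope complex_scope.

(* The regular module R[i]^o carries the topology and the R[i]-normed module
   structure of the complex plane, so that [derivable f z 1] and ['D_1 f z]
   are complex differentiability and the complex derivative. *)
Notation cplane R := (R[i]^o).

Definition cabs (R : realType) (z : cplane R) : R := complex.Re `|z|.

Definition borelC (R : realType) := g_sigma_algebraType (@open (cplane R)).

Definition holomorphic_on (R : realType) (A : set (cplane R))
    (f : cplane R -> cplane R) :=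
  forall z, A z -> derivable f z 1.

Definition curve_derivable (R : realType) (f : R -> cplane R) (x : R) :=
  derivable (fun t => complex.Re (f t)) x 1 /\
  derivable (fun t => complex.Im (f t)) x 1.

(* The derivative of a curve is taken coordinatewise, because R[i] is a normed
   module over itself but not over R. *)
Definition curve_deriv (R : realType) (f : R -> cplane R) (x : R) : cplane R :=
  derive1 (fun t => complex.Re (f t)) x +i*
  derive1 (fun t => complex.Im (f t)) x.

Definition locally_absolutely_continuous (R : realType)
    (f : R -> cplane R) :=
  forall a b e : R, 0 < e -> exists2 d : R, 0 < d &
    forall (n : nat) (u v : 'I_n -> R),
      (forall k, a <= u k /\ u k <= v k /\ v k <= b) ->
      trivIset [set: 'I_n] (fun k => `]u k, v k[%classic) ->
      \sum_(k < n) (v k - u k) < d ->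
      \sum_(k < n) cabs (f (v k) - f (u k)) < e.

Section muckenhoupt.
Context (R : realType) (d : measure_display) (T : measurableType d).
(* sigma is the reference measure, intervals the family of test sets *)
Variables (sigma : set T -> \bar R) (intervals : set (set T)).

Definition average (J : set T) (f : T -> R) : \bar R :=
  ((sigma J)^-1 * \int[sigma]_(z in J) (f z)%:E)%E.

Definition is_weight (w : T -> R) :=
  [/\ measurable_fun [set: T] w,
      forall z, 0 <= w z,
      sigma [set z | w z = 0] = 0%E &
      forall J, intervals J -> (\int[sigma]_(z in J) (w z)%:E < +oo)%E].

Definition muckenhoupt (r : R) (w : T -> R) :=
  is_weight w /\
  exists K : R, forall J, intervals J ->
    (average J w * average J (fun z => w z `^ (- (r - 1)^-1))%R `^ (r - 1)
       <= K%:E)%E.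

Definition muckenhoupt_infty (w : T -> R) :=
  exists2 r : R, 1 < r & muckenhoupt r w.

Definition measure_muckenhoupt_infty (mu : set T -> \bar R) :=
  exists2 w : T -> R, muckenhoupt_infty w &
    forall E, measurable E -> mu E = (\int[sigma]_(z in E) (w z)%:E)%E.

End muckenhoupt.

(* Bounded nondegenerate intervals: the choice of endpoints does not affect
   the averages. *)
Definition line_intervals (R : realType) : set (set (measurableTypeR R)) :=
  [set J | exists a b : R, a < b /\ J = `[a, b]%classic].

Definition Ainfty_line (R : realType)
    (mu : set (measurableTypeR R) -> \bar R) :=
  measure_muckenhoupt_infty (@lebesgue_measure R) (@line_intervals R) mu.

Section graph_domain.
Context (R : realType).
Variable gamma : R -> R.

Definition eta (x : R) : cplane R := x +i* gamma x.

Definition Omega : set (cplane R) :=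
  [set z | gamma (complex.Re z) < complex.Im z].

(* This measure on the plane is concentrated on the graph eta(R). *)
Definition arc_length (E : set (borelC R)) : \bar R :=
  (\int[@lebesgue_measure R]_(t in eta @^-1` E) (cabs (curve_deriv eta t))%:E)%E.

Definition graph_intervals : set (set (borelC R)) :=
  [set J | exists a b : R, a < b /\ J = eta @` `[a, b]%classic].

Definition Ainfty_graph (nu : set (borelC R) -> \bar R) :=
  measure_muckenhoupt_infty arc_length graph_intervals nu.

End graph_domain.

Section half_plane.
Context (R : realType).

Definition uhp : set (cplane R) := [set z | 0 < complex.Im z].

Definition closed_uhp : set (cplane R) := [set z | 0 <= complex.Im z].

Definition cone (alpha x : R) : set (cplane R) :=
  [set z | 0 < complex.Im z /\
           `|x - complex.Re z| < tan alpha * complex.Im z].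

Definition maximal_fun (alpha : R) (h : cplane R -> cplane R) (x : R)
    : \bar R :=
  ereal_sup [set (cabs (h z))%:E | z in cone alpha x].

(* The L^p(mu) norm is spelled out so that mu may be a bare set function, such
   as E |-> nu (Phi @` E). *)
Definition hardy_norm (alpha p : R) (mu : set (measurableTypeR R) -> \bar R)
    (h : cplane R -> cplane R) : \bar R :=
  ((\int[mu]_x (maximal_fun alpha h x `^ p)) `^ p^-1)%E.

Definition hardy (alpha p : R) (mu : set (measurableTypeR R) -> \bar R)
    (h : cplane R -> cplane R) :=
  holomorphic_on uhp h /\ (hardy_norm alpha p mu h < +oo)%E.

End half_plane.

Section conformal.
Context (R : realType).
Variables (gamma : R -> R) (Phi : cplane R -> cplane R).

Definition bdry (x : R) : cplane R := Phi x%:C.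

(* The conformal mapping of the half-plane onto Omega normalised by
   Phi(oo) = oo and Phi(i) = i x0, together with its extension to the boundary
   and the classical facts that make the boundary derivative meaningful.  All
   fields after [conformal_infty] but [conformal_cont] follow from the previous
   ones and from gamma being Lipschitz. *)
Record conformal_map (x0 : R) : Prop := ConformalMap {
  conformal_holo : holomorphic_on (@uhp R) Phi ;
  conformal_bij : set_bij (@uhp R) (Omega gamma) Phi ;
  conformal_base : Phi 'i = x0 *i ;
  conformal_infty : forall M : R, exists N : R, forall z : cplane R,
    0 < complex.Im z -> N < cabs z -> M < cabs (Phi z) ;
  conformal_cont : {within @closed_uhp R, continuous Phi} ;
  conformal_closure_bij :
    set_bij (@closed_uhp R) (closure (Omega gamma)) Phi ;
  conformal_inv_cont : exists2 Psi : cplane R -> cplane R,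
    (forall z, closed_uhp z -> Psi (Phi z) = z) &
    {within closure (Omega gamma), continuous Psi} ;
  conformal_bdry_ac : locally_absolutely_continuous bdry ;
  conformal_bdry_deriv : {ae @lebesgue_measure R, forall x,
    [/\ curve_derivable bdry x,
        curve_deriv bdry x != 0 &
        forall alpha : R, 0 < alpha -> alpha < pi / 2 ->
          'D_1 Phi @ within (cone alpha x) (nbhs (x%:C : cplane R))
            --> curve_deriv bdry x]}
}.

Definition image_measure (nu : set (borelC R) -> \bar R)
    (E : set (measurableTypeR R)) : \bar R :=
  nu (bdry @` E).

(* |Phi'|^q mu, with the boundary derivative of Phi *)
Definition deriv_weighted (q : R) (mu : set (measurableTypeR R) -> \bar R)
    (E : set (measurableTypeR R)) : \bar R :=
  (\int[mu]_(x in E) (cabs (curve_deriv bdry x) `^ q)%:E)%E.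

End conformal.

(* Main.v *)
(* A Lipschitz domain is invariant under w |-> w + v for v in a vertical cone.
   The self-map Phi^-1 (Phi + v) of the half-plane does not decrease Im,
   by Schwarz-Pick and a Wolff-type argument at infinity, and letting v -> 0
   shows that Phi' takes values in a sector around the positive axis.  Hence
   |Phi'| and 1/|Phi'| are comparable to their real parts, so that their
   averages over the interval I_z = (x - Ty, x + Ty), T = tan alpha, are at most
   a multiple of |Phi'(z)| and 1/|Phi'(z)|, z = x + iy.  By Chebyshev, |Phi'| is
   comparable to |Phi'(z)| on a subset A_z of at least half of I_z, and the
   A_infty conditions on both measures give mu(5 I_z) <= C mu(A_z).

   The level set {M G > l} of a nontangential maximal function is the union of
   the I_z with |G(z)| > l.  If G = F / Phi', then M F / |Phi'| > l / K on each
   A_z, so Vitali's covering lemma bounds mu{M G > l} by a multiple of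
   mu{M F / |Phi'| > l / K}.  Integrating over l gives one inequality between
   the norms; exchanging F and F / Phi' gives the other one. *)

From HB Require Import structures.
Require Import Defs.
From mathcomp Require Import all_boot all_order all_algebra complex.
From mathcomp Require Import all_classical all_reals all_analysis.
From mathcomp Require Import measurable_realfun ring lra.
Import Order.TTheory GRing.Theory Num.Theory.
Import numFieldNormedType.Exports.

Set Implicit Arguments.
Unset Strict Implicit.
Unset Printing Implicit Defensive.

Local Open Scope classical_set_scope.
Local Open Scope ring_scope.
Local Open Scope complex_scope.

(** * The complex plane *)

(** No representation of [Phi'] by its boundary values is needed. The mean value property on curves
    inside the half-plane, positivity, and Fatou's lemma at the boundary give upper bounds for the
    averages of [D] and [D^-1], where [D] is the modulus of the boundary derivative, and Chebyshev's
    inequality asks for nothing else. The obstacle is that the two A_infty conditions refer to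
    different measures. For the weighted measure on the line it suffices that good sets are large
    for Lebesgue measure; this bounds [F] by [F / Phi']. For [nu] they must be large for arc length.
    Fatou's lemma bounds the arc length of the image of a good set from below; that of the image of
    the enlarged interval is bounded from above by an increment of [Re Phi], estimated on horizontal
    lines before their height tends to 0. Both bounds are multiples of [y |Phi'(z)|], so their ratio
    does not depend on [z]; this bounds [F / Phi'] by [F]. Wolff's argument applies because the
    points [w + n v] go to infinity while [Phi] is bounded on bounded sets, so that the orbits in
    the half-plane escape as well. *)

Section cabs_theory.
Context (R : realType).
Implicit Types z w : cplane R.

Lemma normE z : `|z| = (cabs z)%:C.
Proof. by rewrite /cabs normc_def. Qed.

Lemma cabsE z : cabs z = Num.sqrt (complex.Re z ^+ 2 + complex.Im z ^+ 2).
Proof. by rewrite /cabs normc_def. Qed.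

Lemma cabs_ge0 z : 0 <= cabs z.
Proof. by rewrite cabsE sqrtr_ge0. Qed.

Lemma cabs_sqr z : cabs z ^+ 2 = complex.Re z ^+ 2 + complex.Im z ^+ 2.
Proof. by rewrite cabsE sqr_sqrtr// addr_ge0// sqr_ge0. Qed.

Lemma cabsM z w : cabs (z * w) = cabs z * cabs w.
Proof. by apply: complexI; rewrite -normE normrM !normE rmorphM. Qed.

Lemma cabsD z w : cabs (z + w) <= cabs z + cabs w.
Proof. by rewrite -lecR rmorphD/= -!normE ler_normD. Qed.

Lemma cabsN z : cabs (- z) = cabs z.
Proof. by apply: complexI; rewrite -!normE normrN. Qed.

Lemma cabsB z w : cabs (z - w) = cabs (w - z).
Proof. by rewrite -cabsN opprB. Qed.

Lemma cabs0 : cabs (0 : cplane R) = 0.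
Proof. by apply: complexI; rewrite -normE normr0. Qed.

Lemma cabs1 : cabs (1 : cplane R) = 1.
Proof. by apply: complexI; rewrite -normE normr1. Qed.

Lemma cabs_eq0 z : (cabs z == 0) = (z == 0).
Proof. by rewrite -(inj_eq (@complexI R)) -normE normr_eq0. Qed.

Lemma cabs_gt0 z : (0 < cabs z) = (z != 0).
Proof. by rewrite lt_def cabs_ge0 andbT cabs_eq0. Qed.

Lemma cabsV z : cabs z^-1 = (cabs z)^-1.
Proof. by apply: complexI; rewrite -normE normfV normE fmorphV. Qed.

Lemma cabsX z n : cabs (z ^+ n) = cabs z ^+ n.
Proof. by apply: complexI; rewrite -normE normrX normE rmorphXn. Qed.

Lemma cabs_real (x : R) : cabs (x%:C : cplane R) = `|x|.
Proof. by rewrite cabsE /= expr0n addr0 sqrtr_sqr. Qed.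

Lemma Re_le_cabs z : `|complex.Re z| <= cabs z.
Proof. by rewrite cabsE -sqrtr_sqr ler_wsqrtr// lerDl sqr_ge0. Qed.

Lemma Im_le_cabs z : `|complex.Im z| <= cabs z.
Proof. by rewrite cabsE -sqrtr_sqr ler_wsqrtr// lerDr sqr_ge0. Qed.

Lemma cabs_le_ReIm z : cabs z <= `|complex.Re z| + `|complex.Im z|.
Proof.
rewrite -ler_sqr ?nnegrE ?cabs_ge0 ?addr_ge0// cabs_sqr sqrrD !real_normK ?num_real//.
by rewrite -addrA lerD2l lerDr mulrn_wge0// mulr_ge0.
Qed.

Lemma cReD z w : complex.Re (z + w) = complex.Re z + complex.Re w.
Proof. by case: z; case: w. Qed.
Lemma cImD z w : complex.Im (z + w) = complex.Im z + complex.Im w.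
Proof. by case: z; case: w. Qed.
Lemma cReN z : complex.Re (- z) = - complex.Re z.
Proof. by case: z. Qed.
Lemma cImN z : complex.Im (- z) = - complex.Im z.
Proof. by case: z. Qed.
Lemma cReM z w : complex.Re (z * w) =
  complex.Re z * complex.Re w - complex.Im z * complex.Im w.
Proof. by case: z; case: w. Qed.
Lemma cImM z w : complex.Im (z * w) =
  complex.Re z * complex.Im w + complex.Im z * complex.Re w.
Proof. by case: z => ? ?; case: w => ? ?; rewrite /=. Qed.
Lemma cReV z : complex.Re z^-1 = complex.Re z / cabs z ^+ 2.
Proof. by rewrite cabs_sqr; case: z. Qed.
Lemma cImV z : complex.Im z^-1 = - complex.Im z / cabs z ^+ 2.
Proof. by rewrite cabs_sqr; case: z => a b /=; rewrite mulNr. Qed.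

Lemma complex_eq z w : complex.Re z = complex.Re w ->
  complex.Im z = complex.Im w -> z = w.
Proof. by case: z => a b; case: w => c d /= -> ->. Qed.

Definition ReImE := (cReD, cImD, cReN, cImN, cReM, cImM).

Lemma ball_cplaneP z (e : R) w : ball z e%:C w <-> cabs (z - w) < e.
Proof. by rewrite /ball/= normE ltcR. Qed.

Lemma nbhs_cplaneP z (A : set (cplane R)) :
  nbhs z A <-> exists2 e : R, 0 < e & forall w, cabs (w - z) < e -> A w.
Proof.
split.
  move/nbhs_ballP => [e /= e0 eA].
  have ee : e = (complex.Re e)%:C.
    by rewrite (RRe_real)// gtr0_real.
  exists (complex.Re e); first by rewrite -ltcR -ee.
  by move=> w we; apply: eA; rewrite ee; apply/ball_cplaneP; rewrite cabsB.
move=> [e e0 eA]; apply/nbhs_ballP; exists e%:C; first by rewrite /= ltcR.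
by move=> w /ball_cplaneP; rewrite cabsB; exact: eA.
Qed.

Lemma cvg_cplaneP (T : Type) (F : set_system T) {FF : Filter F}
   (f : T -> cplane R) z :
  f @ F --> z <-> forall e : R, 0 < e -> \forall t \near F, cabs (f t - z) < e.
Proof.
split.
  move=> fz e e0; apply: (fz [set w | cabs (w - z) < e]).
  by apply/nbhs_cplaneP; exists e.
move=> H A /nbhs_cplaneP[e e0 eA]; have := H e e0.
by apply: filterS => t; exact: eA.
Qed.

Lemma continuous_Re : continuous (fun z : cplane R => complex.Re z : R).
Proof.
move=> z; apply/(@cvgrPdist_lt R R _ (nbhs z)) => e e0; apply/nbhs_cplaneP; exists e => // w wz.
by rewrite -cReN -cReD; apply: le_lt_trans (Re_le_cabs _) _; rewrite cabsB.
Qed.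

Lemma continuous_Im : continuous (fun z : cplane R => complex.Im z : R).
Proof.
move=> z; apply/(@cvgrPdist_lt R R _ (nbhs z)) => e e0; apply/nbhs_cplaneP; exists e => // w wz.
by rewrite -cImN -cImD; apply: le_lt_trans (Im_le_cabs _) _; rewrite cabsB.
Qed.

Lemma cabs_dist z w : `|cabs z - cabs w| <= cabs (z - w).
Proof.
have h (u v : cplane R) : cabs u <= cabs (u - v) + cabs v.
  by apply: le_trans (cabsD _ _); rewrite subrK.
have := h z w; have := h w z; rewrite (cabsB w) ler_norml; lra.
Qed.

Lemma continuous_cabs : continuous (@cabs R : cplane R -> R).
Proof.
move=> z; apply/(@cvgrPdist_lt R R _ (nbhs z)) => e e0; apply/nbhs_cplaneP; exists e => // w wz.
by apply: le_lt_trans (cabs_dist _ _) _; rewrite cabsB.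
Qed.

Lemma cvg_complex (T : Type) (F : set_system T) {FF : Filter F}
   (f g : T -> R) (a b : R) :
  f @ F --> a -> g @ F --> b -> (fun t => f t +i* g t : cplane R) @ F --> (a +i* b : cplane R).
Proof.
move=> fa gb; apply/cvg_cplaneP => e e0.
have e20 : 0 < e / 2 by rewrite divr_gt0.
move/cvgrPdist_lt : fa => /(_ _ e20) fa.
move/cvgrPdist_lt : gb => /(_ _ e20) gb.
near=> t; apply: le_lt_trans (cabs_le_ReIm _) _ => /=.
rewrite [ltRHS]splitr ltrD//; rewrite distrC; near: t; [exact: fa|exact: gb].
Unshelve. all: by end_near. Qed.

End cabs_theory.

(** * Derivatives as epsilon-delta estimates, and the chain rule *)

Section derive_eps.
Context (K : numFieldType).
Lemma growth_rate_norm (f : K^o -> K^o) (x df h : K) : h != 0 ->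
  `|df - h^-1 *: ((f \o shift x) (h *: (1 : K^o)) - f x)| * `|h| =
  `|f (x + h) - f x - df * h|.
Proof.
move=> h0; rewrite -normrM distrC [_ *: (1 : K^o)]mulr1 /= (addrC h).
congr `|_|; rewrite mulrBl; congr (_ - _).
by rewrite [X in X = _]mulrAC mulVf// mul1r.
Qed.

(** Clearing the denominator [h] makes the estimate valid at [h = 0] too, so that it can be composed
    and integrated without case distinctions. It is stated over a general field because it serves
    both [R] and [R[i]]. *)
Lemma is_derive_epsP (f : K^o -> K^o) (x df : K) :
  is_derive (x : K^o) 1 f df <-> forall e : K, 0 < e -> exists2 d : K, 0 < d &
    forall h : K, `|h| < d -> `|f (x + h) - f x - df * h| <= e * `|h|.
Proof.
split.
  move=> [fd <-] e e0.
  move: fd => /cvg_ex[l fl].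
  have -> : 'D_1 f x = l by exact/cvg_lim.
  move/cvgrPdist_le : fl => /(_ _ e0) /nbhs_ballP[d /= d0 H].
  exists d => // h hd; have [->|h0] := eqVneq h 0.
    by rewrite addr0 subrr mulr0 subrr !normr0 mulr0.
  have := H h; rewrite /ball/= sub0r normrN => /(_ hd h0).
  by rewrite -(ler_pM2r (_ : 0 < `|h|)) ?normr_gt0// growth_rate_norm.
move=> H.
have fl : h^-1 *: ((f \o shift (x : K^o)) (h *: (1 : K^o)) - f x) @[h --> 0^'] --> (df : K^o).
  apply/cvgrPdist_le => e e0; have [d d0 {}H] := H _ e0.
  near=> h.
  have h0 : h != 0 by near: h; exact: nbhs_dnbhs_neq.
  have : `|h| < d.
    by near: h; apply: dnbhs0_lt.
  by move=> /H; rewrite -growth_rate_norm// ler_pM2r// normr_gt0.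
split; first by apply/cvg_ex; exists df.
exact: cvg_lim fl.
Unshelve. all: by end_near. Qed.
End derive_eps.
Section complex_derivative.
Context (R : realType).
Implicit Types (f g : cplane R -> cplane R) (z w : cplane R).
(** The radii of balls in [R[i]] are themselves complex numbers. Positive ones are real, so epsilon
    and delta can be moved to [R], where linear arithmetic applies. *)
Lemma is_derive_cplaneP f z l :
  is_derive z 1 f l <-> forall e : R, 0 < e -> exists2 d : R, 0 < d &
    forall w, cabs (w - z) < d -> cabs (f w - f z - l * (w - z)) <= e * cabs (w - z).
Proof.
split.
  move=> /(@is_derive_epsP R[i] f) H e e0.
  have [|d d0 Hd] := H e%:C; first by rewrite ltcR.
  have dd : d = (complex.Re d)%:C by rewrite (RRe_real)// gtr0_real.
  exists (complex.Re d); first by rewrite -ltcR -dd.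
  move=> w wz; have := Hd (w - z).
  rewrite [in X in X -> _]dd normE ltcR => /(_ wz).
  by rewrite (addrC z) subrK normE -rmorphM/= lecR.
move=> H; apply/(@is_derive_epsP R[i] f) => e e0.
have ee : e = (complex.Re e)%:C by rewrite (RRe_real)// gtr0_real.
have [|d d0 Hd] := H (complex.Re e); first by rewrite -ltcR -ee.
exists d%:C; first by rewrite ltcR.
move=> h; rewrite normE ltcR => hd.
have := Hd (z + h); rewrite (addrC z h) addrK => /(_ hd).
by rewrite ee normE -rmorphM/= lecR.
Qed.

Lemma is_derive_comp f g z l m :
  is_derive z 1 g l -> is_derive (g z) 1 f m ->
  is_derive z 1 (fun w => f (g w)) (m * l).
Proof.
move=> /is_derive_cplaneP Hg /is_derive_cplaneP Hf; apply/is_derive_cplaneP => e e0.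
have l0 := cabs_ge0 l; have m0 := cabs_ge0 m.
(* The minimum with 1 in the tolerance for [g] gives the Lipschitz bound [cabs l + 1] for [g] at
   [z]; each of the two remainders then contributes at most [e / 2]. *)
have [|d1 d10 H1] := Hf (e / 2 / (cabs l + 1)); first by rewrite !divr_gt0// ltr_wpDl.
have [|d2 d20 H2] := Hg (Num.min 1 (e / 2 / (cabs m + 1))).
  by rewrite lt_min ltr01/= !divr_gt0// ltr_wpDl.
exists (Num.min d2 (d1 / (cabs l + 1))); first by rewrite lt_min d20 divr_gt0// ltr_wpDl.
move=> w; rewrite lt_min => /andP[w2 w1].
have {H2} := H2 w w2 => H2.
have a0 := cabs_ge0 (w - z).
have Hgw : cabs (g w - g z) <= (cabs l + 1) * cabs (w - z).
  rewrite -[X in cabs X](subrK (l * (w - z))); apply: le_trans (cabsD _ _) _.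
  rewrite cabsM mulrDl addrC lerD2l mul1r (le_trans H2)//.
  by rewrite ler_piMl// ge_min lexx.
have : cabs (g w - g z) < d1.
  apply: le_lt_trans Hgw _; rewrite mulrC -ltr_pdivlMr// ltr_wpDl//.
move=> /H1 {}H1.
have -> : f (g w) - f (g z) - m * l * (w - z) =
  (f (g w) - f (g z) - m * (g w - g z)) + m * (g w - g z - l * (w - z)) by ring.
apply: le_trans (cabsD _ _) _; rewrite cabsM [e]splitr mulrDl lerD//.
  apply: le_trans H1 _; rewrite -mulrA ler_pM2l ?divr_gt0//.
  rewrite mulrC ler_pdivrMr; last by rewrite ltr_wpDl.
  by rewrite mulrC.
apply: (@le_trans _ _ ((cabs m + 1) * (e / 2 / (cabs m + 1) * cabs (w - z)))).
  apply: ler_pM => //; [exact: cabs_ge0|by rewrite lerDl|].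
  by apply: le_trans H2 _; apply: ler_wpM2r => //; rewrite ge_min lexx orbT.
rewrite mulrA (mulrC (cabs m + 1)) mulrVK// unitfE gt_eqF// ltr_wpDl//.
Qed.
End complex_derivative.
Section continuity_rules.
Context (R : realType) (T : topologicalType).
Implicit Types (f g : T -> cplane R) (z : T).

Lemma ccontM f g z : {for z, continuous f} -> {for z, continuous g} ->
  {for z, continuous (fun x => f x * g x : cplane R)}.
Proof. exact: (@continuousM R[i] T f g z). Qed.

Lemma ccontV f z : f z != 0 -> {for z, continuous f} ->
  {for z, continuous (fun x => (f x)^-1 : cplane R)}.
Proof. exact: (@continuousV R[i] T f z). Qed.

Lemma ccontD f g z : {for z, continuous f} -> {for z, continuous g} ->
  {for z, continuous (fun x => f x + g x : cplane R)}.
Proof. exact: (@continuousD R[i] (cplane R) T f g z). Qed.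

Lemma ccontB f g z : {for z, continuous f} -> {for z, continuous g} ->
  {for z, continuous (fun x => f x - g x : cplane R)}.
Proof. exact: (@continuousB R[i] (cplane R) T f g z). Qed.

Lemma ccont_cst (c : cplane R) z : {for z, continuous (fun _ : T => c)}.
Proof. exact: cst_continuous. Qed.

Lemma ccont_complex (f g : T -> R) z : {for z, continuous f} ->
  {for z, continuous g} -> {for z, continuous (fun x => f x +i* g x : cplane R)}.
Proof. by move=> cf cg; apply: cvg_complex. Qed.

Lemma ccont_Re f z : {for z, continuous f} -> {for z, continuous (fun x => complex.Re (f x))}.
Proof. by move=> cf; apply: (continuous_comp cf); exact: continuous_Re. Qed.

Lemma ccont_Im f z : {for z, continuous f} -> {for z, continuous (fun x => complex.Im (f x))}.
Proof. by move=> cf; apply: (continuous_comp cf); exact: continuous_Im. Qed.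

Lemma ccont_cabs f z : {for z, continuous f} -> {for z, continuous (fun x => cabs (f x))}.
Proof. by move=> cf; apply: (continuous_comp cf); exact: continuous_cabs. Qed.

End continuity_rules.

Section derivative_rules.
Context (R : realType).
Implicit Types (f g : cplane R -> cplane R) (z w : cplane R).

Lemma derivable_ccont f z : derivable f z 1 -> {for z, continuous f}.
Proof. by move=> /derivable1_diffP /differentiable_continuous. Qed.

Lemma cderivableM f g z : derivable f z 1 -> derivable g z 1 ->
  derivable (fun x => f x * g x : cplane R) z 1.
Proof. exact: (@derivableM R[i] (cplane R) f g). Qed.

Lemma cderivableV f z : f z != 0 -> derivable f z 1 ->
  derivable (fun x => (f x)^-1 : cplane R) z 1.
Proof. exact: (@derivableV R[i] (cplane R) f). Qed.

Lemma cderivableD f g z : derivable f z 1 -> derivable g z 1 ->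
  derivable (fun x => f x + g x : cplane R) z 1.
Proof. exact: (@derivableD R[i] (cplane R) (cplane R) f g). Qed.

Lemma cderivableB f g z : derivable f z 1 -> derivable g z 1 ->
  derivable (fun x => f x - g x : cplane R) z 1.
Proof. exact: (@derivableB R[i] (cplane R) (cplane R) f g). Qed.

Lemma cderivable_cst (c : cplane R) z : derivable (fun _ : cplane R => c) z 1.
Proof. exact: (@derivable_cst R[i] (cplane R) (cplane R)). Qed.

Lemma cderivable_id z : derivable (fun x : cplane R => x) z 1.
Proof. exact: (@derivable_id R[i] (cplane R)). Qed.

Lemma cderivable_comp f g z : derivable g z 1 -> derivable f (g z) 1 ->
  derivable (fun w => f (g w)) z 1.
Proof.
by move=> /derivableP dg /derivableP df; have [] := is_derive_comp dg df.
Qed.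

Lemma near_eq_cderivable f g z (e : R) : 0 < e ->
  (forall w, cabs (w - z) < e -> f w = g w) -> derivable f z 1 -> derivable g z 1.
Proof.
move=> e0 fg /derivableP/is_derive_cplaneP H.
suff [] : is_derive z 1 g ('D_1 f z) by [].
apply/is_derive_cplaneP => e1 e10; have [d d0 {}H] := H _ e10.
exists (Num.min d e); first by rewrite lt_min d0.
move=> w; rewrite lt_min => /andP[wd we]; rewrite -!fg ?subrr ?cabs0//; exact: H.
Qed.

End derivative_rules.

(** * The complex exponential, used as logarithmic coordinates on annuli *)

Section complex_exponential.
Context (R : realType).
Implicit Types (z w : cplane R).

Definition cexp z : cplane R :=
  (expR (complex.Re z) * cos (complex.Im z)) +i*
  (expR (complex.Re z) * sin (complex.Im z)).

Lemma cexpD z w : cexp (z + w) = cexp z * cexp w.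
Proof.
by apply: complex_eq; rewrite ?cReM ?cImM /cexp /= cReD cImD expRD ?cosD ?sinD; ring.
Qed.

Lemma cexp0 : cexp 0 = 1.
Proof. by apply: complex_eq; rewrite /= expR0 ?cos0 ?sin0 ?mulr0 ?mulr1. Qed.

Lemma cabs_cexp z : cabs (cexp z) = expR (complex.Re z).
Proof.
rewrite cabsE /= !exprMn -mulrDr cos2Dsin2 mulr1 sqrtr_sqr.
by rewrite ger0_norm// expR_ge0.
Qed.

Lemma is_derive_cexp0 : is_derive (0 : cplane R) 1 cexp 1.
Proof.
apply/is_derive_cplaneP => e e0.
(* The errors below add up to at most [4 * m * cabs w + 4 * cabs w ^+ 2], which is at most
   [e * cabs w] once [m <= e / 6] and [cabs w <= e / 12]. *)
have e60 : 0 < e / 6 by rewrite divr_gt0.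
have m0 : 0 < Num.min 1 (e / 6) by rewrite lt_min ltr01.
have /(@is_derive_epsP R expR)/(_ _ m0)[d1 d10 H1] := is_derive_expR (0 : R).
have /(@is_derive_epsP R cos)/(_ _ m0)[d2 d20 H2] := is_derive_cos (0 : R).
have /(@is_derive_epsP R sin)/(_ _ m0)[d3 d30 H3] := is_derive_sin (0 : R).
exists (Num.min 1 (Num.min (e / 12) (Num.min d1 (Num.min d2 d3)))).
  by rewrite !lt_min ltr01 d10 d20 d30 divr_gt0.
move=> w; rewrite subr0 !lt_min => /and5P[w1 we wd1 wd2 wd3].
have rw := Re_le_cabs w; have iw := Im_le_cabs w.
have {H1} := H1 _ (le_lt_trans rw wd1).
have {H2} := H2 _ (le_lt_trans iw wd2).
have {H3} := H3 _ (le_lt_trans iw wd3).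
rewrite !add0r expR0 cos0 sin0 !mul1r oppr0 mul0r addr0 !subr0 cexp0.

set s := complex.Re w in rw *; set t := complex.Im w in iw *.
set m := Num.min _ _ => sn cs ex.
have m1 : m <= 1 by rewrite ge_min lexx.
have me : m <= e / 6 by rewrite ge_min lexx orbT.
have m00 : 0 <= m by rewrite ltW.
have a0 := cabs_ge0 w.
have ms : m * `|s| <= m * cabs w by rewrite ler_wpM2l.
have mt : m * `|t| <= m * cabs w by rewrite ler_wpM2l.
have ma : m * cabs w <= e / 6 * cabs w by rewrite ler_wpM2r.
have ma1 : m * cabs w <= cabs w by rewrite ler_piMl.
have aa : cabs w * cabs w <= e / 12 * cabs w by rewrite ler_wpM2r// ltW.
have C1 : `|cos t| <= 1 by rewrite ler_norml cos_geN1 cos_le1.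
have E1 : `|expR s - 1| <= 2 * cabs w.
  rewrite -[X in `|X|](subrK s) (le_trans (ler_normD _ _))//; lra.
have S1 : `|sin t| <= 2 * cabs w.
  rewrite -[X in `|X|](subrK t) (le_trans (ler_normD _ _))//; lra.
have P1 : `|(expR s - 1 - s) * cos t| <= m * cabs w.
  by rewrite normrM -[leRHS]mulr1 ler_pM// (le_trans ex).
have P2 : `|(1 + s) * (cos t - 1)| <= 2 * (m * cabs w).
  rewrite normrM ler_pM// ?(le_trans cs)//.
  by rewrite (le_trans (ler_normD _ _))// normr1 [leRHS]mulr2n lerD2l (le_trans rw)// ltW.
have P3 : `|(expR s - 1) * sin t| <= 4 * (cabs w * cabs w).
  rewrite normrM (le_trans (ler_pM _ _ E1 S1))//; lra.
apply: (le_trans (cabs_le_ReIm _)); rewrite /cexp !ReImE /= -/s -/t subr0.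
have -> : expR s * cos t - 1 - s = (expR s - 1 - s) * cos t + (1 + s) * (cos t - 1) by ring.
have -> : expR s * sin t - t = (expR s - 1) * sin t + (sin t - t) by ring.
have Q1 := ler_normD ((expR s - 1 - s) * cos t) ((1 + s) * (cos t - 1)).
have Q2 := ler_normD ((expR s - 1) * sin t) (sin t - t).
lra.
Qed.

(** The functional equation [cexpD] carries the estimate at 0 to every point, with the tolerance
    divided by [cabs (cexp z)]. *)
Lemma derivable_cexp z : derivable cexp z 1.
Proof.
have /is_derive_cplaneP H := is_derive_cexp0.
suff [] : is_derive z 1 cexp (cexp z) by [].
apply/is_derive_cplaneP => e e0.
have c0 : 0 < cabs (cexp z) by rewrite cabs_cexp expR_gt0.
have [|d d0 Hd] := H (e / cabs (cexp z)); first by rewrite divr_gt0.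
exists d => // w wz.
have -> : cexp w - cexp z - cexp z * (w - z) =
  cexp z * (cexp (w - z) - cexp 0 - 1 * (w - z - 0)).
  have -> : cexp w = cexp z * cexp (w - z) by rewrite -cexpD addrC subrK.
  rewrite cexp0; ring.
rewrite cabsM mulrC -ler_pdivlMr// mulrAC -[X in _ * cabs X]subr0.
by apply: Hd; rewrite subr0.
Qed.

End complex_exponential.

(** * Integrals over segments and Goursat's theorem *)

Section interval_integrals.
Context (R : realType).
Implicit Types (a b c : R).
Notation mu := (@lebesgue_measure R).

Definition rint a b (f : R -> R) : R := (\int[mu]_(x in `[a, b]) f x)%R.

Lemma lebesgue_measure_cc a b : a <= b -> mu `[a, b] = (b - a)%:E.
Proof.
move=> ab; rewrite lebesgue_measure_itv /= lte_fin; case: ltgtP ab => // ->.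
by rewrite subrr.
Qed.

Lemma within_cont a b (f : R -> R) :
  (forall t, a <= t <= b -> {for t, continuous f}) -> {within `[a, b], continuous f}.
Proof.
by move=> cf; apply: continuous_in_subspaceT => t /set_mem /=; rewrite in_itv /=; exact: cf.
Qed.

Lemma cont_integrable a b (f : R -> R) :
  (forall t, a <= t <= b -> {for t, continuous f}) ->
  mu.-integrable `[a, b] (EFin \o f).
Proof.
move=> cf; apply: continuous_compact_integrable; first exact: segment_compact.
exact: within_cont.
Qed.

Implicit Types (f g : R -> R) (k : R).

Lemma rint_ext a b f g : (forall t, a <= t <= b -> f t = g t) ->
  rint a b f = rint a b g.
Proof.
by move=> fg; apply: eq_Rintegral => t /set_mem/=; rewrite in_itv/=; exact: fg.
Qed.

Lemma rintD a b f g :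
  (forall t, a <= t <= b -> {for t, continuous f}) ->
  (forall t, a <= t <= b -> {for t, continuous g}) ->
  rint a b (fun t => f t + g t) = rint a b f + rint a b g.
Proof. by move=> cf cg; apply: RintegralD => //; exact: cont_integrable. Qed.

Lemma rintB a b f g :
  (forall t, a <= t <= b -> {for t, continuous f}) ->
  (forall t, a <= t <= b -> {for t, continuous g}) ->
  rint a b (fun t => f t - g t) = rint a b f - rint a b g.
Proof. by move=> cf cg; apply: RintegralB => //; exact: cont_integrable. Qed.

Lemma rintZ a b k f :
  (forall t, a <= t <= b -> {for t, continuous f}) ->
  rint a b (fun t => k * f t) = k * rint a b f.
Proof. by move=> cf; apply: RintegralZl => //; exact: cont_integrable. Qed.

Lemma rint_cst a b k : a <= b -> rint a b (fun=> k) = k * (b - a).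
Proof. by move=> ab; rewrite /rint Rintegral_cst//; rewrite -[RHS]/(k * fine (b - a)%:E); congr (_ * fine _); exact: lebesgue_measure_cc. Qed.

Lemma rint_le a b f g : (forall t, a <= t <= b -> {for t, continuous f}) ->
  (forall t, a <= t <= b -> {for t, continuous g}) ->
  (forall t, a <= t <= b -> f t <= g t) -> rint a b f <= rint a b g.
Proof.
move=> cf cg fg; apply: le_Rintegral => //; try exact: cont_integrable.
Qed.

Lemma rint_cat a b c f : a <= b -> b <= c ->
  (forall t, a <= t <= c -> {for t, continuous f}) ->
  rint a c f = rint a b f + rint b c f.
Proof.
move=> ab bc cf; have fi := cont_integrable cf.
have : rint a c f - rint a b f = rint b c f.
  rewrite /rint Rintegral_itvB ?bnd_simp// Rintegral_itv_obnd_cbnd//.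
  apply: integrableS fi => //.
  by apply: subset_itvScc; rewrite bnd_simp.
by move=> <-; rewrite addrC subrK.
Qed.

Lemma rint_bound a b f M : a <= b ->
  (forall t, a <= t <= b -> {for t, continuous f}) ->
  (forall t, a <= t <= b -> `|f t| <= M) -> `|rint a b f| <= M * (b - a).
Proof.
move=> ab cf fM; rewrite ler_norml -mulNr -!(rint_cst _ ab); apply/andP.
split; apply: rint_le => //; try by move=> t _; exact: cst_continuous.
all: by move=> t tab; have := fM t tab; rewrite ler_norml => /andP[].
Qed.

End interval_integrals.

Section complex_interval_integrals.
Context (R : realType).
Implicit Types (a b c : R) (f g : R -> cplane R) (k : cplane R).

Definition cint a b f : cplane R :=
  rint a b (fun t => complex.Re (f t)) +i* rint a b (fun t => complex.Im (f t)).

Lemma cint_ext a b f g : (forall t, a <= t <= b -> f t = g t) ->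
  cint a b f = cint a b g.
Proof. by move=> fg; congr (_ +i* _); apply: rint_ext => t /fg ->. Qed.

Lemma cintD a b f g :
  (forall t, a <= t <= b -> {for t, continuous f}) ->
  (forall t, a <= t <= b -> {for t, continuous g}) ->
  cint a b (fun t => f t + g t) = cint a b f + cint a b g.
Proof.
move=> cf cg; apply: complex_eq; rewrite !ReImE /= -rintD.
- by apply: rint_ext => t _; rewrite cReD.
- by move=> t tab; apply: ccont_Re; exact: cf.
- by move=> t tab; apply: ccont_Re; exact: cg.
- by apply: rint_ext => t _; rewrite cImD.
- by move=> t tab; apply: ccont_Im; exact: cf.
- by move=> t tab; apply: ccont_Im; exact: cg.
Qed.

Lemma cintZ a b k f :
  (forall t, a <= t <= b -> {for t, continuous f}) ->
  cint a b (fun t => k * f t) = k * cint a b f.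
Proof.
move=> cf; apply: complex_eq; rewrite !ReImE /= -!rintZ -?rintB -?rintD.
all: try by move=> t tab; (apply: ccont_Re || apply: ccont_Im); exact: cf.
all: try by apply: rint_ext => t _; rewrite !ReImE.
all: move=> t tab; apply: continuousM; first exact: cst_continuous.
all: by (apply: ccont_Re || apply: ccont_Im); exact: cf.
Qed.

Lemma cintB a b f g :
  (forall t, a <= t <= b -> {for t, continuous f}) ->
  (forall t, a <= t <= b -> {for t, continuous g}) ->
  cint a b (fun t => f t - g t) = cint a b f - cint a b g.
Proof.
move=> cf cg; apply: complex_eq; rewrite !ReImE /= -rintB.
- by apply: rint_ext => t _; rewrite cReD cReN.
- by move=> t tab; apply: ccont_Re; exact: cf.
- by move=> t tab; apply: ccont_Re; exact: cg.
- by apply: rint_ext => t _; rewrite cImD cImN.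
- by move=> t tab; apply: ccont_Im; exact: cf.
- by move=> t tab; apply: ccont_Im; exact: cg.
Qed.

Lemma cint_cst a b k : a <= b -> cint a b (fun=> k) = k * (b - a)%:C.
Proof.
by move=> ab; apply: complex_eq; rewrite !ReImE /= rint_cst// mulr0 ?addr0 ?subr0 ?add0r.
Qed.

Lemma cint_cat a b c f : a <= b -> b <= c ->
  (forall t, a <= t <= c -> {for t, continuous f}) ->
  cint a c f = cint a b f + cint b c f.
Proof.
move=> ab bc cf; apply: complex_eq; rewrite !ReImE /= -rint_cat//.
all: by move=> t tab; (apply: ccont_Re || apply: ccont_Im); exact: cf.
Qed.

(** The factor 2 comes from bounding real and imaginary parts separately. It is harmless wherever a
    constant may be lost; the maximum principle has to remove it. *)
Lemma cint_bound a b f (M : R) : a <= b ->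
  (forall t, a <= t <= b -> {for t, continuous f}) ->
  (forall t, a <= t <= b -> cabs (f t) <= M) ->
  cabs (cint a b f) <= 2 * (M * (b - a)).
Proof.
move=> ab cf fM; apply: (le_trans (cabs_le_ReIm _)); rewrite /= mulr2n mulrDl mul1r.
apply: lerD; apply: rint_bound => // t tab.
- by apply: ccont_Re; exact: cf.
- by rewrite (le_trans (Re_le_cabs _))// fM.
- by apply: ccont_Im; exact: cf.
- by rewrite (le_trans (Im_le_cabs _))// fM.
Qed.

End complex_interval_integrals.

(** * Goursat's theorem on rectangles *)

Section goursat.
Context (R : realType).
Implicit Types (G : cplane R -> cplane R) (a b c d : R).

Definition inrect a b c d (z : cplane R) :=
  a <= complex.Re z <= b /\ c <= complex.Im z <= d.

(** The counterclockwise contour integral of [G] along the boundary of the rectangle, with opposite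
    sides paired into a single integral. *)
Definition bdint G a b c d : cplane R :=
  'i * cint c d (fun t => G (b +i* t) - G (a +i* t)) -
  cint a b (fun s => G (s +i* d) - G (s +i* c)).

Lemma ccont_vline G a t : {for (a +i* t : cplane R), continuous G} ->
  {for t, continuous (fun t : R => G (a +i* t))}.
Proof.
move=> cG; apply: (@continuous_comp R (cplane R) (cplane R) (fun t => a +i* t) G); last exact: cG.
by apply: ccont_complex; [exact: cst_continuous|exact: cvg_id].
Qed.

Lemma ccont_hline G c s : {for (s +i* c : cplane R), continuous G} ->
  {for s, continuous (fun s : R => G (s +i* c))}.
Proof.
move=> cG; apply: (@continuous_comp R (cplane R) (cplane R) (fun s => s +i* c) G); last exact: cG.
by apply: ccont_complex; [exact: cvg_id|exact: cst_continuous].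
Qed.

Lemma bdint_splith G a m b c d : a <= m -> m <= b -> c <= d ->
  (forall z, inrect a b c d z -> {for z, continuous G}) ->
  bdint G a b c d = bdint G a m c d + bdint G m b c d.
Proof.
move=> am mb cd cG; rewrite /bdint.
have lec x : c <= x -> x <= d -> c <= x <= d by move=> -> ->.
rewrite (cint_cat am mb); last first.
  move=> s /andP[s1 s2]; apply: ccontB; apply: ccont_hline; apply: cG; split=> /=;
    by rewrite ?s1 ?s2 ?lexx ?cd.
have -> : cint c d (fun t => G (b +i* t) - G (a +i* t)) =
   cint c d (fun t => G (m +i* t) - G (a +i* t)) +
   cint c d (fun t => G (b +i* t) - G (m +i* t)).
  rewrite -cintD; first by apply: cint_ext => t _; ring.
    move=> t /andP[t1 t2]; apply: ccontB; apply: ccont_vline; apply: cG; split=> /=;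
    by rewrite ?t1 ?t2 ?lexx ?am ?mb ?(le_trans am mb).
  move=> t /andP[t1 t2]; apply: ccontB; apply: ccont_vline; apply: cG; split=> /=;
    by rewrite ?t1 ?t2 ?lexx ?am ?mb ?(le_trans am mb).
ring.
Qed.

Lemma bdint_splitv G a b c m d : a <= b -> c <= m -> m <= d ->
  (forall z, inrect a b c d z -> {for z, continuous G}) ->
  bdint G a b c d = bdint G a b c m + bdint G a b m d.
Proof.
move=> ab cm md cG; rewrite /bdint.
rewrite (cint_cat cm md); last first.
  move=> s /andP[s1 s2]; apply: ccontB; apply: ccont_vline; apply: cG; split=> /=;
    by rewrite ?s1 ?s2 ?lexx ?ab.
have -> : cint a b (fun t => G (t +i* d) - G (t +i* c)) =
   cint a b (fun t => G (t +i* m) - G (t +i* c)) +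
   cint a b (fun t => G (t +i* d) - G (t +i* m)).
  rewrite -cintD; first by apply: cint_ext => t _; ring.
    move=> t /andP[t1 t2]; apply: ccontB; apply: ccont_hline; apply: cG; split=> /=;
    by rewrite ?t1 ?t2 ?lexx ?cm ?md ?(le_trans cm md).
  move=> t /andP[t1 t2]; apply: ccontB; apply: ccont_hline; apply: cG; split=> /=;
    by rewrite ?t1 ?t2 ?lexx ?cm ?md ?(le_trans cm md).
ring.
Qed.

(** The contour integral of an affine function vanishes, so only the remainder, at most [e * P] on
    the rectangle, contributes. The constant 4 is the number 2 of points in each difference times
    the factor 2 of [cint_bound]. *)
Lemma bdint_affine_approx G a b c d (p l : cplane R) (e : R) : a <= b -> c <= d ->
  (forall z, inrect a b c d z -> {for z, continuous G}) ->
  inrect a b c d p -> 0 <= e ->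
  (forall z, inrect a b c d z -> cabs (G z - G p - l * (z - p)) <= e * cabs (z - p)) ->
  cabs (bdint G a b c d) <= 4 * e * (b - a + (d - c)) ^+ 2.
Proof.
move=> ab cd cG [p1 p2] e0 H; set P := b - a + (d - c).
have HP z : inrect a b c d z -> cabs (G z - G p - l * (z - p)) <= e * P.
  move=> zQ; apply: (le_trans (H _ zQ)); apply: ler_wpM2l => //.
  case: zQ => z1 z2; apply: (le_trans (cabs_le_ReIm _)); rewrite !ReImE.
  have h1 : `|complex.Re z - complex.Re p| <= b - a by rewrite ler_norml; lra.
  have h2 : `|complex.Im z - complex.Im p| <= d - c by rewrite ler_norml; lra.
  exact: lerD.
have v1 t : c <= t <= d -> inrect a b c d (b +i* t) by split; rewrite /= ?ab ?lexx.
have v2 t : c <= t <= d -> inrect a b c d (a +i* t) by split; rewrite /= ?ab ?lexx.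
have w1 t : a <= t <= b -> inrect a b c d (t +i* d) by split; rewrite /= ?cd ?lexx.
have w2 t : a <= t <= b -> inrect a b c d (t +i* c) by split; rewrite /= ?cd ?lexx.
(* [k1] and [k2] are the differences of the affine part between opposite sides; being constant, they
   integrate to two terms that cancel. *)
pose k1 : cplane R := l * (b - a)%:C.
pose k2 : cplane R := l * ('i * (d - c)%:C).
have -> : bdint G a b c d =
  'i * cint c d (fun t => (G (b +i* t) - G (a +i* t)) - k1) -
  cint a b (fun s => (G (s +i* d) - G (s +i* c)) - k2).
  rewrite (@cintB _ _ _ (fun t => G (b +i* t) - G (a +i* t)) (fun=> k1)).
  rewrite (@cintB _ _ _ (fun s => G (s +i* d) - G (s +i* c)) (fun=> k2)) ?cint_cst//.
  - rewrite /bdint /k1 /k2; ring.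
  - by move=> t tI; apply: ccontB; apply: ccont_hline; apply: cG; [exact: w1|exact: w2].
  - by move=> t tI; exact: ccont_cst.
  - by move=> t tI; apply: ccontB; apply: ccont_vline; apply: cG; [exact: v1|exact: v2].
  - by move=> t tI; exact: ccont_cst.
have B1 : cabs (cint c d (fun t => (G (b +i* t) - G (a +i* t)) - k1)) <=
    2 * (2 * (e * P) * (d - c)).
  apply: cint_bound => // t tI.
    apply: ccontB; last exact: ccont_cst.
    by apply: ccontB; apply: ccont_vline; apply: cG; [exact: v1|exact: v2].
  have -> : G (b +i* t) - G (a +i* t) - k1 =
     (G (b +i* t) - G p - l * ((b +i* t) - p)) - (G (a +i* t) - G p - l * ((a +i* t) - p)).
    have -> : k1 = l * ((b +i* t) - (a +i* t)).
      by congr (_ * _); apply: complex_eq; rewrite !ReImE/= ?subrr.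
    ring.
  apply: (le_trans (cabsD _ _)); rewrite cabsN mulr2n mulrDl mul1r.
  by apply: lerD; apply: HP; [exact: v1|exact: v2].
have B2 : cabs (cint a b (fun s => (G (s +i* d) - G (s +i* c)) - k2)) <=
    2 * (2 * (e * P) * (b - a)).
  apply: cint_bound => // t tI.
    apply: ccontB; last exact: ccont_cst.
    by apply: ccontB; apply: ccont_hline; apply: cG; [exact: w1|exact: w2].
  have -> : G (t +i* d) - G (t +i* c) - k2 =
     (G (t +i* d) - G p - l * ((t +i* d) - p)) - (G (t +i* c) - G p - l * ((t +i* c) - p)).
    have -> : k2 = l * ((t +i* d) - (t +i* c)).
      by congr (_ * _); apply: complex_eq; rewrite !ReImE/= ?subrr; ring.
    ring.
  apply: (le_trans (cabsD _ _)); rewrite cabsN mulr2n mulrDl mul1r.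
  by apply: lerD; apply: HP; [exact: w1|exact: w2].
apply: (le_trans (cabsD _ _)); rewrite cabsN cabsM.
have -> : cabs ('i : cplane R) = 1 by rewrite cabsE /= expr0n/= expr1n add0r sqrtr1.
rewrite mul1r; apply: (le_trans (lerD B1 B2)).
by rewrite le_eqVlt; apply/orP; left; apply/eqP; rewrite /P; ring.
Qed.

(** If every quarter obeyed the bound with half the semiperimeter, the four bounds would add up to
    [eta * P ^+ 2] for the whole rectangle. *)
Lemma bdint_quarter G a b c d (eta : R) : a <= b -> c <= d ->
  (forall z, inrect a b c d z -> {for z, continuous G}) ->
  eta * (b - a + (d - c)) ^+ 2 < cabs (bdint G a b c d) ->
  exists a' b' c' d', [/\ a <= a' /\ a' <= b' /\ b' <= b,
    c <= c' /\ c' <= d' /\ d' <= d,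
    b' - a' + (d' - c') = (b - a + (d - c)) / 2 &
    eta * (b' - a' + (d' - c')) ^+ 2 < cabs (bdint G a' b' c' d')].
Proof.
move=> ab cd cG H; apply: contrapT => nex.
pose m := (a + b) / 2; pose n := (c + d) / 2.
have am : a <= m by rewrite /m; lra.
have mb : m <= b by rewrite /m; lra.
have cn : c <= n by rewrite /n; lra.
have nd : n <= d by rewrite /n; lra.
set P := b - a + (d - c) in H nex.
have Q a' b' c' d' : a <= a' /\ a' <= b' /\ b' <= b -> c <= c' /\ c' <= d' /\ d' <= d ->
    b' - a' + (d' - c') = P / 2 -> cabs (bdint G a' b' c' d') <= eta * (P / 2) ^+ 2.
  move=> h1 h2 h3; rewrite leNgt; apply/negP => h4; apply: nex.
  by exists a', b', c', d'; split => //; rewrite h3.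
have Q1 : cabs (bdint G a m c n) <= eta * (P / 2) ^+ 2.
  by apply: Q; rewrite ?lexx ?am ?cn ?mb ?nd//; rewrite /P /m /n; lra.
have Q2 : cabs (bdint G m b c n) <= eta * (P / 2) ^+ 2.
  by apply: Q; rewrite ?lexx ?am ?cn ?mb ?nd//; rewrite /P /m /n; lra.
have Q3 : cabs (bdint G a m n d) <= eta * (P / 2) ^+ 2.
  by apply: Q; rewrite ?lexx ?am ?cn ?mb ?nd//; rewrite /P /m /n; lra.
have Q4 : cabs (bdint G m b n d) <= eta * (P / 2) ^+ 2.
  by apply: Q; rewrite ?lexx ?am ?cn ?mb ?nd//; rewrite /P /m /n; lra.
move: H; rewrite ltNge => /negP; apply.
rewrite (bdint_splith am mb cd cG) (@bdint_splitv _ a m c n d)//; last first.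
  by move=> z [z1 z2]; apply: cG; split=> //; lra.
rewrite (@bdint_splitv _ m b c n d)//; last first.
  by move=> z [z1 z2]; apply: cG; split=> //; lra.
have T1 := cabsD (bdint G a m c n + bdint G a m n d) (bdint G m b c n + bdint G m b n d).
have T2 := cabsD (bdint G a m c n) (bdint G a m n d).
have T3 := cabsD (bdint G m b c n) (bdint G m b n d).
have -> : eta * P ^+ 2 = eta * (P / 2) ^+ 2 + eta * (P / 2) ^+ 2 +
  (eta * (P / 2) ^+ 2 + eta * (P / 2) ^+ 2) by field.
apply: (le_trans T1); apply: lerD.
  by apply: (le_trans T2); exact: lerD.
by apply: (le_trans T3); exact: lerD.
Qed.

(** Repeated quartering gives nested rectangles whose integrals stay above [eta] times the square of
    the semiperimeter. At their common point this contradicts differentiability. *)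
Theorem goursat G a b c d : a <= b -> c <= d ->
  (forall z, inrect a b c d z -> derivable G z 1) -> bdint G a b c d = 0.
Proof.
move=> ab cd dG; apply/eqP; apply: contrapT => /negP J0.
have cG z : inrect a b c d z -> {for z, continuous G}.
  by move=> /dG; exact: derivable_ccont.
pose P0 := b - a + (d - c).
(* The denominator [P0 ^+ 2 + 1] keeps the inequality strict and the quotient meaningful even for a
   degenerate rectangle. *)
have [eta eta0 H0] : exists2 eta : R, 0 < eta & eta * P0 ^+ 2 < cabs (bdint G a b c d).
  have J1 : 0 < cabs (bdint G a b c d) by rewrite cabs_gt0.
  exists (cabs (bdint G a b c d) / (P0 ^+ 2 + 1)).
    by rewrite divr_gt0// ltr_wpDl// sqr_ge0.
  rewrite mulrAC ltr_pdivrMr; last by rewrite ltr_wpDl// sqr_ge0.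
  by rewrite ltr_pM2l// ltrDl.
pose bad (q : R * R * R * R) := let: (a', b', c', d') := q in
  [/\ a <= a' /\ a' <= b' /\ b' <= b, c <= c' /\ c' <= d' /\ d' <= d &
   eta * (b' - a' + (d' - c')) ^+ 2 < cabs (bdint G a' b' c' d')].
(* Badness of [q] is a premise inside the relation, so that every quadruple has a successor, as
   [dependent_choice] requires; quadruples that are not bad get a dummy one. *)
pose sub (q r : R * R * R * R) := bad q ->
  let: (a1, b1, c1, d1) := q in let: (a2, b2, c2, d2) := r in
  [/\ bad r, a1 <= a2 /\ b2 <= b1, c1 <= c2 /\ d2 <= d1 &
   b2 - a2 + (d2 - c2) = (b1 - a1 + (d1 - c1)) / 2].
have step q : {r | sub q r}.
  apply: cid; move: q => [[[a1 b1] c1] d1].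
  have [[h1 h2 h3]|nb] := pselect (bad (a1, b1, c1, d1)); last by exists (0,0,0,0).
  case: h1 => aa1 [ab1 bb1]; case: h2 => cc1 [cd1 dd1].
  have cG1 z : inrect a1 b1 c1 d1 z -> {for z, continuous G}.
    by move=> [z1 z2]; apply: cG; split=> //; move: z1 z2 aa1 bb1 cc1 dd1; clear; lra.
  have [a' [b' [c' [d' [k1 k2 k3 k4]]]]] := bdint_quarter ab1 cd1 cG1 h3.
  exists (a', b', c', d') => _.
  case: k1 k2 => k11 [k12 k13] [k21 [k22 k23]].
  by split => //; split => //; rewrite ?(le_trans aa1) ?(le_trans cc1) ?(le_trans k13) ?(le_trans k23).
have [q [q0 qS]] := dependent_choice step (a, b, c, d).
pose A n := (q n).1.1.1; pose B n := (q n).1.1.2.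
pose C n := (q n).1.2; pose D n := (q n).2.
have qE n : q n = (A n, B n, C n, D n).
  by rewrite /A /B /C /D; case: (q n) => [[[? ?] ?] ?].
have badq n : bad (q n).
  elim: n => [|n IH]; first by rewrite q0; split=> //; rewrite ?lexx.
  by have := qS n IH; rewrite (qE n) (qE n.+1) => -[].
have subq n : [/\ A n <= A n.+1 /\ B n.+1 <= B n, C n <= C n.+1 /\ D n.+1 <= D n &
   B n.+1 - A n.+1 + (D n.+1 - C n.+1) = (B n - A n + (D n - C n)) / 2].
  by have := qS n (badq n); rewrite (qE n) (qE n.+1) => -[].
have badE n : [/\ a <= A n /\ A n <= B n /\ B n <= b, c <= C n /\ C n <= D n /\ D n <= d &
   eta * (B n - A n + (D n - C n)) ^+ 2 < cabs (bdint G (A n) (B n) (C n) (D n))].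
  by have := badq n; rewrite (qE n).
have mono m n : [/\ A m <= A (m + n)%N, B (m + n)%N <= B m,
                   C m <= C (m + n)%N & D (m + n)%N <= D m].
  elim: n => [|n [i1 i2 i3 i4]]; first by rewrite addn0.
  rewrite addnS; have [[s1 s2] [s3 s4] _] := subq (m + n)%N.
  by split; [exact: le_trans s1|exact: le_trans i2|exact: le_trans s3|exact: le_trans i4].
have AB m n : A m <= B n.
  have [k1 _ _ _] := mono m n; have [_ k2 _ _] := mono n m.
  have [[_ [k3 _]] _ _] := badE (m + n)%N; rewrite addnC in k2.
  exact: le_trans (le_trans k3 k2).
have CD m n : C m <= D n.
  have [_ _ k1 _] := mono m n; have [_ _ _ k2] := mono n m.
  have [_ [_ [k3 _]] _] := badE (m + n)%N; rewrite addnC in k2.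
  exact: le_trans (le_trans k3 k2).
have P2 n : B n - A n + (D n - C n) = P0 / 2 ^+ n.
  elim: n => [|n IH].
    by rewrite /A /B /C /D q0 /= expr0 divr1.
  by have [_ _ ->] := subq n; rewrite IH exprS invfM mulrA mulrAC.
pose s := sup (range A); pose t := sup (range C).
have As n : A n <= s.
  apply: ub_le_sup; last by exists n.
  by exists (B 0%N) => _ [m _ <-].
have sB n : s <= B n.
  by apply: ge_sup; [exists (A 0%N); exists 0%N|move=> _ [m _ <-]].
have Ct n : C n <= t.
  apply: ub_le_sup; last by exists n.
  by exists (D 0%N) => _ [m _ <-].
have tD n : t <= D n.
  by apply: ge_sup; [exists (C 0%N); exists 0%N|move=> _ [m _ <-]].
pose p : cplane R := s +i* t.
have pq n : inrect (A n) (B n) (C n) (D n) p by split; rewrite /= ?As ?sB ?Ct ?tD.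
have pQ : inrect a b c d p by have := pq 0%N; rewrite /A /B /C /D q0.
(* The tolerance [eta / 4] absorbs the factor 4 of [bdint_affine_approx]. *)
have /derivableP/is_derive_cplaneP/(_ (eta / 4)) := dG _ pQ.
case; first by rewrite divr_gt0.
move=> del del0 Hdel.
have [n Hn] : exists n, P0 / 2 ^+ n < del.
  have P00 : 0 <= P0 by rewrite addr_ge0// subr_ge0.
  exists (Num.trunc (P0 / del)).+1.
  rewrite ltr_pdivrMr ?exprn_gt0// mulrC -ltr_pdivrMr//.
  have := truncnS_gt (P0 / del) => h; apply: (lt_trans h).
  by rewrite -natrX ltr_nat; apply: ltn_expl.
have [[h1 [h2 h3]] [h4 [h5 h6]]] := badE n.
rewrite ltNge => /negP; apply.
have -> : eta = 4 * (eta / 4) by field.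
apply: (@bdint_affine_approx _ _ _ _ _ p ('D_1 G p)) => //.
- by move=> z [z1 z2]; apply: cG; split=> //; move: z1 z2 h1 h3 h4 h6; clear; lra.
- by rewrite ltW// divr_gt0.
move=> z [z1 z2]; apply: Hdel; apply: le_lt_trans Hn.
apply: (le_trans (cabs_le_ReIm _)); rewrite -P2 !ReImE /=.
have k1 : `|complex.Re z - s| <= B n - A n.
  by move: z1 (As n) (sB n); rewrite ler_norml; clear; lra.
have k2 : `|complex.Im z - t| <= D n - C n.
  by move: z2 (Ct n) (tD n); rewrite ler_norml; clear; lra.
exact: lerD.
Qed.

End goursat.

(** * Cauchy's formula on circles *)

Section circles.
Context (R : realType).
Implicit Types (f : cplane R -> cplane R) (a c z w : cplane R) (r t : R).

Definition circ c r t : cplane R := c + ((r * cos t) +i* (r * sin t)).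

(** This is [2 * pi] times the mean over the circle, that is, the contour integral of
    [f z / ('i * (z - c))]. *)
Definition circint f c r : cplane R := cint (- pi) pi (fun t => f (circ c r t)).

Lemma cabs_circ c r t : cabs (circ c r t - c) = `|r|.
Proof.
rewrite /circ addrC addKr cabsE /= !exprMn -mulrDr cos2Dsin2 mulr1.
exact: sqrtr_sqr.
Qed.

Lemma circ_cexp c r t : 0 < r -> circ c r t = c + cexp (ln r +i* t).
Proof. by move=> r0; rewrite /circ /cexp /= lnK ?posrE. Qed.

Lemma continuous_circ c (T : topologicalType) (x : T) (u v : T -> R) :
  {for x, continuous u} -> {for x, continuous v} ->
  {for x, continuous (fun y => circ c (u y) (v y))}.
Proof.
move=> cu cv; apply: ccontD; first exact: ccont_cst.
apply: ccont_complex; apply: (@continuousM R T) => //.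
  by apply: (@continuous_comp _ _ _ v (@cos R)) => //; exact: continuous_cos.
by apply: (@continuous_comp _ _ _ v (@sin R)) => //; exact: continuous_sin.
Qed.

Lemma ccont_circ f c r t : {for circ c r t, continuous f} ->
  {for t, continuous (fun t => f (circ c r t))}.
Proof.
move=> cf; apply: (@continuous_comp R (cplane R) (cplane R) (circ c r) f); last exact: cf.
by apply: continuous_circ; [exact: cst_continuous|exact: cvg_id].
Qed.

Lemma Npi_pi : - pi <= pi :> R.
Proof. by have := pi_ge0 R; lra. Qed.

(** The map [z |-> c + cexp z] wraps the rectangle with sides [[ln r1, ln r2]] and [[- pi, pi]]
    around the annulus. The horizontal sides cancel by periodicity, so Goursat's theorem equates the
    vertical ones, which are the two circles. *)
Lemma circint_const_annulus f c r1 r2 : 0 < r1 -> r1 <= r2 ->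
  (forall z, r1 <= cabs (z - c) <= r2 -> derivable f z 1) ->
  circint f c r1 = circint f c r2.
Proof.
move=> r10 r12 df; have r20 := lt_le_trans r10 r12.
pose G z : cplane R := f (c + cexp z).
have Gd z : inrect (ln r1) (ln r2) (- pi) pi z -> derivable G z 1.
  move=> [/andP[z1 z2] _]; apply: (@cderivable_comp R f (fun z => c + cexp z)).
    by apply: cderivableD; [exact: cderivable_cst|exact: derivable_cexp].
  apply: df; rewrite addrC addKr cabs_cexp.
  by rewrite -[r1]lnK ?posrE// -[r2]lnK ?posrE// !ler_expR z1 z2.
have l12 : ln r1 <= ln r2 by rewrite ler_ln ?posrE.
have := goursat l12 Npi_pi Gd.
rewrite /bdint.
have -> : cint (ln r1) (ln r2) (fun s => G (s +i* pi) - G (s +i* - pi)) = 0.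
  rewrite (@cint_ext _ _ _ _ (fun=> 0)); first by rewrite cint_cst// mul0r.
  by move=> t _; rewrite /G /cexp /= cosN sinN sinpi oppr0 subrr.
rewrite subr0 => /eqP; rewrite mulf_eq0 => /orP[/eqP[/eqP]|]; first by rewrite oner_eq0.
have cG x y : (x = ln r1) \/ (x = ln r2) -> -pi <= y <= pi -> {for y, continuous (fun t => G (x +i* t))}.
  move=> x12 yI; apply: ccont_vline; apply: derivable_ccont; apply: Gd.
  by split=> //=; case: x12 => ->; rewrite ?lexx ?l12.
rewrite cintB; last 2 first.
- by move=> t tI; apply: cG => //; right.
- by move=> t tI; apply: cG => //; left.
rewrite subr_eq0 => /eqP H; symmetry.
transitivity (cint (- pi) pi (fun t => G (ln r2 +i* t))).
  by apply: cint_ext => t _; rewrite circ_cexp.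
by rewrite H; apply: cint_ext => t _; rewrite circ_cexp.
Qed.

Lemma circint_cst c r (k : cplane R) : circint (fun=> k) c r = k * (2 * pi)%:C.
Proof. by rewrite /circint cint_cst ?Npi_pi//; congr (_ * _%:C); ring. Qed.

(** The circle mean does not depend on the radius, and as the radius shrinks it tends to the value
    at the centre by continuity alone. *)
Lemma mean_value_punctured f c r : 0 < r -> {for c, continuous f} ->
  (forall z, 0 < cabs (z - c) <= r -> derivable f z 1) ->
  circint f c r = f c * (2 * pi)%:C.
Proof.
move=> r0 cf df; apply/eqP; rewrite -subr_eq0 -cabs_eq0.
rewrite eq_le cabs_ge0 andbT.
suff H (e : R) : 0 < e -> cabs (circint f c r - f c * (2 * pi)%:C) <= e.
  by apply/ler_addgt0Pl => e /H; rewrite addr0.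
move=> e0; have pi0 := pi_gt0 R.
(* [cint_bound] on an interval of length [2 * pi] multiplies this tolerance by [4 * pi]. *)
have e40 : 0 < e / (4 * pi) by rewrite divr_gt0// mulr_gt0.
move/cvg_cplaneP : cf => /(_ _ e40) /nbhs_cplaneP[d d0 Hd].
pose r1 := Num.min r (d / 2).
have r10 : 0 < r1 by rewrite lt_min r0 divr_gt0.
have r1r : r1 <= r by rewrite ge_min lexx.
have r1d : r1 < d by rewrite gt_min; apply/orP; right; lra.
rewrite -(@circint_const_annulus _ c r1 r)//; last first.
  by move=> z /andP[z1 z2]; apply: df; rewrite z2 (lt_le_trans r10).
rewrite -(circint_cst c r1) /circint -cintB; last 2 first.
- move=> t _; apply: ccont_circ; apply: derivable_ccont; apply: df.
  by rewrite cabs_circ gtr0_norm// r10.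
- by move=> t _; exact: ccont_cst.
have pn0 : (pi : R) != 0 by rewrite gt_eqF.
have -> : e = 2 * (e / (4 * pi) * (pi - - pi)) by move: (pi : R) pn0 => P Pn0; field.
apply: cint_bound; first exact: Npi_pi.
  move=> t _; apply: ccontB; last exact: ccont_cst.
  apply: ccont_circ; apply: derivable_ccont; apply: df.
  by rewrite cabs_circ gtr0_norm// r10.
by move=> t _; rewrite ltW//; apply: Hd; rewrite cabs_circ gtr0_norm.
Qed.

Lemma mean_value f c r : 0 < r ->
  (forall z, cabs (z - c) <= r -> derivable f z 1) ->
  circint f c r = f c * (2 * pi)%:C.
Proof.
move=> r0 df; apply: mean_value_punctured => //.
  by apply: derivable_ccont; apply: df; rewrite subrr cabs0 ltW.
by move=> z /andP[_ zr]; exact: df.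
Qed.

Lemma bounded_box (g : R * R -> cplane R) (a b c d : R) : a <= b -> c <= d ->
  (forall x y, a <= x <= b -> c <= y <= d -> {for (x, y), continuous g}) ->
  exists M : R, forall x y, a <= x <= b -> c <= y <= d -> cabs (g (x, y)) <= M.
Proof.
move=> ab cd cg.
have K : compact (`[a, b]%classic `*` `[c, d]%classic : set (R * R)).
  by apply: compact_setX; exact: segment_compact.
have [||[x0 y0] _ H] := @compact_EVT_max _ R (fun p => cabs (g p)) _ _ K.
- by exists (a, c); split => /=; rewrite in_itv /= lexx.
- apply: continuous_in_subspaceT => -[x y] /set_mem [/=]; rewrite !in_itv/= => xI yI.
  by apply: ccont_cabs; exact: cg.
exists (cabs (g (x0, y0))) => x y xI yI; apply: H; apply/mem_set.
by split; rewrite /= in_itv.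
Qed.

Lemma rint_param_continuous (F : R -> R -> R) (a b u v x0 M : R) : a <= b -> u < x0 < v ->
  (forall x t, u <= x <= v -> a <= t <= b -> {for t, continuous (F x)}) ->
  (forall x t, u <= x <= v -> a <= t <= b -> {for x, continuous (F ^~ t)}) ->
  (forall x t, u <= x <= v -> a <= t <= b -> `|F x t| <= M) ->
  {for x0, continuous (fun x => rint a b (F x))}.
Proof.
move=> ab x0I ct cx bM.
have sub x : `]u, v[%classic x -> u <= x <= v.
  by rewrite /= in_itv /= => /andP[u1 v1]; rewrite !ltW.
apply: (@continuity_under_integral R _ (measurableTypeR R) (@lebesgue_measure R) F `[a, b] _ u v _ _ (fun=> M)) => //.
- by move=> x xI; apply: cont_integrable => t tI; apply: ct => //; exact: sub.
- apply: aeW => t /=; rewrite in_itv /= => tI x /set_mem xI; apply: cx => //; exact: sub.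
- by apply: cont_integrable => t tI; exact: cst_continuous.
- move=> x xI; apply: aeW => t /=; rewrite in_itv /= => tI; apply: bM => //; exact: sub.
- by rewrite inE /= in_itv.
Qed.
End circles.

Section cauchy_integral.
Context (R : realType).
Implicit Types (f : cplane R -> cplane R) (a c z w : cplane R) (r t : R).

Lemma cderivable_subr f a z : derivable f z 1 -> derivable (fun w => f w - a : cplane R) z 1.
Proof.
by move=> df; apply: (@cderivableB R f (fun=> a)); [exact: df|exact: cderivable_cst].
Qed.

Lemma cderivable_kernel f a z : z - a != 0 -> derivable f z 1 ->
  derivable (fun w => f w / (w - a) : cplane R) z 1.
Proof.
move=> za df; apply: (@cderivableM R f (fun w => (w - a)^-1)); first exact: df.
apply: (@cderivableV R (fun w => w - a)); first exact: za.
by apply: (@cderivable_subr (fun w => w)); exact: cderivable_id.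
Qed.

Lemma ccont_subr (T : topologicalType) (f : T -> cplane R) (x : T) a :
  {for x, continuous f} -> {for x, continuous (fun y => f y - a)}.
Proof. by move=> cf; apply: ccontB; [exact: cf|exact: ccont_cst]. Qed.

Lemma ccont_kernel (T : topologicalType) (f g : T -> cplane R) (x : T) a :
  {for x, continuous f} -> {for x, continuous g} -> g x - a != 0 ->
  {for x, continuous (fun y => f y / (g y - a))}.
Proof.
move=> cf cg gxa; apply: ccontM; first exact: cf.
by apply: ccontV; [exact: gxa|exact: ccont_subr].
Qed.

Lemma ccont_epsP f z : {for z, continuous f} <-> forall e : R, 0 < e ->
  exists2 d : R, 0 < d & forall w, cabs (w - z) < d -> cabs (f w - f z) < e.
Proof.
split=> [cf e e0|H].
  by move/(@cvg_cplaneP R _ (nbhs z)) : cf => /(_ _ e0) /nbhs_cplaneP.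
by apply/(@cvg_cplaneP R _ (nbhs z)) => e /H ?; exact/nbhs_cplaneP.
Qed.

Lemma eq_left_continuous (g : R -> R) (u x k : R) : u < x -> {for x, continuous g} ->
  (forall y, u < y < x -> g y = k) -> g x = k.
Proof.
move=> ux cg gk; apply/eqP; rewrite -subr_eq0 -normr_le0; apply/ler_addgt0Pl => e e0.
rewrite addr0; move/(@cvgrPdist_lt R R _ (nbhs x)) : cg => /(_ _ e0)/nbhs_ballP[d /= d0 Hd].
pose y := Num.max ((u + x) / 2) (x - d / 2).
have yx : y < x by rewrite gt_max; apply/andP; split; move: d0 ux; clear; lra.
rewrite -(gk y); last by rewrite yx andbT lt_max; apply/orP; left; move: ux; clear; lra.
rewrite ltW//; apply: Hd; rewrite /ball/= gtr0_norm ?subr_gt0//.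
have : x - d / 2 <= y by rewrite le_max lexx orbT.
by move: d0; clear; lra.
Qed.

Lemma eq_right_continuous (g : R -> R) (v x k : R) : x < v -> {for x, continuous g} ->
  (forall y, x < y < v -> g y = k) -> g x = k.
Proof.
move=> xv cg gk; apply/eqP; rewrite -subr_eq0 -normr_le0; apply/ler_addgt0Pl => e e0.
rewrite addr0; move/(@cvgrPdist_lt R R _ (nbhs x)) : cg => /(_ _ e0)/nbhs_ballP[d /= d0 Hd].
pose y := Num.min ((x + v) / 2) (x + d / 2).
have xy : x < y by rewrite lt_min; apply/andP; split; move: d0 xv; clear; lra.
rewrite -(gk y); last by rewrite xy /= gt_min; apply/orP; left; move: xv; clear; lra.
rewrite ltW//; apply: Hd; rewrite /ball/= distrC gtr0_norm ?subr_gt0//.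
have : y <= x + d / 2 by rewrite ge_min lexx orbT.
by move: d0; clear; lra.
Qed.

(* The circle means are constant on either side of the radius of the
   exceptional point, and continuous in the radius. *)
Lemma mean_value_exceptional f a c r : cabs (a - c) < r ->
  (forall z, cabs (z - c) <= r -> {for z, continuous f}) ->
  (forall z, z != a -> cabs (z - c) <= r -> derivable f z 1) ->
  circint f c r = f c * (2 * pi)%:C.
Proof.
move=> ar cf df; have r0 := le_lt_trans (cabs_ge0 _) ar.
have [d0|d0] := leP (cabs (a - c)) 0.
  have ac : a = c by apply/eqP; rewrite -subr_eq0 -cabs_eq0 eq_le d0 cabs_ge0.
  apply: mean_value_punctured => //; first by apply: cf; rewrite subrr cabs0 ltW.
  by move=> z /andP[z0 zr]; apply: df => //; rewrite ac -subr_eq0 -cabs_gt0.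
set d := cabs (a - c) in ar d0.
have cirD t (x : R) : 0 <= x -> x <= r -> cabs (circ c x t - c) <= r.
  by move=> x0 xr; rewrite cabs_circ ger0_norm.
have [M HM] : exists M : R, forall x t, 0 <= x <= r -> - pi <= t <= pi ->
    cabs (f (circ c x t)) <= M.
  apply: (@bounded_box R (fun p => f (circ c p.1 p.2))) => //; first exact: ltW.
    exact: Npi_pi.
  move=> x t /andP[x0 xr] _.
  apply: (@continuous_comp _ _ _ (fun p : R * R => circ c p.1 p.2) f).
    by apply: continuous_circ; [exact: cvg_fst|exact: cvg_snd].
  by apply: cf; exact: cirD.
have inI (x : R) : d / 2 <= x <= r -> 0 <= x /\ x <= r.
  by move=> /andP[x1 ->]; split=> //; move: x1 d0; clear; lra.
have dI : d / 2 < d < r by rewrite ar andbT; move: d0; clear; lra.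
have cx x t : d / 2 <= x <= r -> {for x, continuous (fun x => f (circ c x t))}.
  move=> /inI[x0 xr]; apply: (@continuous_comp _ _ _ (fun x => circ c x t) f).
    by apply: continuous_circ; [exact: cvg_id|exact: cst_continuous].
  by apply: cf; exact: cirD.
have ct x t : d / 2 <= x <= r -> {for t, continuous (fun t => f (circ c x t))}.
  by move=> /inI[x0 xr]; apply: ccont_circ; apply: cf; exact: cirD.
have left_mean x : 0 < x < d -> circint f c x = f c * (2 * pi)%:C.
  move=> /andP[x0 xd]; apply: mean_value => // z zx; apply: df.
    by apply: contraTN xd => /eqP za; rewrite -leNgt /d -za.
  by rewrite (le_trans zx)// ltW// (lt_trans xd).
have right_mean x : d < x < r -> circint f c x = circint f c r.
  move=> /andP[dx xr]; apply: circint_const_annulus; rewrite ?(lt_trans d0)//; first exact: ltW.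
  move=> z /andP[z1 z2]; apply: df => //.
  by apply: contraTN dx => /eqP za; rewrite -leNgt /d -za.
pose IR x := rint (- pi) pi (fun t => complex.Re (f (circ c x t))).
have cRe : {for d, continuous IR}.
  apply: (@rint_param_continuous R (fun x t => complex.Re (f (circ c x t))) (- pi) pi (d / 2) r d M) => //.
  - exact: Npi_pi.
  - by move=> x t xI _; exact: (ccont_Re (ct x t xI)).
  - by move=> x t xI _; exact: (ccont_Re (cx x t xI)).
  - move=> x t /inI[x0 xr] tI; apply: (le_trans (Re_le_cabs _)).
    exact: (HM x t (introT andP (conj x0 xr)) tI).
pose II x := rint (- pi) pi (fun t => complex.Im (f (circ c x t))).
have cIm : {for d, continuous II}.
  apply: (@rint_param_continuous R (fun x t => complex.Im (f (circ c x t))) (- pi) pi (d / 2) r d M) => //.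
  - exact: Npi_pi.
  - by move=> x t xI _; exact: (ccont_Im (ct x t xI)).
  - by move=> x t xI _; exact: (ccont_Im (cx x t xI)).
  - move=> x t /inI[x0 xr] tI; apply: (le_trans (Im_le_cabs _)).
    exact: (HM x t (introT andP (conj x0 xr)) tI).
have cE x : circint f c x = IR x +i* II x by [].
have eRe : IR d = IR r.
  by apply: (eq_right_continuous ar cRe) => y /right_mean; rewrite !cE => -[].
have eIm : II d = II r.
  by apply: (eq_right_continuous ar cIm) => y /right_mean; rewrite !cE => -[].
rewrite cE -eRe -eIm; apply: complex_eq => /=.
  by apply: (eq_left_continuous d0 cRe) => y /left_mean <-; rewrite cE.
by apply: (eq_left_continuous d0 cIm) => y /left_mean <-; rewrite cE.
Qed.

(** The difference quotient with its removable singularity filled in; it serves to divide out zeros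
    and to avoid the pole of Cauchy's kernel. *)
Definition diffq f a z : cplane R :=
  if z == a then 'D_1 f a else (f z - f a) / (z - a).

Lemma diffqE f a z : f z = f a + diffq f a z * (z - a).
Proof.
rewrite /diffq; case: eqVneq => [->|za]; first by rewrite subrr mulr0 addr0.
by rewrite mulfVK ?subr_eq0// addrC subrK.
Qed.

Lemma continuous_diffq f a z : derivable f a 1 -> {for z, continuous f} ->
  {for z, continuous (diffq f a)}.
Proof.
move=> dfa cf; have [->|za] := eqVneq z a.
  apply/ccont_epsP => e e0.
  have e20 : 0 < e / 2 by rewrite divr_gt0.
  move/derivableP : dfa => /is_derive_cplaneP/(_ _ e20)[d d0 Hd].
  exists d => // w wa; rewrite /diffq eqxx; case: eqVneq => [_|wna].
    by rewrite subrr cabs0.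
  have wa0 : 0 < cabs (w - a) by rewrite cabs_gt0 subr_eq0.
  have -> : (f w - f a) / (w - a) - 'D_1 f a = (f w - f a - 'D_1 f a * (w - a)) / (w - a).
    by rewrite [RHS]mulrBl mulfK ?subr_eq0.
  rewrite cabsM cabsV ltr_pdivrMr//; apply: le_lt_trans (Hd _ wa) _.
  by rewrite ltr_pM2r//; move: e0; clear; lra.
have cq : {for z, continuous (fun w => (f w - f a) / (w - a))}.
  apply: (@ccont_kernel _ (fun w => f w - f a) (fun w => w)); last by rewrite subr_eq0.
    by apply: ccont_subr; exact: cf.
  exact: cvg_id.
apply/ccont_epsP => e e0; move/ccont_epsP : cq => /(_ _ e0)[d d0 Hd].
exists (Num.min d (cabs (z - a))).
  by rewrite lt_min d0 cabs_gt0 subr_eq0.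
move=> w; rewrite lt_min /diffq => /andP[wd wza].
rewrite !ifN_eq//; first exact: Hd.
by apply: contraTneq wza => ->; rewrite cabsB ltxx.
Qed.

Lemma derivable_diffq f a z : z != a -> derivable f z 1 -> derivable (diffq f a) z 1.
Proof.
move=> za dfz.
apply: (@near_eq_cderivable R (fun w => (f w - f a) / (w - a)) _ z (cabs (z - a))).
- by rewrite cabs_gt0 subr_eq0.
- move=> w wza; rewrite /diffq ifN_eq//.
  by apply: contraTneq wza => ->; rewrite cabsB ltxx.
- apply: (@cderivable_kernel (fun w => f w - f a)); first by rewrite subr_eq0.
  by apply: cderivable_subr; exact: dfz.
Qed.

Lemma circ_neq a c r t : 0 < r -> cabs (a - c) < r -> circ c r t - a != 0.
Proof.
move=> r0 ar; rewrite subr_eq0; apply: contraTneq ar => <-.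
by rewrite cabs_circ gtr0_norm// ltxx.
Qed.

Lemma ccont_circid c r t : {for t, continuous (circ c r)}.
Proof. by apply: continuous_circ; [exact: cst_continuous|exact: cvg_id]. Qed.

(** The function [(z - c) / (z - a)] is holomorphic outside the disc and tends to 1 at infinity. Its
    circle integral does not depend on the radius, hence equals that of the constant 1. *)
Lemma circint_cauchy_kernel a c r : cabs (a - c) < r ->
  cint (- pi) pi (fun t => (circ c r t - c) / (circ c r t - a)) = (2 * pi)%:C.
Proof.
move=> ar; have r0 := le_lt_trans (cabs_ge0 _) ar; have pi0 := pi_gt0 R.
pose h z : cplane R := (z - c) / (z - a).
rewrite -[LHS]/(circint h c r).
apply/eqP; rewrite -subr_eq0 -cabs_eq0 eq_le cabs_ge0 andbT.
suff H (e : R) : 0 < e -> cabs (circint h c r - (2 * pi)%:C) <= e.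
  by apply/ler_addgt0Pl => e /H; rewrite addr0.
move=> e0; set d := cabs (a - c) in ar.
have d0 : 0 <= d by exact: cabs_ge0.
(* On the circle of radius [r1] the kernel differs from 1 by at most [d / (r1 - d)], and this radius
   makes that at most [e / (4 * pi)]. *)
pose r1 := r + d + d * (4 * pi) / e.
have rr1 : r <= r1.
  by rewrite /r1 -addrA lerDl addr_ge0// divr_ge0 ?mulr_ge0// ltW.
have r10 : 0 < r1 by exact: lt_le_trans rr1.
have dr1 : d < r1 by exact: lt_le_trans rr1.
rewrite (@circint_const_annulus R _ c r r1)//; last first.
  move=> z /andP[z1 _]; apply: (@cderivable_kernel (fun w => w - c)).
    by rewrite subr_eq0; apply: contraTneq z1 => ->; rewrite -ltNge.
  by apply: (@cderivable_subr (fun w => w)); exact: cderivable_id.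
have -> : (2 * pi)%:C = circint (fun=> 1 : cplane R) c r1 by rewrite circint_cst mul1r.
have ch t : {for t, continuous (fun t => h (circ c r1 t))}.
  apply: ccont_kernel; [apply: ccont_subr; exact: ccont_circid|exact: ccont_circid|exact: circ_neq].
rewrite /circint -cintB; last 2 first.
- by move=> t _; exact: ch.
- by move=> t _; exact: ccont_cst.
have -> : e = 2 * (e / (4 * pi) * (pi - - pi)).
  have pn0 : (pi : R) != 0 by rewrite gt_eqF.
  by move: (pi : R) pn0 => P Pn0; field.
apply: cint_bound; first exact: Npi_pi.
  by move=> t _; apply: ccont_subr; exact: ch.
move=> t _; have nz := circ_neq t r10 dr1.
have -> : h (circ c r1 t) - 1 = (a - c) / (circ c r1 t - a).
  by rewrite /h -[X in _ - X](divff nz) -mulrBl; congr (_ / _); ring.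
rewrite cabsM cabsV -/d ler_pdivrMr ?cabs_gt0// -ler_pdivrMl ?divr_gt0 ?mulr_gt0//.
apply: (@le_trans _ _ (r1 - d)).
  have -> : (e / (4 * pi))^-1 * d = d * (4 * pi) / e.
    by rewrite invf_div [LHS]mulrC [LHS]mulrA.
  by rewrite /r1; move: (d * (4 * pi) / e) r0 => x; clear; lra.
have : cabs (circ c r1 t - c) <= cabs (circ c r1 t - a) + cabs (a - c).
  by rewrite -(subrK a (circ c r1 t)) -addrA (le_trans (cabsD _ _))// addrK.
by rewrite cabs_circ gtr0_norm// -/d; clear; lra.
Qed.

(** The function [(z - c) * diffq f a z] is continuous on the disc, holomorphic off [a], and zero at
    [c], so its circle mean vanishes. This says that [f] may be replaced by [f a] in the integral,
    and the kernel itself integrates to [2 * pi]. *)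
Theorem cauchy_formula f a c r : cabs (a - c) < r ->
  (forall z, cabs (z - c) <= r -> derivable f z 1) ->
  cint (- pi) pi (fun t => f (circ c r t) * ((circ c r t - c) / (circ c r t - a))) =
  f a * (2 * pi)%:C.
Proof.
move=> ar df; have r0 := le_lt_trans (cabs_ge0 _) ar.
pose h z : cplane R := (z - c) * diffq f a z.
have dfa : derivable f a 1 by apply: df; exact: ltW.
have cdiff z : cabs (z - c) <= r -> {for z, continuous (diffq f a)}.
  by move=> zr; apply: continuous_diffq; [exact: dfa|apply: derivable_ccont; exact: df].
have := @mean_value_exceptional h a c r ar.
have hc0 : h c = 0 by rewrite /h subrr mul0r.
rewrite hc0 mul0r => H.
have cdisc t : cabs (circ c r t - c) <= r by rewrite cabs_circ gtr0_norm.
have ck t : {for t, continuous (fun t => (circ c r t - c) / (circ c r t - a))}.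
  apply: ccont_kernel; [apply: ccont_subr; exact: ccont_circid|exact: ccont_circid|exact: circ_neq].
have cft t : {for t, continuous (fun t => f (circ c r t))}.
  by apply: ccont_circ; apply: derivable_ccont; exact: df.
rewrite -(circint_cauchy_kernel ar) -cintZ; last by move=> t _; exact: ck.
apply/eqP; rewrite -subr_eq0 -cintB.
- rewrite -[X in _ == X]H.
  + apply/eqP; apply: cint_ext => t _; rewrite /h -mulrBl.
    rewrite [X in X - _](diffqE f a) addrAC subrr add0r.
    have nz := @circ_neq a c r t r0 ar.
    by rewrite mulrACA mulfV ?nz// mulr1 mulrC.
  + move=> z zr; apply: ccontM; last exact: cdiff.
    by apply: ccont_subr; exact: cvg_id.
  + move=> z za zr; apply: (@cderivableM R (fun w => w - c)).
      by apply: (@cderivable_subr (fun w => w)); exact: cderivable_id.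
    by apply: derivable_diffq; [exact: za|exact: df].
- by move=> t _; apply: ccontM; [exact: cft|exact: ck].
- by move=> t _; apply: ccontM; [exact: ccont_cst|exact: ck].
Qed.

End cauchy_integral.

#[local] Opaque pi.

(** * Differentiation of Cauchy integrals and the maximum principle *)

Section cauchy_consequences.
Context (R : realType).
Implicit Types (f : cplane R -> cplane R) (a b c z w : cplane R) (r t : R).
Implicit Types (phi : R -> cplane R).

(** A Cauchy type integral in the variable [a], with an arbitrary continuous density [phi] on the
    circle. The factor [circ c r t - c] coming from the parametrization is left to [phi]. *)
Definition cauchyint phi (n : nat) c r a : cplane R :=
  cint (- pi) pi (fun t => phi t * ((circ c r t - a)^-1) ^+ n).

Lemma circ_dist_ge a c r t : 0 < r -> r - cabs (a - c) <= cabs (circ c r t - a).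
Proof.
move=> r0; have : cabs (circ c r t - c) <= cabs (circ c r t - a) + cabs (a - c).
  by rewrite -(subrK a (circ c r t)) -addrA (le_trans (cabsD _ _))// addrK.
by rewrite cabs_circ gtr0_norm//; move: (cabs _) (cabs _) => x y; clear; lra.
Qed.

Lemma ccont_cauchyint phi n c r a t : cabs (a - c) < r -> {for t, continuous phi} ->
  {for t, continuous (fun t => phi t * ((circ c r t - a)^-1) ^+ n)}.
Proof.
move=> ar cphi; have r0 := le_lt_trans (cabs_ge0 _) ar.
have ci : {for t, continuous (fun t => (circ c r t - a)^-1)}.
  apply: (@ccontV R _ (fun t => circ c r t - a)); first exact: circ_neq.
  by apply: ccont_subr; exact: ccont_circid.
elim: n => [|n IH].
  have -> : (fun t => phi t * (circ c r t - a)^-1 ^+ 0) = phi.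
    by apply/funext => s; rewrite expr0 mulr1.
  exact: cphi.
have -> : (fun t => phi t * (circ c r t - a)^-1 ^+ n.+1) =
   (fun t => (phi t * (circ c r t - a)^-1 ^+ n) * (circ c r t - a)^-1).
  by apply/funext => s; rewrite exprSr mulrA.
by apply: ccontM; [exact: IH|exact: ci].
Qed.

Lemma bounded_segment phi (a b : R) : a <= b ->
  (forall t, a <= t <= b -> {for t, continuous phi}) ->
  exists2 B : R, 0 <= B & forall t, a <= t <= b -> cabs (phi t) <= B.
Proof.
move=> ab cphi; have [|M HM] := @bounded_box R (fun p => phi p.1) a b 0 0 ab (lexx 0).
  move=> x y xI _; apply: (@continuous_comp _ _ _ (@fst R R) phi); first exact: cvg_fst.
  exact: cphi.
have M0 t : a <= t <= b -> cabs (phi t) <= M.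
  by move=> tI; apply: (HM t 0 tI); rewrite lexx.
exists M => //; apply: (le_trans (cabs_ge0 (phi a))); apply: M0.
by rewrite lexx.
Qed.

(* Both kernels have a second order Taylor remainder bounded by M h^2. *)
Lemma is_derive_cauchyint phi n c r a (M : R) : cabs (a - c) < r ->
  (forall t, - pi <= t <= pi -> {for t, continuous phi}) ->
  (forall t b, cabs (b - a) < (r - cabs (a - c)) / 2 ->
    cabs ((circ c r t - b)^-1 ^+ n - (circ c r t - a)^-1 ^+ n -
       n%:R * (circ c r t - a)^-1 ^+ n.+1 * (b - a)) <= M * cabs (b - a) ^+ 2) ->
  is_derive a 1 (cauchyint phi n c r) (n%:R * cauchyint phi n.+1 c r a).
Proof.
move=> ar cphi HM; have r0 := le_lt_trans (cabs_ge0 _) ar.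
have [B B0 HB] := bounded_segment (Npi_pi R) cphi.
have pi0 := pi_gt0 R.
apply/is_derive_cplaneP => e e0.
pose C := 2 * (B * `|M| * (pi - - pi)).
have C0 : 0 <= C.
  by rewrite !mulr_ge0// subr_ge0 Npi_pi.
have d0 : 0 < (r - cabs (a - c)) / 2 by rewrite divr_gt0// subr_gt0.
exists (Num.min ((r - cabs (a - c)) / 2) (e / (C + 1))).
  by rewrite lt_min d0 divr_gt0// ltr_wpDl.
move=> b; rewrite lt_min => /andP[bd be].
have br : cabs (b - c) < r.
  have : cabs (b - c) <= cabs (b - a) + cabs (a - c).
    by rewrite -(subrK a b) -addrA (le_trans (cabsD _ _))// addrK.
  by move: bd ar; move: (cabs _) (cabs _) (cabs _) => x y z; clear; lra.
have -> : cauchyint phi n c r b - cauchyint phi n c r a -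
    n%:R * cauchyint phi n.+1 c r a * (b - a) =
  cint (- pi) pi (fun t => phi t * ((circ c r t - b)^-1 ^+ n - (circ c r t - a)^-1 ^+ n -
       n%:R * (circ c r t - a)^-1 ^+ n.+1 * (b - a))).
  rewrite mulrAC (mulrC _ (cauchyint _ _ _ _ _)) (mulrC _ (n%:R * _)).
  rewrite /cauchyint -cintB; last 2 first.
  - by move=> t tI; apply: ccont_cauchyint; [exact: br|exact: cphi].
  - by move=> t tI; apply: ccont_cauchyint; [exact: ar|exact: cphi].
  rewrite -cintZ; last by move=> t tI; apply: ccont_cauchyint; [exact: ar|exact: cphi].
  rewrite -cintB; last 2 first.
  - move=> t tI; apply: ccontB; apply: ccont_cauchyint; [exact: br|exact: cphi|exact: ar|exact: cphi].
  - move=> t tI; apply: ccontM; first exact: ccont_cst.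
    by apply: ccont_cauchyint; [exact: ar|exact: cphi].
  by apply: cint_ext => t _; rewrite mulrBr mulrBr mulrCA -!mulrA; congr (_ - _); ring.
have bnd : cabs (cint (- pi) pi (fun t => phi t * ((circ c r t - b)^-1 ^+ n -
       (circ c r t - a)^-1 ^+ n - n%:R * (circ c r t - a)^-1 ^+ n.+1 * (b - a)))) <=
       2 * (B * (`|M| * cabs (b - a) ^+ 2) * (pi - - pi)).
  apply: cint_bound; first exact: Npi_pi.
    move=> t tI.
    have -> : (fun t => phi t * ((circ c r t - b)^-1 ^+ n - (circ c r t - a)^-1 ^+ n -
         n%:R * (circ c r t - a)^-1 ^+ n.+1 * (b - a))) =
      (fun t => (phi t * (circ c r t - b)^-1 ^+ n - phi t * (circ c r t - a)^-1 ^+ n) -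
         (n%:R * (b - a)) * (phi t * (circ c r t - a)^-1 ^+ n.+1)).
      by apply/funext => s; ring.
    apply: ccontB.
      apply: ccontB; apply: ccont_cauchyint; [exact: br|exact: cphi|exact: ar|exact: cphi].
    apply: ccontM; first exact: ccont_cst.
    by apply: ccont_cauchyint; [exact: ar|exact: cphi].
  move=> t tI; rewrite cabsM ler_pM ?cabs_ge0//; first exact: HB.
  by apply: (le_trans (HM _ _ bd)); rewrite ler_wpM2r ?sqr_ge0 ?ler_norm.
apply: (le_trans bnd).
have -> : 2 * (B * (`|M| * cabs (b - a) ^+ 2) * (pi - - pi)) = C * cabs (b - a) * cabs (b - a).
  by rewrite /C; ring.
apply: ler_wpM2r; first exact: cabs_ge0.
apply: (@le_trans _ _ (C * (e / (C + 1)))); first by rewrite ler_wpM2l// ltW.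
rewrite mulrA ler_pdivrMr ?ltr_wpDl// mulrC ler_pM2l// lerDl//.
Qed.

Lemma kernel_remainder1 (u v h : cplane R) (d : R) : 0 < d -> u != 0 -> v != 0 ->
  d <= cabs u -> d <= cabs v -> u - v = h ->
  cabs (v^-1 ^+ 1 - u^-1 ^+ 1 - 1%:R * u^-1 ^+ 2 * h) <= d^-1 ^+ 3 * cabs h ^+ 2.
Proof.
move=> d0 u0 v0 du dv <-.
have -> : v^-1 ^+ 1 - u^-1 ^+ 1 - 1%:R * u^-1 ^+ 2 * (u - v) =
   (u^-1 ^+ 2 * v^-1) * (u - v) ^+ 2 by field; rewrite u0 v0.
rewrite cabsM !cabsX cabsM cabsX !cabsV ler_wpM2r ?sqr_ge0//.
rewrite [leRHS]exprSr; apply: ler_pM; rewrite ?invr_ge0 ?cabs_ge0 ?exprn_ge0 ?invr_ge0 ?cabs_ge0//.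
  by rewrite lerXn2r ?nnegrE ?invr_ge0 ?cabs_ge0 ?(ltW d0)// lef_pV2 ?posrE// (lt_le_trans d0).
by rewrite lef_pV2 ?posrE// (lt_le_trans d0).
Qed.

Lemma kernel_remainder2 (u v h : cplane R) (d K : R) : 0 < d -> u != 0 -> v != 0 ->
  d <= cabs u -> d <= cabs v -> u - v = h -> 3 * cabs v + cabs h <= K ->
  cabs (v^-1 ^+ 2 - u^-1 ^+ 2 - 2%:R * u^-1 ^+ 3 * h) <= (d^-1 ^+ 5 * K) * cabs h ^+ 2.
Proof.
move=> d0 u0 v0 du dv <- HK.
have -> : v^-1 ^+ 2 - u^-1 ^+ 2 - 2%:R * u^-1 ^+ 3 * (u - v) =
   (u^-1 ^+ 3 * v^-1 ^+ 2) * (3%:R * v + (u - v)) * (u - v) ^+ 2 by field; rewrite u0 v0.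
have iu : cabs u^-1 <= d^-1 by rewrite cabsV lef_pV2 ?posrE// (lt_le_trans d0).
have iv : cabs v^-1 <= d^-1 by rewrite cabsV lef_pV2 ?posrE// (lt_le_trans d0).
rewrite cabsM cabsX ler_wpM2r ?sqr_ge0// cabsM ler_pM ?cabs_ge0//.
  rewrite cabsM !cabsX -[5%N]/(3 + 2)%N exprD.
  by apply: ler_pM; rewrite ?exprn_ge0 ?cabs_ge0// lerXn2r ?nnegrE ?cabs_ge0// invr_ge0 ltW.
apply: (le_trans (cabsD _ _)); apply: le_trans HK; rewrite cabsM lerD2r.
have -> : (3%:R : cplane R) = (3%:R : R)%:C by rewrite rmorph_nat.
by rewrite cabs_real ger0_norm.
Qed.

Lemma is_derive_cauchyint1 phi c r a : cabs (a - c) < r ->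
  (forall t, - pi <= t <= pi -> {for t, continuous phi}) ->
  is_derive a 1 (cauchyint phi 1 c r) (cauchyint phi 2 c r a).
Proof.
move=> ar cphi; have r0 := le_lt_trans (cabs_ge0 _) ar.
rewrite -[X in is_derive _ _ _ X]mul1r.
apply: (is_derive_cauchyint (M := ((r - cabs (a - c)) / 2)^-1 ^+ 3) ar cphi) => t b ba.
have d0 : 0 < (r - cabs (a - c)) / 2 by rewrite divr_gt0// subr_gt0.
have br : cabs (b - c) <= cabs (b - a) + cabs (a - c).
  by rewrite -(subrK a b) -addrA (le_trans (cabsD _ _))// addrK.
have Ha := circ_dist_ge a c t r0; have Hb := circ_dist_ge b c t r0.
apply: kernel_remainder1; [exact: d0|exact: circ_neq| |lra|lra|ring].
apply: circ_neq => //; lra.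
Qed.

(** This gives the derivative of a holomorphic function its own derivative: by [is_derive_disc] that
    derivative is such an integral. *)
Lemma derivable_cauchyint2 phi c r a : cabs (a - c) < r ->
  (forall t, - pi <= t <= pi -> {for t, continuous phi}) ->
  derivable (cauchyint phi 2 c r) a 1.
Proof.
move=> ar cphi; have r0 := le_lt_trans (cabs_ge0 _) ar.
(* For [b] in the half-distance disc, [cabs (circ c r t - b) < 2 * r] and [cabs (b - a) <= r / 2],
   so [7 * r] dominates the numerator [3 * cabs v + cabs h] of [kernel_remainder2]. *)
have := @is_derive_cauchyint phi 2 c r a (((r - cabs (a - c)) / 2)^-1 ^+ 5 * (7 * r)) ar cphi.
case=> // t b ba.
have d0 : 0 < (r - cabs (a - c)) / 2 by rewrite divr_gt0// subr_gt0.
have ac0 := cabs_ge0 (a - c).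
have br : cabs (b - c) <= cabs (b - a) + cabs (a - c).
  by rewrite -(subrK a b) -addrA (le_trans (cabsD _ _))// addrK.
have Ha := circ_dist_ge a c t r0; have Hb := circ_dist_ge b c t r0.
have Hv : cabs (circ c r t - b) <= r + cabs (b - c).
  rewrite -(subrK c (circ c r t)) -addrA (le_trans (cabsD _ _))// cabs_circ gtr0_norm//.
  by rewrite (cabsB c).
apply: kernel_remainder2; [exact: d0|exact: circ_neq| |lra|lra|ring|lra].
apply: circ_neq => //; lra.
Qed.

Section disc.
Variables (f : cplane R -> cplane R) (c : cplane R) (r : R).
Hypothesis df : forall z, cabs (z - c) <= r -> derivable f z 1.

Let twopi : cplane R := (2 * pi)%:C.

Let twopi0 : twopi != 0.
Proof. by rewrite -cabs_gt0 cabs_real gtr0_norm mulr_gt0// pi_gt0. Qed.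

Let cphi t : 0 < r -> {for t, continuous (fun t => f (circ c r t) * (circ c r t - c))}.
Proof.
move=> r0; apply: ccontM; last by apply: ccont_subr; exact: ccont_circid.
by apply: ccont_circ; apply: derivable_ccont; apply: df; rewrite cabs_circ gtr0_norm.
Qed.

Lemma cauchy_cauchyint a : cabs (a - c) < r ->
  f a = twopi^-1 * cauchyint (fun t => f (circ c r t) * (circ c r t - c)) 1 c r a.
Proof.
move=> ar; apply: (mulIf twopi0); rewrite mulrAC mulVf// mul1r -(cauchy_formula ar df).
by apply: cint_ext => t _; rewrite expr1 mulrA.
Qed.

Lemma is_derive_disc a : cabs (a - c) < r ->
  is_derive a 1 f (twopi^-1 * cauchyint (fun t => f (circ c r t) * (circ c r t - c)) 2 c r a).
Proof.
move=> ar; have r0 := le_lt_trans (cabs_ge0 _) ar.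
have /is_derive_cplaneP H := is_derive_cauchyint1 ar (fun t _ => @cphi t r0).
apply/is_derive_cplaneP => e e0.
have p0 : 0 < cabs twopi by rewrite cabs_gt0.
have [|d d0 Hd] := H (e * cabs twopi); first by rewrite mulr_gt0.
exists (Num.min d (r - cabs (a - c))); first by rewrite lt_min d0 subr_gt0.
move=> b; rewrite lt_min => /andP[bd br].
have bc : cabs (b - c) < r.
  have : cabs (b - c) <= cabs (b - a) + cabs (a - c).
    by rewrite -(subrK a b) -addrA (le_trans (cabsD _ _))// addrK.
  lra.
rewrite (cauchy_cauchyint ar) (cauchy_cauchyint bc).
rewrite -mulrA -!mulrBr cabsM cabsV ler_pdivrMl//.
by apply: (le_trans (Hd _ bd)); rewrite mulrA (mulrC e).
Qed.

Lemma derivable_deriv_disc a : cabs (a - c) < r -> derivable ('D_1 f) a 1.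
Proof.
move=> ar; have r0 := le_lt_trans (cabs_ge0 _) ar.
apply: (@near_eq_cderivable R (fun b => twopi^-1 *
   cauchyint (fun t => f (circ c r t) * (circ c r t - c)) 2 c r b) _ a (r - cabs (a - c))).
- by rewrite subr_gt0.
- move=> b ba; have bc : cabs (b - c) < r.
    have : cabs (b - c) <= cabs (b - a) + cabs (a - c).
      by rewrite -(subrK a b) -addrA (le_trans (cabsD _ _))// addrK.
    lra.
  by have [_ ->] := is_derive_disc bc.
- apply: (@cderivableM R (fun=> twopi^-1)); first exact: cderivable_cst.
  by apply: derivable_cauchyint2; [exact: ar|move=> t _; exact: (@cphi t r0)].
Qed.

(** Subtracting Cauchy's formulas at [b] and at [c] cancels the factor [circ c r t - c]: the
    difference quotient is the Cauchy integral of [f] itself with exponent 1, and this includes the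
    value at [b = c]. This is the removable singularity theorem in the form needed later. *)
Lemma derivable_diffq_center : 0 < r -> derivable (diffq f c) c 1.
Proof.
move=> r0; have cc : cabs (c - c) < r by rewrite subrr cabs0.
have cf t : {for t, continuous (fun t => f (circ c r t))}.
  by apply: ccont_circ; apply: derivable_ccont; apply: df; rewrite cabs_circ gtr0_norm.
apply: (@near_eq_cderivable R (fun b => twopi^-1 *
   cauchyint (fun t => f (circ c r t)) 1 c r b) _ c r) => //.
  move=> b bc; rewrite /diffq; case: eqVneq => [->|bnc].
    have [_ ->] := is_derive_disc cc; congr (_ * _); apply: cint_ext => t _.
    have nz := circ_neq t r0 cc.
    by field.
  rewrite (cauchy_cauchyint bc) (cauchy_cauchyint cc) -mulrBr -mulrA; congr (_ * _).
  apply: (mulIf (_ : b - c != 0)); first by rewrite subr_eq0.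
  rewrite mulfVK ?subr_eq0// mulrC /cauchyint -cintZ; last first.
    by move=> t _; apply: ccont_cauchyint; [exact: bc|exact: cf].
  rewrite -cintB; last 2 first.
  - by move=> t _; apply: ccont_cauchyint; [exact: bc|exact: (@cphi t r0)].
  - by move=> t _; apply: ccont_cauchyint; [exact: cc|exact: (@cphi t r0)].
  apply: cint_ext => t _; have n1 := circ_neq t r0 bc; have n2 := circ_neq t r0 cc.
  by field; rewrite n1 n2.
apply: (@cderivableM R (fun=> twopi^-1)); first exact: cderivable_cst.
by have [] := is_derive_cauchyint1 cc (fun t _ => cf t).
Qed.

End disc.

Lemma bernoulli (x : R) n : 0 <= x -> 1 + n%:R * x <= (1 + x) ^+ n.
Proof.
move=> x0; elim: n => [|n IH]; first by rewrite mul0r addr0 expr0.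
rewrite exprS; apply: (@le_trans _ _ ((1 + x) * (1 + n%:R * x))).
  rewrite -natr1 mulrDl mul1r mulrDr mulr1.
  have : 0 <= n%:R * x * x by rewrite !mulr_ge0.
  by move: (n%:R * x) => y; rewrite mulrDl mul1r (mulrC x); lra.
by rewrite ler_wpM2l// addr_ge0.
Qed.

(* Applying Cauchy's formula to the powers of f removes the constant. *)
Lemma maximum_principle f c r a (M : R) : cabs (a - c) < r ->
  (forall z, cabs (z - c) <= r -> derivable f z 1) ->
  (forall t, - pi <= t <= pi -> cabs (f (circ c r t)) <= M) -> cabs (f a) <= M.
Proof.
move=> ar df fM; have r0 := le_lt_trans (cabs_ge0 _) ar; have pi0 := pi_gt0 R.
have M0 : 0 <= M.
  by apply: (le_trans (cabs_ge0 (f (circ c r 0)))); apply: fM; rewrite oppr_le0 !ltW.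
have d0 : 0 < r - cabs (a - c) by rewrite subr_gt0.
pose C := 2 * (r / (r - cabs (a - c))).
have dfn n z : cabs (z - c) <= r -> derivable (fun z => f z ^+ n) z 1.
  move=> zr; elim: n => [|n IH]; first exact: cderivable_cst.
  have -> : (fun z => f z ^+ n.+1) = (fun z => f z * f z ^+ n).
    by apply/funext => w; rewrite exprS.
  by apply: (@cderivableM R f); [exact: df|exact: IH].
have key n : cabs (f a) ^+ n <= C * M ^+ n.
  have := cauchy_formula ar (dfn n) => H.
  have : cabs (f a ^+ n * (2 * pi)%:C) <= 2 * (M ^+ n * (r / (r - cabs (a - c))) * (pi - - pi)).
    rewrite -H; apply: cint_bound; first exact: Npi_pi.
      move=> t _; apply: ccontM.
        apply: (@ccont_circ R (fun z => f z ^+ n)); apply: derivable_ccont; apply: dfn.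
        by rewrite cabs_circ gtr0_norm.
      apply: ccont_kernel; [by apply: ccont_subr; exact: ccont_circid|exact: ccont_circid|exact: circ_neq].
    move=> t tI; rewrite cabsM cabsX ler_pM ?cabs_ge0 ?exprn_ge0 ?cabs_ge0//.
      by rewrite lerXn2r ?nnegrE ?cabs_ge0//; exact: fM.
    rewrite cabsM cabsV cabs_circ gtr0_norm// ler_pM2l// lef_pV2 ?posrE ?cabs_gt0 ?circ_neq//.
    exact: circ_dist_ge.
  rewrite cabsM cabsX cabs_real gtr0_norm ?mulr_gt0//.
  have -> : 2 * (M ^+ n * (r / (r - cabs (a - c))) * (pi - - pi)) = C * M ^+ n * (2 * pi).
    by rewrite /C opprK; ring.
  by rewrite ler_pM2r// mulr_gt0.
have C0 : 0 < C by rewrite mulr_gt0// divr_gt0.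
rewrite leNgt; apply/negP => Mfa.
have [M00|Mp] := leP M 0.
  have ME : M = 0 by apply/eqP; rewrite eq_le M00.
  by have := key 1%N; move: Mfa; rewrite !expr1 ME mulr0 => h1 h2; have := lt_le_trans h1 h2; rewrite ltxx.
pose x := cabs (f a) / M - 1.
have x0 : 0 < x by rewrite subr_gt0 ltr_pdivlMr// mul1r.
pose n := (Num.trunc (C / x)).+1.
have Cn : C < 1 + n%:R * x.
  by have := truncnS_gt (C / x); rewrite ltr_pdivrMr// => /lt_trans; apply; rewrite ltrDr.
have := le_trans (bernoulli n (ltW x0)) _ => /(_ C).
rewrite addrC subrK expr_div_n ler_pdivrMr ?exprn_gt0// => /(_ (key n)).
by rewrite leNgt Cn.
Qed.

End cauchy_consequences.

(** * Isolated zeros and inverse functions *)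

Section holomorphic_functions.
Context (R : realType).
Implicit Types (f g : cplane R -> cplane R) (a c z w : cplane R) (A : set (cplane R)).

(** Openness through closed discs, the form in which the results on circles are applied. *)
Definition copen A := forall z, A z -> exists2 r : R, 0 < r &
  forall w, cabs (w - z) <= r -> A w.

Lemma holomorphic_deriv f A : copen A -> holomorphic_on A f -> holomorphic_on A ('D_1 f).
Proof.
move=> oA hf z Az; have [r r0 rA] := oA z Az.
apply: (@derivable_deriv_disc R f z r); last by rewrite subrr cabs0.
by move=> w wr; apply: hf; exact: rA.
Qed.

Lemma holomorphic_diffq f A a : copen A -> holomorphic_on A f -> A a ->
  holomorphic_on A (diffq f a).
Proof.
move=> oA hf Aa z Az; have [->|za] := eqVneq z a.
  have [r r0 rA] := oA a Aa.
  apply: (@derivable_diffq_center R f a r); last exact: r0.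
  by move=> w wr; apply: hf; exact: rA.
by apply: derivable_diffq; [exact: za|exact: hf].
Qed.

Lemma small_power (q e : R) : 0 <= q -> q < 1 -> 0 < e -> exists n, q ^+ n < e.
Proof.
rewrite le_eqVlt => /predU1P[<- _ e0|q0 q1 e0].
  by exists 1%N; rewrite expr1.
pose x := q^-1 - 1.
have x0 : 0 < x by rewrite subr_gt0 invf_gt1.
pose n := (Num.trunc (e^-1 / x)).+1; exists n.
have en : e^-1 < 1 + n%:R * x.
  by have := truncnS_gt (e^-1 / x); rewrite ltr_pdivrMr// => /lt_trans; apply; rewrite ltrDr.
have := lt_le_trans en (bernoulli n (ltW x0)).
rewrite addrC subrK exprVn ltf_pV2 ?posrE ?exprn_gt0//.
Qed.

Lemma zero_of_accumulation g a : {for a, continuous g} ->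
  (forall e : R, 0 < e -> exists2 w, 0 < cabs (w - a) < e & g w = 0) -> g a = 0.
Proof.
move=> /ccont_epsP cg acc; apply/eqP; rewrite -cabs_eq0 eq_le cabs_ge0 andbT.
rewrite leNgt; apply/negP => ga0; have [d d0 Hd] := cg _ ga0.
have [w /andP[_ wd] gw] := acc _ d0.
by have := Hd w wd; rewrite gw sub0r cabsN ltxx.
Qed.

(** If zeros accumulate at [a], every iterated difference quotient [F n] vanishes there, so
    [f w = F n w * (w - a) ^+ n] for all [n]. The maximum principle on a fixed circle gives
    [cabs (F n z) <= B / r ^+ n], hence [cabs (f z) <= B * (cabs (z - a) / r) ^+ n], which tends to
    0. *)
Lemma isolated_zeros f A a : copen A -> holomorphic_on A f -> A a ->
  (exists2 r : R, 0 < r & forall z, cabs (z - a) < r -> f z = 0) \/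
  (exists2 r : R, 0 < r & forall z, 0 < cabs (z - a) < r -> f z != 0).
Proof.
move=> oA hf Aa.
have [|nacc] := pselect (exists2 r : R, 0 < r & forall z, 0 < cabs (z - a) < r -> f z != 0).
  by right.
left; have [r r0 rA] := oA a Aa; exists r => // z zr.
have acc (e : R) : 0 < e -> exists2 w, 0 < cabs (w - a) < e & f w = 0.
  move=> e0; apply: contrapT => nex; apply: nacc; exists e => // w we.
  by apply/negP => /eqP fw; apply: nex; exists w.
pose F n := iter n (fun g => diffq g a) f.
have zF n : holomorphic_on A (F n) -> (forall w, f w = F n w * (w - a) ^+ n) -> F n a = 0.
  move=> hF fE; apply: zero_of_accumulation; first exact: (derivable_ccont (hF a Aa)).
  move=> e /acc[w we fw]; exists w => //; move: fw; rewrite fE => /eqP.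
  rewrite mulf_eq0 => /orP[/eqP//|]; rewrite expf_eq0 => /andP[_].
  by rewrite -cabs_eq0 gt_eqF//; case/andP: we.
have HF n : holomorphic_on A (F n) /\ forall w, f w = F n w * (w - a) ^+ n.
  elim: n => [|n [hF fE]]; first by split => // w; rewrite expr0 mulr1.
  split; first exact: holomorphic_diffq.
  move=> w; rewrite fE [F n w](diffqE (F n) a) (zF n hF fE) add0r.
  by rewrite -mulrA -exprS.
have [B B0 HB] : exists2 B : R, 0 <= B & forall t, - pi <= t <= pi -> cabs (f (circ a r t)) <= B.
  apply: (@bounded_segment R (fun t => f (circ a r t))); first exact: Npi_pi.
  move=> t _; apply: ccont_circ; apply: derivable_ccont; apply: hf; apply: rA.
  by rewrite cabs_circ gtr0_norm.
have bF n : cabs (F n z) <= B / r ^+ n.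
  apply: (@maximum_principle R (F n) a r z _ zr).
    by move=> w wr; have [hF _] := HF n; apply: hF; exact: rA.
  move=> t tI; have [_ fE] := HF n.
  rewrite ler_pdivlMr ?exprn_gt0//; have := HB t tI.
  by rewrite fE cabsM cabsX cabs_circ gtr0_norm.
have bf n : cabs (f z) <= B * (cabs (z - a) / r) ^+ n.
  have [_ ->] := HF n; rewrite cabsM cabsX expr_div_n mulrCA mulrC.
  by rewrite ler_wpM2l ?exprn_ge0 ?cabs_ge0.
apply/eqP; rewrite -cabs_eq0 eq_le cabs_ge0 andbT leNgt; apply/negP => fz0.
have [|||n Hn] := @small_power (cabs (z - a) / r) (cabs (f z) / (B + 1)).
- by rewrite divr_ge0 ?cabs_ge0// ltW.
- by rewrite ltr_pdivrMr// mul1r.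
- by rewrite divr_gt0// ltr_wpDl.
have B1 : 0 < B + 1 by rewrite ltr_wpDl.
have := bf n; rewrite leNgt => /negP; apply.
apply: (@le_lt_trans _ _ ((B + 1) * (cabs (z - a) / r) ^+ n)).
  by rewrite ler_wpM2r ?exprn_ge0 ?divr_ge0 ?cabs_ge0 ?lerDl// ltW.
by rewrite mulrC -ltr_pdivlMr.
Qed.

Lemma cReMr z (s : R) : complex.Re (z * s%:C) = complex.Re z * s.
Proof. by rewrite cReM /= mulr0 subr0. Qed.

Lemma cImMr z (s : R) : complex.Im (z * s%:C) = complex.Im z * s.
Proof. by rewrite cImM /= mulr0 add0r. Qed.

Lemma is_derive_line f a h l (t : R) : is_derive (a + t%:C * h : cplane R) 1 f l ->
  is_derive t 1 (fun s : R => complex.Re (f (a + s%:C * h))) (complex.Re (l * h)) /\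
  is_derive t 1 (fun s : R => complex.Im (f (a + s%:C * h))) (complex.Im (l * h)).
Proof.
move=> /is_derive_cplaneP H.
have key (e : R) : 0 < e -> exists2 d : R, 0 < d & forall s : R, `|s| < d ->
    cabs (f (a + (t + s)%:C * h) - f (a + t%:C * h) - l * h * s%:C) <= e * `|s|.
  move=> e0; have h1 : 0 < cabs h + 1 by rewrite ltr_wpDl// cabs_ge0.
  have [|d d0 Hd] := H (e / (cabs h + 1)); first by rewrite divr_gt0.
  exists (d / (cabs h + 1)); first by rewrite divr_gt0.
  move=> s sd; have E : a + (t + s)%:C * h - (a + t%:C * h) = s%:C * h.
    by rewrite rmorphD/=; ring.
  have := Hd (a + (t + s)%:C * h); rewrite E.
  have -> : l * (s%:C * h) = l * h * s%:C by ring.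
  rewrite !cabsM cabs_real => /(_ _)/le_trans; apply.
    rewrite ltr_pdivlMr// in sd; apply: le_lt_trans sd.
    by rewrite ler_wpM2l// lerDl.
  by rewrite mulrACA ler_piMr ?mulr_ge0 ?(ltW e0)// ler_pdivrMl// mulr1 lerDl.
split; apply/(@is_derive_epsP R) => e /key[d d0 Hd]; exists d => // s /Hd.
  have -> : complex.Re (f (a + (t + s)%:C * h)) - complex.Re (f (a + t%:C * h)) -
     complex.Re (l * h) * s = complex.Re (f (a + (t + s)%:C * h) - f (a + t%:C * h) - l * h * s%:C).
    by rewrite cReD cReN cReD cReN cReMr.
  by move=> Hs; exact: le_trans (Re_le_cabs _) Hs.
have -> : complex.Im (f (a + (t + s)%:C * h)) - complex.Im (f (a + t%:C * h)) -
     complex.Im (l * h) * s = complex.Im (f (a + (t + s)%:C * h) - f (a + t%:C * h) - l * h * s%:C).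
  by rewrite cImD cImN cImD cImN cImMr.
by move=> Hs; exact: le_trans (Im_le_cabs _) Hs.
Qed.

Lemma deriv0_const f a (r : R) : (forall z, cabs (z - a) < r -> is_derive z 1 f 0) ->
  forall z, cabs (z - a) < r -> f z = f a.
Proof.
move=> df z zr; pose h := z - a.
have inD (t : R) : 0 <= t <= 1 -> cabs (a + t%:C * h - a) < r.
  move=> /andP[t0 t1]; rewrite addrC addKr cabsM cabs_real ger0_norm//.
  by apply: le_lt_trans zr; rewrite ler_piMl// cabs_ge0.
have E (u : R -> R) : (forall t : R, 0 <= t <= 1 -> is_derive t 1 u (0 : R)) -> u 1 = u 0.
  move=> du; have [||x _] := @MVT_segment R u (fun=> 0) 0 1 ler01.
  - by move=> x; rewrite in_itv/= => /andP[x0 x1]; apply: du; rewrite !ltW.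
  - apply: within_cont => t tI; apply: differentiable_continuous.
    by apply/derivable1_diffP; have [] := du t tI.
  - by rewrite mul0r => /eqP; rewrite subr_eq0 => /eqP.
have l1 (t : R) tI := is_derive_line (df _ (inD t tI)).
have e1 : a + (1 : R)%:C * h = z by rewrite rmorph1 mul1r /h addrC subrK.
have e0 : a + (0 : R)%:C * h = a by rewrite rmorph0 mul0r addr0.
apply: complex_eq.
  rewrite -{1}e1 -{2}e0; apply: (E (fun s => complex.Re (f (a + s%:C * h)))) => t tI.
  by have [+ _] := l1 t tI; rewrite mul0r.
rewrite -{1}e1 -{2}e0; apply: (E (fun s => complex.Im (f (a + s%:C * h)))) => t tI.
by have [_] := l1 t tI; rewrite mul0r.
Qed.

Lemma is_derive_caratheodory g k a (e : R) : 0 < e ->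
  (forall w, cabs (w - a) < e -> g w - g a = k w * (w - a)) ->
  {for a, continuous k} -> is_derive a 1 g (k a).
Proof.
move=> e0 H /ccont_epsP ck; apply/is_derive_cplaneP => e1 e10.
have [d d0 Hd] := ck _ e10.
exists (Num.min d e); first by rewrite lt_min d0.
move=> w; rewrite lt_min => /andP[wd we]; rewrite H// -mulrBl cabsM.
by rewrite ler_wpM2r ?cabs_ge0// ltW// Hd.
Qed.

Section inverse.
Variables (A B : set (cplane R)) (f g : cplane R -> cplane R).
Hypotheses (oA : copen A) (oB : copen B) (hf : holomorphic_on A f).
Hypotheses (fAB : forall z, A z -> B (f z)) (gK : forall z, A z -> g (f z) = z).
Hypotheses (gBA : forall w, B w -> A (g w)) (fK : forall w, B w -> f (g w) = w).
Hypothesis cg : forall w, B w -> {for w, continuous g}.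

(** From [w - f z = diffq f z (g w) * (g w - z)], the slope of [g] in Carathéodory's sense is the
    inverse of [diffq f z (g w)], continuous at [f z] because [g] is. *)
Lemma is_derive_inverse_holo z : A z -> 'D_1 f z != 0 ->
  is_derive (f z) 1 g ('D_1 f z)^-1.
Proof.
move=> Az dz0; have Bfz := fAB Az.
have [r r0 rB] := oB Bfz.
have dfz := hf Az.
have cq : {for f z, continuous (fun w => diffq f z (g w))}.
  apply: (@continuous_comp _ _ _ g (diffq f z)); first exact: cg.
  by rewrite (gK Az); apply: continuous_diffq; [exact: dfz|exact: (derivable_ccont dfz)].
have q0 : diffq f z (g (f z)) != 0 by rewrite gK// /diffq eqxx.
have ci : {for f z, continuous (fun w => (diffq f z (g w))^-1)}.
  exact: (@ccontV R _ (fun w => diffq f z (g w)) _ q0 cq).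
have -> : ('D_1 f z)^-1 = (diffq f z (g (f z)))^-1 by rewrite gK// /diffq eqxx.
have [|e e0 He] := (ccont_epsP _ _).1 cq (cabs ('D_1 f z)); first by rewrite cabs_gt0.
apply: (@is_derive_caratheodory g (fun w => (diffq f z (g w))^-1) (f z) (Num.min r e)).
- by rewrite lt_min r0.
- move=> w; rewrite lt_min => /andP[wr we].
  have Bw : B w by apply: rB; exact: ltW.
  have nz : diffq f z (g w) != 0.
    apply: contraTneq (He w we) => ->.
    by rewrite gK// /diffq eqxx sub0r cabsN ltxx.
  apply: (mulfI nz); rewrite mulrA mulfV// mul1r gK//.
  by rewrite -[in RHS](fK Bw) (diffqE f z (g w)) [RHS]addrAC subrr add0r.
- exact: ci.
Qed.

(** Suppose the derivative vanishes at [z]. If it vanishes near [z], then [f] is locally constant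
    and not injective. Otherwise [z] is an isolated zero of it, so [g] is differentiable around
    [f z] except perhaps at [f z], where it is continuous. The singularity is removable, and the
    chain rule for [g (f z) = z] gives [0 = 1]. *)
Lemma deriv_neq0 z : A z -> 'D_1 f z != 0.
Proof.
move=> Az; apply/negP => /eqP dz0; have Bfz := fAB Az.
have hdf := holomorphic_deriv oA hf.
have [r r0 rA] := oA Az; have [rB rB0 HrB] := oB Bfz.
have [[s s0 Hs]|[s s0 Hs]] := isolated_zeros oA hdf Az.
  pose m := Num.min r s / 2.
  have m0 : 0 < m by rewrite divr_gt0// lt_min r0.
  have mr : m < Num.min r s.
    by rewrite /m ltr_pdivrMr// mulr_natr mulr2n ltrDl lt_min r0.
  pose z' : cplane R := z + m%:C.
  have E : cabs (z' - z) = m by rewrite /z' addrC addKr cabs_real gtr0_norm.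
  have fz' : f z' = f z.
    apply: (@deriv0_const f z (Num.min r s)); last by rewrite E.
    move=> w; rewrite lt_min => /andP[wr ws].
    have Aw : A w by apply: rA; exact: ltW.
    by rewrite -(Hs _ ws); apply/derivableP; exact: hf.
  have Az' : A z' by apply: rA; rewrite E ltW// (lt_le_trans mr)// ge_min lexx.
  have : z' = z by rewrite -(gK Az') fz' gK.
  by move/eqP; rewrite -subr_eq0 -cabs_eq0 E gt_eqF.
have cgw := cg Bfz.
have [d d0 Hd] := (ccont_epsP _ _).1 cgw _ s0.
(* Multiplication by [w - f z] makes the product differentiable at [f z] too, with derivative 0. Its
   difference quotient is [g w - z], to which [derivable_diffq_center] applies. *)
pose h w : cplane R := (w - f z) * (g w - z).
have h0 : h (f z) = 0 by rewrite /h subrr mul0r.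
have dh0 : is_derive (f z) 1 h 0.
  have -> : (0 : cplane R) = g (f z) - z by rewrite gK// subrr.
  apply: (@is_derive_caratheodory h (fun w => g w - z) (f z) 1 ltr01).
    by move=> w _; rewrite h0 subr0 /h mulrC.
  by apply: ccont_subr; exact: cgw.
pose rho := Num.min (d / 2) rB.
have rho0 : 0 < rho by rewrite lt_min divr_gt0.
have dh w : cabs (w - f z) <= rho -> derivable h w 1.
  rewrite le_min => /andP[wd wB].
  have [->|wz] := eqVneq w (f z); first by have [] := dh0.
  have Bw := HrB _ wB.
  have gw1 : 0 < cabs (g w - z) < s.
    apply/andP; split; last first.
      by rewrite -{1}(gK Az); apply: Hd; apply: (le_lt_trans wd); lra.
    by rewrite cabs_gt0 subr_eq0; apply: contraNneq wz => <-; rewrite fK.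
  have dg : derivable g w 1.
    by have [+ _] := is_derive_inverse_holo (gBA Bw) (Hs _ gw1); rewrite (fK Bw).
  apply: (@cderivableM R (fun w => w - f z) (fun w => g w - z)).
    by apply: (@cderivable_subr R (fun w => w)); exact: cderivable_id.
  by apply: cderivable_subr; exact: dg.
have dq := derivable_diffq_center dh rho0.
have qE w : diffq h (f z) w = g w - z.
  rewrite /diffq; case: eqVneq => [->|wz]; first by have [_ ->] := dh0; rewrite gK// subrr.
  by rewrite h0 subr0 /h [X in X / _]mulrC mulfK ?subr_eq0.
have dg : derivable g (f z) 1.
  apply: (@near_eq_cderivable R (fun w => diffq h (f z) w - - z) g (f z) 1 ltr01).
    by move=> w _; rewrite qE opprK subrK.
  by apply: cderivable_subr; exact: dq.
have /derivableP dfz := hf Az.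
have /derivableP dgz := dg.
(* The composite is the identity near [z] but has derivative 0; a displacement of size [m] would be
   at most [m / 2]. *)
have := is_derive_comp dfz dgz; rewrite dz0 mulr0 => /is_derive_cplaneP H.
have [|e e0 He] := H (1 / 2); first by rewrite divr_gt0.
pose m := Num.min e r / 2.
have m0 : 0 < m by rewrite divr_gt0// lt_min r0 e0.
have mr : m < Num.min e r.
  by rewrite /m ltr_pdivrMr// mulr_natr mulr2n ltrDl lt_min r0 e0.
pose z' : cplane R := z + m%:C.
have E : cabs (z' - z) = m by rewrite /z' addrC addKr cabs_real gtr0_norm.
have Az' : A z' by apply: rA; rewrite E ltW// (lt_le_trans mr)// ge_min lexx orbT.
have mle : m < e by rewrite (lt_le_trans mr)// ge_min lexx.
have := He z'; rewrite E (gK Az) (gK Az') mul0r subr0 E => /(_ mle).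
by rewrite leNgt => /negP; apply; rewrite gtr_pMl // ltr_pdivrMr ?mul1r ?ltr1n.
Qed.

Lemma is_derive_inverse_fun z : A z -> is_derive (f z) 1 g ('D_1 f z)^-1.
Proof. by move=> Az; apply: is_derive_inverse_holo; [|exact: deriv_neq0]. Qed.

End inverse.

End holomorphic_functions.

(** * The sector condition for the derivative of a conformal mapping *)

Section schwarz_pick.
Context (R : realType).
Implicit Types (f phi : cplane R -> cplane R) (a c z w : cplane R).

Lemma copen_uhp : copen (@uhp R).
Proof.
move=> z z0; exists (complex.Im z / 2); first by rewrite divr_gt0.
move=> w wz; have := le_trans (Im_le_cabs (w - z)) wz.
rewrite cImD cImN ler_norml => /andP[h _]; move: h z0; rewrite /uhp /=.
by move: (complex.Im z) (complex.Im w) => x y; lra.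
Qed.

Lemma cabs_conj_sqr z w :
  cabs (z - w^*) ^+ 2 = cabs (z - w) ^+ 2 + 4 * complex.Im z * complex.Im w.
Proof. by case: z w => a b [c d]; rewrite !cabs_sqr /=; ring. Qed.

Lemma cabs_le_conj z w : uhp z -> uhp w -> cabs (z - w) <= cabs (z - w^*).
Proof.
move=> z0 w0; rewrite -ler_sqr ?nnegrE ?cabs_ge0// cabs_conj_sqr lerDl.
by rewrite !mulr_ge0// ltW.
Qed.

Lemma subr_conj_neq0 z w : uhp z -> uhp w -> z - w^* != 0.
Proof.
move=> z0 w0; apply/negP => /eqP H; have := cabs_conj_sqr z w.
rewrite H cabs0 expr0n /= => /esym/eqP; rewrite gt_eqF//.
by rewrite ltr_wpDl ?sqr_ge0// !mulr_gt0.
Qed.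

(* The circle of Apollonius |z - w^*| = k |z - w| bounds a disc in the half-plane. *)
Lemma apollonius (w z : cplane R) (k : R) : uhp w -> 1 < k ->
  let c := complex.Re w +i* (complex.Im w * (k ^+ 2 + 1) / (k ^+ 2 - 1)) in
  let r := 2 * complex.Im w * k / (k ^+ 2 - 1) in
  cabs (z - c) ^+ 2 - r ^+ 2 =
  (k ^+ 2 * cabs (z - w) ^+ 2 - cabs (z - w^*) ^+ 2) / (k ^+ 2 - 1).
Proof.
move=> w0 k1 c r; have k0 : k ^+ 2 - 1 != 0.
  by rewrite gt_eqF// subr_gt0 expr_gt1// (le_trans ler01)// ltW.
rewrite /c /r; case: z w {w0 c r} => a b [u v]; rewrite !cabs_sqr /=; field.
exact: k0.
Qed.

(** [G] is the quotient of the pseudohyperbolic distances of the images and of the points, without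
    the moduli. On the boundary of an Apollonius disc with ratio [k] its modulus is at most [k], so
    the maximum principle gives [cabs (G z) <= k], and [k] tends to 1. No passage to the unit disc
    is involved. Squaring turns the result into the product form that Wolff's argument uses. *)
Lemma schwarz_pick phi z w : holomorphic_on (@uhp R) phi ->
  (forall z, uhp z -> uhp (phi z)) -> uhp z -> uhp w ->
  complex.Im z * complex.Im w * cabs (phi z - (phi w)^*) ^+ 2 <=
  complex.Im (phi z) * complex.Im (phi w) * cabs (z - w^*) ^+ 2.
Proof.
move=> hphi pU zU wU.
have [->|zw] := eqVneq z w.
  by rewrite !cabs_conj_sqr !subrr cabs0 expr0n /= !add0r le_eqVlt; apply/orP; left; apply/eqP; ring.
pose G x : cplane R := diffq phi w x * (x - w^*) / (phi x - (phi w)^*).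
have hG x : uhp x -> derivable G x 1.
  move=> xU; apply: (@cderivableM R (fun x => diffq phi w x * (x - w^*))).
    apply: (@cderivableM R (diffq phi w)).
      exact: (holomorphic_diffq copen_uhp hphi wU xU).
    by apply: (@cderivable_subr R (fun x => x)); exact: cderivable_id.
  apply: (@cderivableV R (fun x => phi x - (phi w)^*)).
    by apply: subr_conj_neq0; exact: pU.
  by apply: cderivable_subr; exact: hphi.
have zw0 : 0 < cabs (z - w) by rewrite cabs_gt0 subr_eq0.
have lt1 : cabs (z - w) < cabs (z - w^*).
  rewrite -ltr_sqr ?nnegrE ?cabs_ge0// cabs_conj_sqr ltrDl.
  by rewrite !mulr_gt0.
have Gk (k : R) : 1 < k -> k * cabs (z - w) < cabs (z - w^*) -> cabs (G z) <= k.
  move=> k1 kz; have k0 : 0 < k by exact: lt_trans k1.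
  have k20 : 0 < k ^+ 2 - 1 by rewrite subr_gt0 expr_gt1// ltW.
  pose c : cplane R := complex.Re w +i* (complex.Im w * (k ^+ 2 + 1) / (k ^+ 2 - 1)).
  pose r := 2 * complex.Im w * k / (k ^+ 2 - 1).
  have r0 : 0 < r by rewrite divr_gt0// !mulr_gt0.
  have A x : cabs (x - c) ^+ 2 - r ^+ 2 =
      (k ^+ 2 * cabs (x - w) ^+ 2 - cabs (x - w^*) ^+ 2) / (k ^+ 2 - 1).
    exact: (apollonius x wU k1).
  have zr : cabs (z - c) < r.
    rewrite -ltr_sqr ?nnegrE ?cabs_ge0 ?(ltW r0)// -subr_lt0 A.
    rewrite pmulr_llt0 ?invr_gt0// subr_lt0 -exprMn ltr_sqr ?nnegrE ?mulr_ge0 ?cabs_ge0// ltW//.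
  have disc x : cabs (x - c) <= r -> uhp x.
    move=> xr; have := le_trans (Im_le_cabs (x - c)) xr.
    rewrite cImD cImN /= ler_norml => /andP[h _].
    apply: (@lt_le_trans _ _ (complex.Im w * (k ^+ 2 + 1) / (k ^+ 2 - 1) - r)); last first.
      by move: h; move: (complex.Im w * (k ^+ 2 + 1) / (k ^+ 2 - 1)) (r) (complex.Im x) => X Y Z; lra.
    rewrite /r -mulrBl divr_gt0//.
    have -> : complex.Im w * (k ^+ 2 + 1) - 2 * complex.Im w * k =
       complex.Im w * (k - 1) ^+ 2 by ring.
    by rewrite mulr_gt0// exprn_gt0// subr_gt0.
  apply: (@maximum_principle R G c r z k zr).
    by move=> x xr; apply: hG; exact: disc.
  move=> t _; set x := circ c r t.
  have xr : cabs (x - c) = r by rewrite cabs_circ gtr0_norm.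
  have xU : uhp x by apply: disc; rewrite xr.
  have xk : cabs (x - w^*) = k * cabs (x - w).
    have := A x; rewrite xr subrr => /esym/eqP.
    rewrite mulf_eq0 invr_eq0 (gt_eqF k20) orbF subr_eq0 -exprMn => /eqP/esym/eqP.
    by rewrite eqrXn2 ?cabs_ge0 ?mulr_ge0 ?cabs_ge0 ?(ltW k0)// => /eqP.
  have pc : 0 < cabs (phi x - (phi w)^*).
    by rewrite cabs_gt0; apply: subr_conj_neq0; exact: pU.
  rewrite /G cabsM cabsV ler_pdivrMr// cabsM xk mulrCA ler_pM2l// -cabsM.
  have -> : diffq phi w x * (x - w) = phi x - phi w.
    by rewrite [phi x](diffqE phi w x) [RHS]addrAC subrr add0r.
  by apply: cabs_le_conj; exact: pU.
have G1 : cabs (G z) <= 1.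
  apply/ler_addgt0Pr => e e0.
  pose k := Num.min (1 + e) ((1 + cabs (z - w^*) / cabs (z - w)) / 2).
  have q1 : 1 < cabs (z - w^*) / cabs (z - w) by rewrite ltr_pdivlMr// mul1r.
  apply: (@le_trans _ _ k); last by rewrite ge_min lexx.
  apply: Gk; first by rewrite lt_min ltrDl e0 /=; lra.
  rewrite -ltr_pdivlMr// gt_min; apply/orP; right; lra.
have pc : 0 < cabs (phi z - (phi w)^*).
  by rewrite cabs_gt0; apply: subr_conj_neq0; exact: pU.
have key : cabs (phi z - phi w) * cabs (z - w^*) <= cabs (z - w) * cabs (phi z - (phi w)^*).
  have -> : phi z - phi w = diffq phi w z * (z - w).
    by rewrite [phi z](diffqE phi w z) addrAC subrr add0r.
  rewrite cabsM mulrAC (mulrC (cabs (z - w))) ler_pM2r//.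
  by move: G1; rewrite /G cabsM cabsV ler_pdivrMr// mul1r cabsM.
have : (cabs (phi z - phi w) * cabs (z - w^*)) ^+ 2 <=
       (cabs (z - w) * cabs (phi z - (phi w)^*)) ^+ 2.
  by rewrite ler_sqr ?nnegrE ?mulr_ge0 ?cabs_ge0.
rewrite !exprMn.
have -> : cabs (phi z - phi w) ^+ 2 = cabs (phi z - (phi w)^*) ^+ 2 -
   4 * complex.Im (phi z) * complex.Im (phi w) by rewrite cabs_conj_sqr addrK.
have -> : cabs (z - w) ^+ 2 = cabs (z - w^*) ^+ 2 -
   4 * complex.Im z * complex.Im w by rewrite cabs_conj_sqr addrK.
move: (cabs _ ^+ 2) (cabs _ ^+ 2) => X Y; rewrite !mulrBl (mulrC X Y).
move: (complex.Im _) (complex.Im _) (complex.Im _) (complex.Im _) => p q a b H.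
lra.
Qed.

(* Wolff's lemma at infinity: if the orbit w_n of phi goes to infinity, then
   Q_n = Im w_n / |w_n|^2 tends to 0, so that Q_(n+1) <= Q_n infinitely often,
   and the Schwarz-Pick inequality at w_n gives the claim in the limit. *)
Lemma wolff_infinity phi (w_ : nat -> cplane R) z : holomorphic_on (@uhp R) phi ->
  (forall z, uhp z -> uhp (phi z)) -> (forall n, uhp (w_ n)) ->
  (forall n, w_ n.+1 = phi (w_ n)) ->
  (forall N : R, exists n0, forall n, (n0 <= n)%N -> N < cabs (w_ n)) ->
  uhp z -> complex.Im z <= complex.Im (phi z).
Proof.
move=> hphi pU wU wS winf zU; rewrite leNgt; apply/negP => pz.
set a := complex.Im z in pz; set p := complex.Im (phi z) in pz.
have a0 : 0 < a by exact: zU.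
have p0 : 0 < p by exact: pU.
pose m := cabs z + cabs (phi z) + 1.
have m0 : 0 < m by rewrite ltr_wpDl// addr_ge0 ?cabs_ge0.
(* Once the orbit is beyond [m / s], Schwarz-Pick gives [a * (1 - s) ^+ 2 <= p * (1 + s) ^+ 2]. With
   [p < a] and [s <= 1] this implies [a - p < 5 * (a * s)], which this [s] excludes. *)
pose s := Num.min 1 ((a - p) / (6 * a)).
have s0 : 0 < s by rewrite lt_min ltr01 divr_gt0 ?mulr_gt0 ?subr_gt0.
have [n0 Hn0] := winf (m / s).
pose Q n := complex.Im (w_ n) / cabs (w_ n) ^+ 2.
have W0 n : 0 < cabs (w_ n) by apply: lt_le_trans (wU n) _; rewrite (le_trans (ler_norm _))// Im_le_cabs.
have Q0 n : 0 < Q n by rewrite divr_gt0 ?exprn_gt0//; exact: wU.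
have [n n0n Qn] : exists2 n, (n0 <= n)%N & Q n.+1 <= Q n.
  apply: contrapT => nex.
  have Qinc n : (n0 <= n)%N -> Q n0 <= Q n.
    elim: n => [|n IH]; first by rewrite leqn0 => /eqP ->.
    rewrite leq_eqVlt => /predU1P[->//|]; rewrite ltnS => n0n.
    apply: (le_trans (IH n0n)); rewrite ltW// ltNge; apply/negP => h.
    by apply: nex; exists n.
  have [n1 Hn1] := winf (Q n0)^-1.
  have h1 := Qinc (maxn n0 n1) (leq_maxl _ _).
  have h2 := Hn1 (maxn n0 n1) (leq_maxr _ _).
  have : Q (maxn n0 n1) <= (cabs (w_ (maxn n0 n1)))^-1.
    rewrite ler_pdivrMr ?exprn_gt0// expr2 mulrA mulVf ?gt_eqF// mul1r.
    by rewrite (le_trans (ler_norm _))// Im_le_cabs.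
  move=> /(le_trans h1); rewrite -[Q n0]invrK lef_pV2 ?posrE ?invr_gt0//.
  by rewrite leNgt h2.
have D1 : m / s < cabs (w_ n) by exact: Hn0.
have D2 : m / s < cabs (w_ n.+1) by apply: Hn0; exact: leqW.
have := schwarz_pick hphi pU zU (wU n); rewrite -wS -/a -/p.
set d1 := cabs (w_ n) in D1; set d2 := cabs (w_ n.+1) in D2.
have d10 : 0 < d1 by exact: W0.
have d20 : 0 < d2 by exact: W0.
have conjE (u : cplane R) : cabs u^* = cabs u by rewrite !cabsE; case: u => x y /=; rewrite sqrrN.
have E1 : cabs (z - (w_ n)^*) <= (1 + s) * d1.
  apply: (le_trans (cabsD _ _)); rewrite cabsN conjE -/d1 mulrDl mul1r addrC lerD2l.
  rewrite mulrC -ler_pdivrMr//; apply: ltW; apply: le_lt_trans D1.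
  by rewrite ler_pM2r ?invr_gt0// /m -addrA lerDl addr_ge0 ?cabs_ge0.
have E2 : (1 - s) * d2 <= cabs (phi z - (w_ n.+1)^*).
  have : d2 <= cabs (phi z - (w_ n.+1)^*) + cabs (phi z).
    rewrite /d2 -conjE cabsB (le_trans _ (cabsD _ _))// subrK//.
  have : cabs (phi z) <= s * d2.
    rewrite mulrC -ler_pdivrMr//; apply: ltW; apply: le_lt_trans D2.
    rewrite ler_pM2r ?invr_gt0// /m -addrA addrCA lerDl addr_ge0 ?cabs_ge0//.
  by rewrite mulrBl mul1r; lra.
have s1 : s <= 1 by rewrite ge_min lexx.
move=> SP.
have SP2 : a * complex.Im (w_ n) * ((1 - s) * d2) ^+ 2 <=
           p * complex.Im (w_ n.+1) * ((1 + s) * d1) ^+ 2.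
  apply: (le_trans _ (le_trans SP _)).
    rewrite ler_wpM2l ?mulr_ge0 ?(ltW a0) ?(ltW (wU n))// ler_sqr ?nnegrE ?cabs_ge0//.
    by rewrite mulr_ge0 ?subr_ge0// ltW.
  rewrite ler_wpM2l ?mulr_ge0 ?(ltW p0) ?(ltW (wU n.+1))// ler_sqr ?nnegrE ?cabs_ge0//.
  by rewrite mulr_ge0 ?addr_ge0// ltW.
have SP3 : a * (1 - s) ^+ 2 * Q n <= p * (1 + s) ^+ 2 * Q n.+1.
  have dn1 : d1 != 0 by rewrite gt_eqF.
  have dn2 : d2 != 0 by rewrite gt_eqF.
  rewrite /Q -/d1 -/d2.
  have -> : a * (1 - s) ^+ 2 * (complex.Im (w_ n) / d1 ^+ 2) =
     a * complex.Im (w_ n) * ((1 - s) * d2) ^+ 2 / (d1 * d2) ^+ 2.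
    by move: d1 d2 {D1 D2 d10 d20 E1 E2 SP SP2} dn1 dn2 => x y x0 y0; field; rewrite x0 y0.
  have -> : p * (1 + s) ^+ 2 * (complex.Im (w_ n.+1) / d2 ^+ 2) =
     p * complex.Im (w_ n.+1) * ((1 + s) * d1) ^+ 2 / (d1 * d2) ^+ 2.
    by move: d1 d2 {D1 D2 d10 d20 E1 E2 SP SP2} dn1 dn2 => x y x0 y0; field; rewrite x0 y0.
  by rewrite ler_pM2r// invr_gt0 exprn_gt0// mulr_gt0.
have : a * (1 - s) ^+ 2 <= p * (1 + s) ^+ 2.
  rewrite -(ler_pM2r (Q0 n)); apply: (le_trans SP3).
  by rewrite ler_wpM2l// mulr_ge0 ?sqr_ge0// ltW.
have sa : s * (6 * a) <= a - p.
  by rewrite -ler_pdivlMr ?mulr_gt0// ge_min lexx orbT.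
have ps : p * s <= a * s by rewrite ler_pM2r// ltW.
have ss : s * s <= s by rewrite -[leRHS]mulr1 ler_pM2l.
have pss : p * (s * s) <= p * s by rewrite ler_pM2l.
have as0 : 0 <= a * (s * s) by rewrite !mulr_ge0// ltW.
have as1 : 0 < a * s by rewrite mulr_gt0.
rewrite leNgt => /negP; apply.
have -> : a * (1 - s) ^+ 2 = a - 2 * (a * s) + a * (s * s) by ring.
have -> : p * (1 + s) ^+ 2 = p + 2 * (p * s) + p * (s * s) by ring.
have sa' : 6 * (a * s) <= a - p by move: sa; rewrite mulrCA (mulrC s).
move: (a * s) (p * s) (p * (s * s)) (a * (s * s)) sa' ps pss as0 as1 => x1 x2 x3 x4; lra.
Qed.

End schwarz_pick.

(** * Translations of the domain and the sector of [Phi'] *)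

Section conformal_geometry.
Context (R : realType).
Variables (gamma : R -> R) (L x0 : R) (Phi : cplane R -> cplane R).
Hypothesis lip : L.-lipschitz gamma.
Hypothesis Hc : conformal_map gamma Phi x0.
Implicit Types (v w z : cplane R).

Lemma lipschitzE x y : `|gamma x - gamma y| <= L * `|x - y|.
Proof. by have := @lip (x, y); apply; split. Qed.

Lemma lipschitz_ge0 : 0 <= L.
Proof.
have := lipschitzE 1 0; rewrite subr0 normr1 mulr1; exact: le_trans.
Qed.

Lemma Omega_shift w v : Omega gamma w -> L * `|complex.Re v| <= complex.Im v ->
  Omega gamma (w + v).
Proof.
rewrite /Omega /= cReD cImD => w0 hv.
have := lipschitzE (complex.Re w + complex.Re v) (complex.Re w).
rewrite addrAC subrr add0r => /(le_trans (ler_norm _)).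
by move: w0 hv; move: (gamma _) (gamma _) (L * _) => x y u; lra.
Qed.

Lemma copen_Omega : copen (Omega gamma).
Proof.
move=> w w0; have L0 := lipschitz_ge0.
pose s := complex.Im w - gamma (complex.Re w).
have s0 : 0 < s by rewrite subr_gt0.
have L1 : 0 < L + 1 by rewrite ltr_wpDl.
exists (s / (2 * (L + 1))); first by rewrite divr_gt0 ?mulr_gt0.
move=> u; rewrite ler_pdivlMr ?mulr_gt0// => us.
have := lipschitzE (complex.Re u) (complex.Re w); rewrite -cReN -cReD.
move=> /(le_trans (ler_norm _)) h1.
have := Im_le_cabs (u - w); rewrite ler_norml cImD cImN => /andP[h2 _].
have h3 : L * `|complex.Re (u - w)| <= L * cabs (u - w) by rewrite ler_wpM2l// Re_le_cabs.
rewrite /Omega /=; move: s0 us h1 h2 h3; rewrite /s.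
have : 0 <= cabs (u - w) by exact: cabs_ge0.
have : 0 <= L * cabs (u - w) by rewrite mulr_ge0// cabs_ge0.
rewrite [cabs _ * (2 * _)](_ : _ = 2 * (L * cabs (u - w)) + 2 * cabs (u - w)); last by ring.
move: (cabs _) (L * cabs _) (L * `|_|) (gamma _) (gamma _) (complex.Im _) (complex.Im _) => *; lra.
Qed.

Lemma copen_open (A : set (cplane R)) : copen A -> open A.
Proof.
move=> oA; rewrite openE => z /oA[r r0 rA]; apply/nbhs_cplaneP; exists r => // w wr.
by apply: rA; exact: ltW.
Qed.

Let Psi : cplane R -> cplane R := projT1 (cid2 (conformal_inv_cont Hc)).

Let PsiK z : closed_uhp z -> Psi (Phi z) = z.
Proof. by rewrite /Psi; case: cid2 => /= P PK cP; exact: PK. Qed.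

Let cPsi : {within closure (Omega gamma), continuous Psi}.
Proof. by rewrite /Psi; case: cid2. Qed.

Lemma sub_closed_uhp z : uhp z -> closed_uhp z.
Proof. exact: ltW. Qed.

Let PhiU z : uhp z -> Omega gamma (Phi z).
Proof. by have [H _ _] := conformal_bij Hc; exact: H. Qed.

Let PsiPhiK z : uhp z -> Psi (Phi z) = z.
Proof. by move=> zU; exact/PsiK/sub_closed_uhp. Qed.

Let PsiO w : Omega gamma w -> uhp (Psi w) /\ Phi (Psi w) = w.
Proof.
by have [_ _ H] := conformal_bij Hc; move=> /H[z zU <-]; rewrite PsiPhiK.
Qed.

Let cPsiO w : Omega gamma w -> {for w, continuous Psi}.
Proof.
move=> wO; have := continuous_subspaceW (@subset_closure _ (Omega gamma)) cPsi.
rewrite continuous_open_subspace; last exact/copen_open/copen_Omega.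
by apply; exact/mem_set.
Qed.

Lemma conformal_deriv_neq0 z : uhp z -> 'D_1 Phi z != 0.
Proof.
apply: (@deriv_neq0 R (@uhp R) (Omega gamma) Phi Psi).
- exact: copen_uhp.
- exact: copen_Omega.
- exact: conformal_holo Hc.
- exact: PhiU.
- exact: PsiPhiK.
- by move=> w /PsiO[].
- by move=> w /PsiO[].
- exact: cPsiO.
Qed.

Let dPsi z : uhp z -> is_derive (Phi z) 1 Psi ('D_1 Phi z)^-1.
Proof.
apply: (@is_derive_inverse_fun R (@uhp R) (Omega gamma) Phi Psi).
- exact: copen_uhp.
- exact: copen_Omega.
- exact: conformal_holo Hc.
- exact: PhiU.
- exact: PsiPhiK.
- by move=> w /PsiO[].
- by move=> w /PsiO[].
- exact: cPsiO.
Qed.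

Lemma compact_crect (a b c d : R) :
  compact [set z : cplane R | a <= complex.Re z <= b /\ c <= complex.Im z <= d].
Proof.
have -> : [set z : cplane R | a <= complex.Re z <= b /\ c <= complex.Im z <= d] =
   (fun p : R * R => p.1 +i* p.2 : cplane R) @` (`[a, b]%classic `*` `[c, d]%classic).
  apply/seteqP; split.
    by move=> [x y] /= [h1 h2]; exists (x, y) => //; split; rewrite /= in_itv.
  by move=> _ [[x y] /= [h1 h2] <-] /=; split; [move: h1|move: h2]; rewrite in_itv.
apply: continuous_compact; last by apply: compact_setX; exact: segment_compact.
apply: continuous_subspaceT => p; apply: ccont_complex; [exact: cvg_fst|exact: cvg_snd].
Qed.

(** By compactness, since [Phi] is continuous up to the real line. It is used in the contrapositive:
    points whose images go to infinity go to infinity themselves. *)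
Lemma conformal_bounded (N : R) : exists M : R, forall z, closed_uhp z -> cabs z <= N ->
  cabs (Phi z) <= M.
Proof.
have [N0|N0] := ltP N 0.
  by exists 0 => z _ /(le_trans (cabs_ge0 z)); rewrite leNgt N0.
pose K := [set z : cplane R | - N <= complex.Re z <= N /\ 0 <= complex.Im z <= N].
have cK : {within K, continuous (fun z => cabs (Phi z))}.
  have KU : K `<=` @closed_uhp R by move=> z [_ /andP[]].
  have := continuous_subspaceW KU (conformal_cont Hc) => cP z.
  apply: (@continuous_comp (subspace K) _ _ Phi (@cabs R)); first exact: cP.
  exact: continuous_cabs.
have [|c _ Hc'] := @compact_EVT_max _ R _ K _ (@compact_crect (- N) N 0 N) cK.
  by exists (0 : cplane R); split => /=; rewrite ?oppr_le0 ?lexx ?N0.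
exists (cabs (Phi c)) => z z0 zN; apply: Hc'; apply/mem_set; split.
  by rewrite -ler_norml (le_trans (Re_le_cabs z)).
by rewrite z0 /= (le_trans (ler_norm _))// (le_trans (Im_le_cabs z)).
Qed.

(* By Wolff's lemma for the self-map z |-> Psi (Phi z + v) of the half-plane,
   whose orbits Psi (w + n v) go to infinity. *)
Lemma Im_Psi_shift w v : Omega gamma w -> v != 0 -> L * `|complex.Re v| <= complex.Im v ->
  complex.Im (Psi w) <= complex.Im (Psi (w + v)).
Proof.
move=> wO v0 hv; have [zU Pz] := PsiO wO.
pose phi z : cplane R := Psi (Phi z + v).
pose w_ n : cplane R := Psi (w + n%:R%:C * v).
have wO' n : Omega gamma (w + n%:R%:C * v).
  apply: Omega_shift => //; rewrite cReM cImM /= !mul0r subr0 addr0 normrM ger0_norm//.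
  by rewrite mulrCA ler_wpM2l.
have -> : Psi (w + v) = phi (Psi w) by rewrite /phi Pz.
apply: (@wolff_infinity R phi w_ (Psi w)).
- move=> z zU'; apply: (@cderivable_comp R Psi (fun z => Phi z + v)).
    apply: (@cderivableD R Phi (fun=> v)); first exact: (conformal_holo Hc).
    exact: cderivable_cst.
  have O1 : Omega gamma (Phi z + v) by apply: Omega_shift; [exact: PhiU|exact: hv].
  have [U1 P1] := PsiO O1.
  by have [+ _] := dPsi U1; rewrite P1.
- move=> z zU'; have O1 : Omega gamma (Phi z + v).
    by apply: Omega_shift; [exact: PhiU|exact: hv].
  by have [] := PsiO O1.
- by move=> n; have [] := PsiO (wO' n).
- move=> n; rewrite /w_ /phi; have [_ ->] := PsiO (wO' n).
  by rewrite -addrA -natr1 rmorphD rmorph1 mulrDl mul1r.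
- move=> N; have [M HM] := conformal_bounded N.
  have v1 : 0 < cabs v by rewrite cabs_gt0.
  exists (Num.trunc ((`|M| + cabs w) / cabs v)).+1 => n hn.
  have [U1 P1] := PsiO (wO' n).
  rewrite ltNge; apply/negP => /(HM _ (sub_closed_uhp U1)); rewrite P1.
  have h1 : n%:R * cabs v <= cabs (w + n%:R%:C * v) + cabs w.
    have -> : n%:R * cabs v = cabs (n%:R%:C * v) by rewrite cabsM cabs_real ger0_norm.
    have := cabsD (w + n%:R%:C * v) (- w); rewrite cabsN; apply: le_trans.
    by rewrite addrAC subrr add0r.
  have h2 : `|M| + cabs w < n%:R * cabs v.
    rewrite -ltr_pdivrMr//; have := truncnS_gt ((`|M| + cabs w) / cabs v).
    by move=> /lt_le_trans; apply; rewrite ler_nat.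
  by have := ler_norm M; move: h1 h2; move: (cabs _) (cabs _) `|M| (n%:R * _) => *; lra.
- exact: zU.
Qed.

Lemma Im_inv_deriv_ge0 z v : uhp z -> v != 0 -> L * `|complex.Re v| <= complex.Im v ->
  0 <= complex.Im (('D_1 Phi z)^-1 * v).
Proof.
move=> zU v0 hv; set D := ('D_1 Phi z)^-1; rewrite leNgt; apply/negP => Dv.
have dP := dPsi zU; rewrite -/D in dP.
have e1 : Phi z + (0 : R)%:C * v = Phi z by rewrite rmorph0 mul0r addr0.
rewrite -e1 in dP.
(* With half the supposed negative slope as tolerance, [complex.Im (Psi _)] would decrease strictly
   along a small multiple of [v], against [Im_Psi_shift]. *)
have [_ /(@is_derive_epsP R)/(_ (- complex.Im (D * v) / 2))] := is_derive_line dP.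
case; first by rewrite divr_gt0// oppr_gt0.
move=> d d0 Hd; have d20 : 0 < d / 2 by rewrite divr_gt0.
have dd : `|d / 2| < d by rewrite gtr0_norm// ltr_pdivrMr// mulr_natr mulr2n ltrDl.
have := Hd (d / 2) dd; rewrite add0r e1 (gtr0_norm d20) => /(le_trans (ler_norm _)).
have v1 : (d / 2)%:C * v != 0.
  by rewrite mulf_neq0// -cabs_eq0 cabs_real gtr0_norm// gt_eqF.
have hv1 : L * `|complex.Re ((d / 2)%:C * v)| <= complex.Im ((d / 2)%:C * v).
  rewrite cReM cImM /= !mul0r subr0 addr0 normrM (gtr0_norm d20) mulrCA.
  by rewrite ler_pM2l.
have := Im_Psi_shift (PhiU zU) v1 hv1.
have k0 : 0 < - complex.Im (D * v) * (d / 2) by rewrite mulr_gt0// oppr_gt0.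
have -> : - complex.Im (D * v) / 2 * (d / 2) = - complex.Im (D * v) * (d / 2) / 2 by rewrite mulrAC.
move: k0; rewrite mulNr.
move: (complex.Im (Psi _)) (complex.Im (Psi _)) (complex.Im _ * _) => x y u; lra.
Qed.

Let sector_bound (x y : R) : 0 <= (L + 1) * x + y -> 0 <= (L + 1) * x - y ->
  `|y| <= (L + 1) * x.
Proof. by rewrite ler_norml; move: ((L + 1) * x) => u; lra. Qed.

(** Apply [Im_inv_deriv_ge0] to the two directions [1 +i* (L + 1)] and [-1 +i* (L + 1)]. Taking
    [L + 1] for [L] keeps the constant positive when [L = 0], so that the modulus is controlled by
    the real part. *)
Lemma inv_deriv_sector z : uhp z ->
  `|complex.Im ('D_1 Phi z)^-1| <= (L + 1) * complex.Re ('D_1 Phi z)^-1.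
Proof.
move=> zU; have L0 := lipschitz_ge0.
have H (s : R) : `|s| = 1 -> 0 <= complex.Im (('D_1 Phi z)^-1 * (s +i* (L + 1))).
  move=> s1; apply: Im_inv_deriv_ge0 => //=.
    rewrite eq_complex /= negb_and; apply/orP; right.
    by rewrite gt_eqF// ltr_wpDl.
  by rewrite s1 mulr1 lerDl.
have := H 1 (normr1 _); have := H (-1) (normrN1 _).
rewrite !cImM /=; set x := complex.Re _; set y := complex.Im _ => h1 h2.
apply: sector_bound; [move: h2|move: h1]; rewrite (mulrC (L + 1)) ?mulr1 ?mulrN1//.
Qed.

(** Inversion conjugates up to a positive factor, and the sector is symmetric about the real
    axis. *)
Lemma deriv_sector z : uhp z ->
  `|complex.Im ('D_1 Phi z)| <= (L + 1) * complex.Re ('D_1 Phi z).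
Proof.
move=> zU; have := inv_deriv_sector zU; rewrite cImV cReV mulNr normrN normrM.
have D0 : 0 < cabs ('D_1 Phi z) ^+ 2.
  by rewrite exprn_gt0// cabs_gt0; exact: conformal_deriv_neq0.
by rewrite mulrA normfV (gtr0_norm D0) ler_pM2r// invr_gt0.
Qed.

End conformal_geometry.

(** * Averages over curves approaching the boundary *)

Section poisson_bound.
Context (R : realType).
Implicit Types (f h : cplane R -> cplane R) (z w : cplane R) (a b x y s t : R).
Notation mu := (@lebesgue_measure R).

Lemma rint_FTC (F f : R -> R) a b : a <= b ->
  (forall t, a <= t <= b -> is_derive t 1 F (f t)) ->
  (forall t, a <= t <= b -> {for t, continuous f}) -> rint a b f = F b - F a.
Proof.
rewrite le_eqVlt => /predU1P[<-|ab] dF cf.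
  by rewrite subrr /rint set_itv1 Rintegral_set1.
have cF t : a <= t <= b -> {for t, continuous F}.
  by move=> /dF[+ _] => /derivable1_diffP/differentiable_continuous.
have cFw := within_cont cF.
rewrite /rint /Rintegral (@continuous_FTC2 R f F a b ab)//.
- exact: within_cont.
- have /(continuous_within_itvP _ ab)[_ cFa cFb] := cFw.
  split=> // t; rewrite in_itv /= => /andP[t1 t2].
  by have [] := dF t; rewrite ?ltW.
- move=> t; rewrite in_itv /= => /andP[t1 t2]; rewrite derive1E.
  by have [|_ ->] := dF t; rewrite ?ltW.
Qed.

Lemma rint_subst (F f G : R -> R) a b : a <= b ->
  (forall t, is_derive t 1 F (f t)) -> continuous f ->
  {homo F : u v / u < v} ->
  (forall u, F a <= u <= F b -> {for u, continuous G}) ->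
  rint (F a) (F b) G = rint a b (fun t => G (F t) * f t).
Proof.
move=> ab dF cf incF cG.
have F' : derive1 F = f by apply/funext => t; rewrite derive1E; have [_ ->] := dF t.
have cF t : {for t, continuous F}.
  by have [+ _] := dF t => /derivable1_diffP/differentiable_continuous.
rewrite /rint /Rintegral (@integration_by_substitution_increasing R F G a b ab).
- by congr fine; apply: eq_integral => t _ /=; rewrite F'.
- by move=> u v _ _; exact: incF.
- by move=> t _; rewrite F'; exact: cf.
- by rewrite F'; apply/cvg_ex; exists (f a); apply: cvg_at_right_filter; exact: cf.
- by rewrite F'; apply/cvg_ex; exists (f b); apply: cvg_at_left_filter; exact: cf.
- split.
  + by move=> t _; have [] := dF t.
  + by apply: cvg_at_right_filter; exact: cF.
  + by apply: cvg_at_left_filter; exact: cF.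
- exact: within_cont.
Qed.

Definition cayley z : cplane R := 'i * (1 - z) / (1 + z).

Lemma cayley_uhp z : cabs z < 1 -> uhp (cayley z).
Proof.
move=> z1; rewrite /uhp /=.
have n0 : 1 + z != 0.
  apply: contraTneq z1 => /eqP; rewrite addrC addr_eq0 => /eqP ->.
  by rewrite cabsN cabs1 ltxx.
have n1 : 0 < cabs (1 + z) ^+ 2 by rewrite exprn_gt0// cabs_gt0.
have z2 : complex.Re z ^+ 2 + complex.Im z ^+ 2 < 1.
  by rewrite -cabs_sqr expr_lt1// cabs_ge0.
rewrite /cayley cImM cReV cImV !cReM !cImM !cReD !cImD !cReN !cImN /=.
move: n1; move: (cabs (1 + z) ^+ 2) => N N0.
have -> : (0 * (1 - complex.Re z) - 1 * (0 - complex.Im z)) * (- (0 + complex.Im z) / N) +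
   (0 * (0 - complex.Im z) + 1 * (1 - complex.Re z)) * ((1 + complex.Re z) / N) =
   (1 - (complex.Re z ^+ 2 + complex.Im z ^+ 2)) / N by ring.
by rewrite divr_gt0// subr_gt0.
Qed.

Lemma cayley0 : cayley 0 = 'i.
Proof. by rewrite /cayley subr0 addr0 mulr1 divr1. Qed.

Lemma derivable_cayley z : cabs z < 1 -> derivable cayley z 1.
Proof.
move=> z1; have n0 : 1 + z != 0.
  apply: contraTneq z1 => /eqP; rewrite addrC addr_eq0 => /eqP ->.
  by rewrite cabsN cabs1 ltxx.
apply: (@cderivableM R (fun z => 'i * (1 - z)) (fun z => (1 + z)^-1)).
  apply: (@cderivableM R (fun=> 'i) (fun z => 1 - z)); first exact: cderivable_cst.
  by apply: (@cderivableB R (fun=> 1)); [exact: cderivable_cst|exact: cderivable_id].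
apply: (@cderivableV R (fun z => 1 + z)); first exact: n0.
by apply: (@cderivableD R (fun=> 1)); [exact: cderivable_cst|exact: cderivable_id].
Qed.

(* A family of curves approaching the real line as k -> 0: the images of the
   concentric circles under the Cayley transform. *)
Definition crv (k s : R) : cplane R := (s +i* k) / (1 -i* (k * s)).

Lemma crv_den (k s : R) : (1 -i* (k * s) : cplane R) != 0.
Proof. by rewrite eq_complex /= oner_eq0. Qed.

Lemma crvE (k s : R) : crv k s =
  (s * (1 - k ^+ 2) / (1 + (k * s) ^+ 2)) +i* (k * (1 + s ^+ 2) / (1 + (k * s) ^+ 2)).
Proof.
have d0 : 1 + (k * s) ^+ 2 != 0 by rewrite gt_eqF// ltr_pwDl// sqr_ge0.
apply: (mulIf (crv_den k s)); rewrite mulfVK ?crv_den//.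
by apply: complex_eq => /=; field; exact: d0.
Qed.

Lemma cos_sin_2atan s : cos (2 * atan s) = (1 - s ^+ 2) / (1 + s ^+ 2) /\
  sin (2 * atan s) = 2 * s / (1 + s ^+ 2).
Proof.
have c0 : cos (atan s) != 0.
  by rewrite gt_eqF// cos_gt0_pihalf// atan_gtNpi2 atan_ltpi2.
have H := cos2_tan2 c0; rewrite atanK in H.
have d0 : 1 + s ^+ 2 != 0 by rewrite gt_eqF// ltr_pwDl// sqr_ge0.
have c2 : cos (atan s) ^+ 2 = (1 + s ^+ 2)^-1 by rewrite -H invrK.
have ss : sin (atan s) = s * cos (atan s).
  by have := atanK s; rewrite /tan => {2}<-; rewrite mulfVK.
rewrite !(mulrC 2) !mulr_natr cos_mulr2n sin_mulr2n c2; split.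
  by field; exact: d0.
by rewrite ss mulrCA -expr2 c2; field; exact: d0.
Qed.

(** With [s] the tangent of half the angle, the circle of radius [(1 - k) / (1 + k)] becomes the
    curve [crv k], which passes through [0 +i* k] and becomes the real line at [k = 0]. *)
Lemma cayley_circ (k s : R) : 0 < k ->
  cayley (circ 0 ((1 - k) / (1 + k)) (2 * atan s)) = crv k s.
Proof.
move=> k0; have [ce se] := cos_sin_2atan s.
have d0 : 1 + s ^+ 2 != 0 by rewrite gt_eqF// ltr_pwDl// sqr_ge0.
have k1 : 1 + k != 0 by rewrite gt_eqF// addr_gt0.
have e0 : 1 + circ 0 ((1 - k) / (1 + k)) (2 * atan s) != 0.
  rewrite -cabs_gt0; apply: (@lt_le_trans _ _ (complex.Re (1 + circ 0 ((1 - k) / (1 + k)) (2 * atan s)))); last first.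
    exact: le_trans (ler_norm _) (Re_le_cabs _).
  rewrite /circ add0r cReD /= ce.
  have -> : 1 + (1 - k) / (1 + k) * ((1 - s ^+ 2) / (1 + s ^+ 2)) =
    (2 + 2 * k * s ^+ 2) / ((1 + k) * (1 + s ^+ 2)) by field; rewrite d0 k1.
  have ks : 0 <= k * s ^+ 2 by rewrite mulr_ge0 ?sqr_ge0// ltW.
  have s1 : 0 < 1 + s ^+ 2 by rewrite ltr_pwDl// sqr_ge0.
  apply: divr_gt0; last by rewrite mulr_gt0// addr_gt0.
  by rewrite -mulrA ltr_pwDl// mulr_ge0.
rewrite /cayley /crv; apply: (mulIf e0); rewrite mulfVK//.
apply: (mulIf (crv_den k s)); rewrite [RHS]mulrAC mulfVK ?crv_den//.
rewrite /circ add0r ce se.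
by apply: complex_eq; rewrite ?cReM ?cImM /=; field; rewrite d0 k1.
Qed.

Lemma uhp_affine x y z : 0 < y -> uhp z -> uhp (x%:C + y%:C * z).
Proof. by move=> y0 z0; rewrite /uhp /= cImD cImM /= mul0r addr0 add0r mulr_gt0. Qed.

Lemma circ_mean_Re h x y (r : R) : 0 < y -> 0 < r -> r < 1 -> holomorphic_on (@uhp R) h ->
  rint (- pi) pi (fun t => complex.Re (h (x%:C + y%:C * cayley (circ 0 r t)))) =
  complex.Re (h (x +i* y)) * (2 * pi).
Proof.
move=> y0 r0 r1 hh; pose f z := h (x%:C + y%:C * cayley z).
have df z : cabs (z - 0) <= r -> derivable f z 1.
  rewrite subr0 => zr; have z1 := le_lt_trans zr r1.
  apply: (@cderivable_comp R h (fun z => x%:C + y%:C * cayley z)).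
    apply: (@cderivableD R (fun=> x%:C)); first exact: cderivable_cst.
    by apply: (@cderivableM R (fun=> y%:C)); [exact: cderivable_cst|exact: derivable_cayley].
  by apply: hh; apply: uhp_affine => //; exact: cayley_uhp.
have := mean_value r0 df; rewrite /f cayley0 => H.
have -> : rint (- pi) pi (fun t => complex.Re (h (x%:C + y%:C * cayley (circ 0 r t)))) =
  complex.Re (circint f 0 r) by [].
rewrite [circint f 0 r]H cReMr; congr (complex.Re (h _) * _).
by apply: complex_eq; rewrite !ReImE /=; ring.
Qed.

(** A truncated Poisson formula on a curve inside the half-plane. The angle is
    [2 * atan ((t - x) / y)], whose density is at least [2 / (y * (1 + T ^+ 2))] for
    [|t - x| <= T * y]. The rest of the circle is dropped because [Re h >= 0], and the mean over the
    whole circle is the value at [x +i* y]. *)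
Lemma poisson_le h x y (T k : R) : 0 < y -> 0 < T -> 0 < k -> k < 1 ->
  holomorphic_on (@uhp R) h -> (forall z, uhp z -> 0 <= complex.Re (h z)) ->
  rint (x - T * y) (x + T * y)
    (fun t => complex.Re (h (x%:C + y%:C * crv k ((t - x) / y)))) <=
  pi * (1 + T ^+ 2) * y * complex.Re (h (x +i* y)).
Proof.
move=> y0 T0 k0 k1 hh hp; pose r := (1 - k) / (1 + k).
have k10 : 0 < 1 + k by rewrite addr_gt0.
have r0 : 0 < r by rewrite divr_gt0// subr_gt0.
have r1 : r < 1 by rewrite ltr_pdivrMr// mul1r; move: k0; clear; lra.
pose G t := complex.Re (h (x%:C + y%:C * cayley (circ 0 r t))).
pose F t := 2 * atan ((t - x) / y).
pose f t := 2 * (y^-1 * (1 + ((t - x) / y) ^+ 2)^-1).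
have cu t : uhp (cayley (circ 0 r t)).
  by apply: cayley_uhp; rewrite -[X in cabs X]subr0 cabs_circ gtr0_norm.
have cG t : {for t, continuous G}.
  apply: ccont_Re; apply: (@ccont_circ R (fun z => h (x%:C + y%:C * cayley z))).
  apply: derivable_ccont; apply: (@cderivable_comp R h (fun z => x%:C + y%:C * cayley z)).
    apply: (@cderivableD R (fun=> x%:C)); first exact: cderivable_cst.
    apply: (@cderivableM R (fun=> y%:C)); first exact: cderivable_cst.
    by apply: derivable_cayley; rewrite -[X in cabs X]subr0 cabs_circ gtr0_norm.
  by apply: hh; apply: uhp_affine => //; exact: cu.
have G0 t : 0 <= G t by apply: hp; apply: uhp_affine => //; exact: cu.
have dF t : is_derive t 1 F (f t).
  have d1 : is_derive t (1 : R) (fun t => (t - x) / y) y^-1.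
    by apply: is_derive_eq; rewrite subr0 scaler0 add0r [_ *: _]mulr1.
  have d2 := is_derive1_atan ((t - x) / y).
  have d3 := @is_derive1_comp R (@atan R) (fun t => (t - x) / y) t _ _ d2 d1.
  rewrite /F /f; apply: is_derive_eq.
  by rewrite [LHS]mulrC mulrC; congr (_ * _); rewrite mulrC.
have den0 t : 0 < 1 + ((t - x) / y) ^+ 2 by rewrite ltr_pwDl// sqr_ge0.
have cf : continuous f.
  move=> t.
  have c1 : {for t, continuous (fun t => t - x)}.
    by apply: (@continuousB R R R id (fun=> x)); [exact: cvg_id|exact: cst_continuous].
  have c2 : {for t, continuous (fun t => (t - x) / y)}.
    by apply: (@continuousM R R (fun t => t - x) (fun=> y^-1)); [exact: c1|exact: cst_continuous].
  have c3 : {for t, continuous (fun t => 1 + ((t - x) / y) ^+ 2)}.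
    apply: (@continuousD R R R (fun=> 1) (fun t => ((t - x) / y) ^+ 2)); first exact: cst_continuous.
    apply: (@continuous_comp R R R (fun t => (t - x) / y) (fun u => u ^+ 2)); first exact: c2.
    exact: exprn_continuous.
  have c4 : {for t, continuous (fun t => (1 + ((t - x) / y) ^+ 2)^-1)}.
    by apply: (@continuousV R R (fun t => 1 + ((t - x) / y) ^+ 2)); [rewrite gt_eqF|exact: c3].
  apply: (@continuousM R R (fun=> 2) (fun t => y^-1 * (1 + ((t - x) / y) ^+ 2)^-1)).
    exact: cst_continuous.
  apply: (@continuousM R R (fun=> y^-1) (fun t => (1 + ((t - x) / y) ^+ 2)^-1)).
    exact: cst_continuous.
  exact: c4.
have incF : {homo F : u v / u < v}.
  by move=> u v uv; rewrite /F ltr_pM2l// lt_atan// ltr_pM2r ?invr_gt0// ltrD2r.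
have ab : x - T * y <= x + T * y.
  have : 0 < T * y by rewrite mulr_gt0. by move: (T * y); clear; move=> u u0; lra.
have := rint_subst ab dF cf incF (fun u _ => cG u) => HS.
have F1 t : - pi <= F t.
  by have := atan_gtNpi2 ((t - x) / y); rewrite /F; move: (atan _) (pi : R); clear; move=> u v; lra.
have F2 t : F t <= pi.
  by have := atan_ltpi2 ((t - x) / y); rewrite /F; move: (atan _) (pi : R); clear; move=> u v; lra.
have Fab : F (x - T * y) <= F (x + T * y).
  by move: ab; rewrite le_eqVlt => /predU1P[->//|h1]; rewrite ltW// incF.
have I0 u v : u <= v -> 0 <= rint u v G.
  move=> uv; rewrite -[leLHS](mul0r (v - u)) -rint_cst//; apply: rint_le.
  - by move=> t _; exact: cst_continuous.
  - by move=> t _; exact: cG.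
  - by move=> t _; exact: G0.
have HI : rint (F (x - T * y)) (F (x + T * y)) G <= complex.Re (h (x +i* y)) * (2 * pi).
  rewrite -(circ_mean_Re x y0 r0 r1 hh).
  rewrite (@rint_cat R (- pi) (F (x - T * y)) pi); [|exact: F1|exact: F2|by move=> t _; exact: cG].
  rewrite (@rint_cat R (F (x - T * y)) (F (x + T * y)) pi); [|exact: Fab|exact: F2|by move=> t _; exact: cG].
  have := I0 _ _ (F1 (x - T * y)); have := I0 _ _ (F2 (x + T * y)).
  move: (rint _ _ _) (rint _ _ _) (rint _ _ _); clear; move=> u v w; lra.
have GE t : G (F t) = complex.Re (h (x%:C + y%:C * crv k ((t - x) / y))).
  by rewrite /G /F cayley_circ.
have T10 : 0 < 1 + T ^+ 2 by rewrite ltr_pwDl// sqr_ge0.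
have H2 : rint (x - T * y) (x + T * y)
    (fun t => 2 / (y * (1 + T ^+ 2)) * complex.Re (h (x%:C + y%:C * crv k ((t - x) / y)))) <=
    rint (x - T * y) (x + T * y) (fun t => G (F t) * f t).
  have cGF t : {for t, continuous (fun t => G (F t))}.
    apply: (@continuous_comp R R R F G); last exact: cG.
    by have [+ _] := dF t => /derivable1_diffP/differentiable_continuous.
  have -> : (fun t => 2 / (y * (1 + T ^+ 2)) * complex.Re (h (x%:C + y%:C * crv k ((t - x) / y)))) =
    (fun t => 2 / (y * (1 + T ^+ 2)) * G (F t)) by apply/funext => t; rewrite GE.
  apply: rint_le.
  - by move=> t _; apply: (@continuousM R R (fun=> 2 / (y * (1 + T ^+ 2))) (fun t => G (F t))); [exact: cst_continuous|exact: cGF].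
  - by move=> t _; apply: (@continuousM R R (fun t => G (F t)) f); [exact: cGF|exact: cf].
  - move=> t tI; rewrite mulrC; apply: ler_wpM2l; first exact: G0.
    rewrite /f ler_pM2l// invfM ler_pM2l ?invr_gt0// lef_pV2 ?posrE//.
    rewrite lerD2l -real_normK ?num_real// lerXn2r ?nnegrE ?(ltW T0)//.
    rewrite ler_norml; move: tI => /andP[t1 t2]; apply/andP; split.
      by rewrite ler_pdivlMr// mulNr; move: t1; move: (T * y); clear; move=> u; lra.
    by rewrite ler_pdivrMr//; move: t2; move: (T * y); clear; move=> u; lra.
move: H2; rewrite rintZ; last first.
  move=> t _; have -> : (fun t => complex.Re (h (x%:C + y%:C * crv k ((t - x) / y)))) =
    (fun t => G (F t)) by apply/funext => u; rewrite GE.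
  apply: (@continuous_comp R R R F G); last exact: cG.
  by have [+ _] := dF t => /derivable1_diffP/differentiable_continuous.
rewrite -HS => /le_trans/(_ HI).
have yT : 0 < y * (1 + T ^+ 2) by rewrite mulr_gt0.
rewrite -ler_pdivlMl ?divr_gt0// invf_div => /le_trans; apply.
rewrite le_eqVlt; apply/orP; left; apply/eqP.
by move: (pi : R) => P; field.
Qed.

End poisson_bound.

(** * Measurability and Fatou's lemma at the boundary *)

Section derive1_measurable.
Context {R : realType}.
Implicit Types f : R -> R.

Let q f (h x : R) : R := h^-1 *: (f (h + x) - f x).

Lemma continuous_quotient f h : continuous f -> continuous (q f h).
Proof.
move=> cf x; rewrite /q; apply: cvgZr; apply: cvgB; last exact: cf.
apply: (@continuous_comp _ _ _ (fun x => h + x) f); last exact: cf.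
by apply: cvgD; [exact: cvg_cst|exact: cvg_id].
Qed.

(** The Cauchy criterion for the difference quotients at 0. The intersection over [p] is
    uncountable; the final inequality is not strict so that it is an intersection of closed sets. *)
Let A f : set R := \bigcap_k \bigcup_m \bigcap_(p in [set p : R * R |
   [/\ p.1 != 0, p.2 != 0, `|p.1| < m.+1%:R^-1 & `|p.2| < m.+1%:R^-1]])
   [set x | `|q f p.1 x - q f p.2 x| <= k.+1%:R^-1].

Lemma measurable_A f : continuous f -> measurable (A f : set (measurableTypeR R)).
Proof.
move=> cf; apply: bigcap_measurable => [|k _]; first by exists 0%N.
apply: bigcup_measurable => m _; apply: closed_measurable.
apply: closed_bigI => p _.
rewrite (_ : mkset _ = (fun x => `|q f p.1 x - q f p.2 x|) @^-1` [set y | y <= k.+1%:R^-1]) //.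
apply: preimage_closed; last exact: closed_le.
move=> x _; apply: cvg_norm; apply: cvgB; exact: continuous_quotient.
Qed.

Lemma A_cvg f x : A f x <-> cvg (q f h x @[h --> 0^']).
Proof.
split=> [Ax|/cvg_cauchy/cauchy_ballP H].
  apply/cauchy_cvgP/cauchy_ballP => e e0; near_simpl.
  have [k ke] : exists k, k.+1%:R^-1 < e by have [k] := ltr_add_invr e0; rewrite add0r; exists k.
  have [m _ Am] := Ax k I.
  have m0 : 0 < m.+1%:R^-1 :> R by rewrite invr_gt0.
  have F : \forall h \near (0 : R)^', h != 0 /\ `|h| < m.+1%:R^-1 :> R.
    apply/nbhs_ballP; exists m.+1%:R^-1 => //= h; rewrite /ball /= sub0r normrN => h1 h2; exact: (conj h2 h1).
  exists ([set h | h != 0 /\ `|h| < m.+1%:R^-1], [set h | h != 0 /\ `|h| < m.+1%:R^-1]) => //=.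
  by move=> [h h'] /= [[h1 h2] [h3 h4]]; apply: le_lt_trans ke; exact: (Am (h, h')).
move=> k _; have k0 : 0 < k.+1%:R^-1 :> R by rewrite invr_gt0.
have := H _ k0; near_simpl => -[[P Q] /= [/nbhs_ballP[r r0 rP] /nbhs_ballP[s s0 sQ]] PQ].
have rs0 : 0 < Num.min r s by rewrite lt_min r0 s0.
have [m] := ltr_add_invr rs0; rewrite add0r => mr.
move: mr; rewrite lt_min => /andP[mr ms].
exists m => // -[h h'] /= [h0 h0' hm hm'].
have := PQ (h, h'); rewrite /ball /= => /(_ _)/ltW; apply; split.
  by apply: rP => //=; rewrite /ball /= sub0r normrN; exact: lt_trans mr.
by apply: sQ => //=; rewrite /ball /= sub0r normrN; exact: lt_trans ms.
Qed.

(** On [A f] the derivative is the limit of the continuous quotients with step [n.+1%:R^-1]; off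
    [A f] the limit does not exist and [derive1] takes the constant default [point]. *)
Lemma measurable_derive1 f : continuous f ->
  measurable_fun [set: measurableTypeR R] (derive1 f : R -> measurableTypeR R).
Proof.
move=> cf; have mA := measurable_A cf.
rewrite -(setvU (A f)); apply/measurable_funU => //; first exact: measurableC.
split.
  apply: (@eq_measurable_fun _ _ _ _ _ (cst point)) => // x /set_mem /= nA.
  by apply/esym/dvgP => h; apply: nA; exact: (A_cvg f x).2 h.
apply: (@measurable_fun_cvg _ _ R (A f) (fun n x => q f n.+1%:R^-1 x)) => [m|x /A_cvg cx].
  by apply: measurable_funTS; apply: continuous_measurable_fun; exact: continuous_quotient.
rewrite /= in cx.
have := @cvg_at_rightP R (q f ^~ x) 0 (derive1 f x).
move=> [H _]; apply: H.
  exact: (cvg_dnbhs_at_right cx).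
split=> [n|]; first by rewrite invr_gt0.
exact: cvg_harmonic.
Qed.
End derive1_measurable.
Section fatou_segment.
Context {R : realType}.
Notation mu := (@lebesgue_measure R).

Lemma measurable_limn_einf (D : set (measurableTypeR R))
    (f : (measurableTypeR R -> \bar R)^nat) :
  (forall n, measurable_fun D (f n)) ->
  measurable_fun D (fun x => limn_einf (f ^~ x)).
Proof.
move=> mf; apply: measurableT_comp => //.
apply: (@measurable_fun_limn_esup _ _ _ D (fun n x => - f n x)%E) => n.
by apply: measurableT_comp => //; exact: mf.
Qed.

Lemma limn_einf_le (u v : nat -> \bar R) (l : \bar R) : (forall n, u n <= v n)%E ->
  v n @[n --> \oo] --> l -> (limn_einf u <= l)%E.
Proof.
move=> uv vl; rewrite limn_einf_lim -(cvg_lim _ vl)//.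
apply: lee_lim; [exact: is_cvg_einfs|by apply/cvg_ex; exists l|].
apply: nearW => n; apply: le_trans (uv n).
by apply: ereal_inf_lbound; exists n => /=.
Qed.

(** The function [u] need only lie below the pointwise limit. In the applications the limit is the
    real part of a boundary value, and [u] its modulus divided by the sector constant. *)
Lemma fatou_rint (a b : R) (f : nat -> R -> R) (B : nat -> R) (b0 : R) (u : R -> R) :
  (forall n t, a <= t <= b -> {for t, continuous (f n)}) ->
  (forall n t, a <= t <= b -> 0 <= f n t) ->
  (forall n, rint a b (f n) <= B n) -> B n @[n --> \oo] --> b0 ->
  measurable_fun `[a, b] u -> (forall t, 0 <= u t) ->
  {ae mu, forall t, a <= t <= b -> exists2 v, f n t @[n --> \oo] --> v & u t <= v} ->
  (\int[mu]_(t in `[a, b]) (u t)%:E <= b0%:E)%E.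
Proof.
move=> cf f0 fB Bb mu_u u0 H.
have mf n : measurable_fun (`[a, b] : set (measurableTypeR R)) (EFin \o f n).
  by have /integrableP[] := cont_integrable (cf n).
have f0' n t : `[a, b]%classic t -> (0 <= (EFin \o f n) t)%E.
  by rewrite /= in_itv /= lee_fin; exact: f0.
apply: (@le_trans _ _ (\int[mu]_(t in `[a, b]) limn_einf (fun n => (f n t)%:E))%E).
  apply: ae_ge0_le_integral => //.
  - by move=> t _; rewrite lee_fin.
  - by apply/measurable_EFinP.
  - move=> t ab; rewrite limn_einf_lim; apply: lime_ge; first exact: is_cvg_einfs.
    by apply: nearW => n; apply: le_ereal_inf_tmp => _ [m _ <-]; exact: f0'.
  - exact: (@measurable_limn_einf `[a, b] (fun n => EFin \o f n)).
  have [N [mN N0 sN]] := H; exists N; split => //= t tN; apply: sN => /= {}H; apply: tN.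
  rewrite /= in_itv /= => /H [v fv uv].
  have fv' : (f n t)%:E @[n --> \oo] --> v%:E by apply: cvg_EFin; [exact: nearW|exact: fv].
  rewrite is_cvg_limn_einfE; last by apply/cvg_ex; exists v%:E.
  by rewrite (cvg_lim _ fv').
apply: le_trans (@fatou _ _ _ mu `[a, b]%classic _ (fun n => EFin \o f n) mf f0') _ => //.
apply: (@limn_einf_le _ (fun n => (B n)%:E)).
  move=> n; apply: le_trans (_ : (rint a b (f n))%:E <= _)%E; last by rewrite lee_fin.
  rewrite /rint /Rintegral fineK//; apply: integrable_fin_num => //.
  exact: (cont_integrable (cf n)).
by apply: cvg_EFin; [exact: nearW|exact: Bb].
Qed.
End fatou_segment.

(** * The Poisson bound on the real line *)

Section poisson_boundary.
Context {R : realType}.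
Notation mu := (@lebesgue_measure R).
Implicit Types (h : cplane R -> cplane R) (x y T t k : R) (p : nat -> cplane R).

(** The sequence eventually enters every cone at [t], however narrow, so a limit known in any one
    cone applies to it. *)
Definition nontangential t p :=
  [/\ forall n, uhp (p n),
      forall e : R, 0 < e -> \forall n \near \oo, `|t - complex.Re (p n)| <= e * complex.Im (p n) &
      p n @[n --> \oo] --> (t%:C : cplane R)].

Let q x y t k : cplane R := x%:C + y%:C * crv k ((t - x) / y).

Lemma crv_uhp x y t k : 0 < y -> 0 < k -> uhp (q x y t k).
Proof.
move=> y0 k0; apply: uhp_affine => //; rewrite crvE /uhp /= divr_gt0//.
  by rewrite mulr_gt0// ltr_pwDl// sqr_ge0.
by rewrite ltr_pwDl// sqr_ge0.
Qed.

Lemma continuous_crv x y t k : {for t, continuous (fun t => q x y t k)}.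
Proof.
have cl (a b c d : R) : {for t, continuous (fun t : R => (a + b * ((t - x) / y)) +i* (c + d * ((t - x) / y)) : cplane R)}.
  have c2 : {for t, continuous (fun t => (t - x) / y)}.
    apply: (@continuousM R R (fun t => t - x) (fun=> y^-1)); last exact: cst_continuous.
    by apply: (@continuousB R R R id (fun=> x)); [exact: cvg_id|exact: cst_continuous].
  have c3 e f : {for t, continuous (fun t => e + f * ((t - x) / y))}.
    apply: (@continuousD R R R (fun=> e) (fun t => f * ((t - x) / y))); first exact: cst_continuous.
    by apply: (@continuousM R R (fun=> f) (fun t => (t - x) / y)); [exact: cst_continuous|exact: c2].
  exact: ccont_complex (c3 a b) (c3 c d).
apply: (@ccontD R R (fun=> x%:C) (fun t => y%:C * crv k ((t - x) / y))); first exact: ccont_cst.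
apply: (@ccontM R R (fun=> y%:C) (fun t => crv k ((t - x) / y))); first exact: ccont_cst.
apply: (@ccontM R R (fun t => ((t - x) / y) +i* k) (fun t => (1 -i* (k * ((t - x) / y)))^-1)).
  have -> : (fun t => ((t - x) / y) +i* k) =
    (fun t => (0 + 1 * ((t - x) / y)) +i* (k + 0 * ((t - x) / y)) : cplane R).
    by apply/funext => s; rewrite add0r mul1r mul0r addr0.
  exact: cl.
apply: (@ccontV R R (fun t => 1 -i* (k * ((t - x) / y)))); first exact: crv_den.
have -> : (fun t => 1 -i* (k * ((t - x) / y))) =
  (fun t => (1 + 0 * ((t - x) / y)) +i* (0 + (- k) * ((t - x) / y)) : cplane R).
  by apply/funext => s; rewrite mul0r addr0 add0r mulNr.
exact: cl.
Qed.

(** The horizontal distance to [t] divided by the height is [k * |t - x| / y], so the curves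
    approach each [t] vertically as [k -> 0]. *)
Lemma crv_ReE x y t k : 0 < y ->
  t - complex.Re (q x y t k) = k * ((t - x) / y) * complex.Im (q x y t k).
Proof.
move=> y0; rewrite /q crvE /=.
have e : t = x + y * ((t - x) / y) by rewrite mulrC divfK ?gt_eqF//; ring.
have : 1 + (k * ((t - x) / y)) ^+ 2 != 0 by rewrite gt_eqF// ltr_pwDl// sqr_ge0.
move: e; move: (_ / y) => s -> s0; field.
by rewrite s0.
Qed.

(** The shift by two keeps every parameter strictly below 1, as [poisson_le] requires. *)
Lemma cvg_inv_succ2 : (n.+2%:R^-1 : R) @[n --> \oo] --> 0.
Proof. by have := @cvg_harmonic R; rewrite -(cvg_shiftS (@harmonic R)). Qed.

Lemma nontangential_crv x y T t : 0 < y -> 0 < T -> x - T * y <= t <= x + T * y ->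
  nontangential t (fun n => q x y t n.+2%:R^-1).
Proof.
move=> y0 T0 tI; set s := (t - x) / y.
have sT : `|s| <= T.
  by rewrite ler_norml ler_pdivrMr// ler_pdivlMr//; lra.
split=> [n|e e0|].
- by apply: crv_uhp => //; rewrite invr_gt0.
- have : \forall n \near \oo, n.+2%:R^-1 < e / T.
    have := cvg_inv_succ2 => /cvgrPdist_lt /(_ (e / T)); rewrite divr_gt0// => /(_ isT).
    by apply: filterS => n; rewrite sub0r normrN gtr0_norm// invr_gt0.
  apply: filterS => n nk; rewrite crv_ReE// -/s normrM.
  have I0 : 0 < complex.Im (q x y t n.+2%:R^-1) by apply: crv_uhp; rewrite ?invr_gt0.
  rewrite (gtr0_norm I0) ler_pM2r// normrM.
  rewrite ger0_norm ?invr_ge0//; move: nk; rewrite ltr_pdivlMr// => /ltW; apply: le_trans.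
  by rewrite ler_pM2l ?invr_gt0.
have -> : (t%:C : cplane R) = x%:C + y%:C * (s +i* 0).
  by apply: complex_eq; rewrite /= ?mul0r ?mulr0 ?subr0 ?addr0// mulrC divfK ?gt_eqF//; ring.
have e1 n : q x y t n.+2%:R^-1 =
  (x + y * (s * (1 - n.+2%:R^-1 ^+ 2) / (1 + (n.+2%:R^-1 * s) ^+ 2))) +i*
  (y * (n.+2%:R^-1 * (1 + s ^+ 2) / (1 + (n.+2%:R^-1 * s) ^+ 2))).
  by rewrite /q crvE; apply: complex_eq; rewrite /= -/s ?mul0r ?subr0 ?addr0 ?add0r//; ring.
under eq_cvg do rewrite e1.
have k0 := cvg_inv_succ2.
have dn : 1 + (n.+2%:R^-1 * s) ^+ 2 @[n --> \oo] --> (1 : R).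
  rewrite -[X in _ --> X]addr0; apply: cvgD; first exact: cvg_cst.
  rewrite -[X in _ --> X](expr0n R 2) -(mul0r s).
  rewrite !expr2; apply: cvgM; apply: cvgMl; exact: k0.
have dV : (1 + (n.+2%:R^-1 * s) ^+ 2)^-1 @[n --> \oo] --> (1 : R).
  by rewrite -[X in _ --> X]invr1; apply: cvgV.
have -> : x%:C + y%:C * (s +i* 0) =
  (x + y * (s * (1 - 0 * 0) * 1)) +i* (y * (0 * (1 + s ^+ 2) * 1)) :> cplane R.
  by apply: complex_eq; rewrite /=; ring.
apply: cvg_complex.
  apply: cvgD; first exact: cvg_cst.
  apply: cvgMr; apply: cvgM; last exact: dV.
  by apply: cvgMr; apply: cvgB; [exact: cvg_cst|apply: cvgM].
by apply: cvgMr; apply: cvgM; [apply: cvgMl|].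
Qed.

(** Fatou's lemma applied to [poisson_le] as [k -> 0]. The boundary behaviour of [h] enters only
    through the lower bound [u] of its nontangential limits. *)
Lemma poisson_boundary h x y T (u : R -> R) : 0 < y -> 0 < T ->
  holomorphic_on (@uhp R) h -> (forall z, uhp z -> 0 <= complex.Re (h z)) ->
  measurable_fun (`[x - T * y, x + T * y] : set (measurableTypeR R)) u ->
  (forall t, 0 <= u t) ->
  {ae mu, forall t, forall p, nontangential t p ->
     exists2 v : R, complex.Re (h (p n)) @[n --> \oo] --> v & u t <= v} ->
  (\int[mu]_(t in `[(x - T * y)%R, (x + T * y)%R]) (u t)%:E <=
   (pi * (1 + T ^+ 2) * y * complex.Re (h (x +i* y)))%:E)%E.
Proof.
move=> y0 T0 hh h0 mu_u u0 [N [mN N0 sN]].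
apply: (@fatou_rint R _ _ (fun n t => complex.Re (h (q x y t n.+2%:R^-1)))
  (fun=> pi * (1 + T ^+ 2) * y * complex.Re (h (x +i* y)))) => //.
- move=> n t _; apply: ccont_Re.
  apply: (@continuous_comp _ _ _ (fun t => q x y t n.+2%:R^-1) h); first exact: continuous_crv.
  by apply: derivable_ccont; apply: hh; apply: crv_uhp; rewrite ?invr_gt0.
- by move=> n t _; apply: h0; apply: crv_uhp; rewrite ?invr_gt0.
- by move=> n; apply: poisson_le; rewrite ?invr_gt0// invf_lt1// ltr1n.
- exact: cvg_cst.
exists N; split => // t tN; apply: sN => /= H; apply: tN => tI.
by apply: H; exact: nontangential_crv tI.
Qed.
End poisson_boundary.

(** * Boundary estimates for the conformal mapping *)

Section conformal_boundary.
Context {R : realType} (gamma : R -> R) (L x0 : R) (Phi : cplane R -> cplane R).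
Hypotheses (lip : L.-lipschitz gamma) (Hc : conformal_map gamma Phi x0).
Notation mu := (@lebesgue_measure R).
Notation D t := (cabs (curve_deriv (bdry Phi) t)).
Notation X t := (complex.Re (bdry Phi t)).
Notation dPhi := ('D_1 Phi).

Let L0 : 0 <= L := lipschitz_ge0 lip.

Lemma sector_cabs (l : R) (z : cplane R) : 0 < l ->
  `|complex.Im z| <= l * complex.Re z -> cabs z <= (l + 1) * complex.Re z.
Proof.
move=> l0 h; apply: le_trans (cabs_le_ReIm z) _.
have [r0|r0] := leP 0 (complex.Re z).
  by rewrite ger0_norm// mulrDl mul1r addrC lerD2r.
have := normr_ge0 (complex.Im z); have : l * complex.Re z < 0 by rewrite pmulr_rlt0.
by move=> h1 /le_trans/(_ h); rewrite leNgt h1.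
Qed.

Lemma deriv_cabs z : uhp z -> cabs (dPhi z) <= (L + 2) * complex.Re (dPhi z).
Proof.
move=> zU; rewrite (_ : L + 2 = L + 1 + 1); last by ring.
by apply: sector_cabs; [rewrite ltr_wpDl|exact: deriv_sector lip Hc _ zU].
Qed.

Lemma inv_deriv_cabs z : uhp z -> cabs (dPhi z)^-1 <= (L + 2) * complex.Re (dPhi z)^-1.
Proof.
move=> zU; rewrite (_ : L + 2 = L + 1 + 1); last by ring.
by apply: sector_cabs; [rewrite ltr_wpDl|exact: inv_deriv_sector lip Hc _ zU].
Qed.

Lemma cabs_le_ge0 (z : cplane R) : cabs z <= (L + 2) * complex.Re z -> 0 <= complex.Re z.
Proof.
move=> h; have := le_trans (cabs_ge0 z) h; rewrite pmulr_rge0//.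
by rewrite ltr_wpDl.
Qed.

Lemma holomorphic_dPhi : holomorphic_on (@uhp R) dPhi.
Proof. by apply: holomorphic_deriv (conformal_holo Hc); exact: copen_uhp. Qed.

Lemma holomorphic_dPhiV : holomorphic_on (@uhp R) (fun z => (dPhi z)^-1).
Proof.
move=> z zU; apply: cderivableV; first exact: (conformal_deriv_neq0 lip Hc).
exact: holomorphic_dPhi.
Qed.

Lemma ae_bdry : {ae mu, forall t, [/\ curve_derivable (bdry Phi) t,
  curve_deriv (bdry Phi) t != 0 & forall p, nontangential t p ->
    dPhi (p n) @[n --> \oo] --> (curve_deriv (bdry Phi) t : cplane R)]}.
Proof.
have [N [mN N0 sN]] := conformal_bdry_deriv Hc.
exists N; split => // t tN; apply: sN => /= -[d1 d2 H]; apply: tN; split=> // p [pU pt pc].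
(* A single cone is enough, because the sequence ends up in all of them; half of [tan (pi / 4)]
   makes the cone inequality strict. *)
have q0 : 0 < pi / 4 :> R by rewrite divr_gt0// pi_gt0.
have q1 : pi / 4 < pi / 2 :> R by have := pi_gt0 R; move: (pi : R) => P; lra.
apply: (cvg_comp _ _ _ (H (pi / 4) q0 q1)) => //.
move=> U; rewrite /within /= => UU.
have h0 : 0 < tan (pi / 4) / 2 :> R.
  by rewrite divr_gt0// tan_piquarter.
have := pc _ UU; have := pt _ h0; rewrite !near_simpl; apply: filterS2 => n h1 h2.
apply: h2; split; first exact: pU.
apply: le_lt_trans h1 _; rewrite ltr_pM2r; last exact: pU.
by move: h0; move: (tan _) => u; lra.
Qed.

Lemma cvg_conformal (T : Type) (F : set_system T) (g : T -> cplane R) z : Filter F ->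
  closed_uhp z -> (forall x, closed_uhp (g x)) -> g x @[x --> F] --> z ->
  Phi (g x) @[x --> F] --> Phi z.
Proof.
move=> FF zU gU gz; have := conformal_cont Hc => /subspace_continuousP/(_ z zU) H.
apply: (cvg_comp _ _ _ H) => U; rewrite /within /= => UU.
by have := gz _ UU; rewrite !near_simpl; apply: filterS => x; apply; exact: gU.
Qed.

Lemma closed_uhp_real (t : R) : closed_uhp (t%:C : cplane R).
Proof. by rewrite /closed_uhp /=. Qed.

Lemma continuous_bdry : continuous (bdry Phi).
Proof.
move=> t; apply: (@cvg_conformal R (nbhs t) (fun s => s%:C)); first exact: closed_uhp_real.
  by move=> s; exact: closed_uhp_real.
by apply: cvg_complex; [exact: cvg_id|exact: cvg_cst].
Qed.

Lemma continuous_ReB : continuous (fun t => X t).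
Proof. by move=> t; apply: ccont_Re; exact: continuous_bdry. Qed.

Lemma continuous_ImB : continuous (fun t => complex.Im (bdry Phi t)).
Proof. by move=> t; apply: ccont_Im; exact: continuous_bdry. Qed.

Lemma measurable_cabs_deriv (f : R -> cplane R) : continuous (fun t => complex.Re (f t)) ->
  continuous (fun t => complex.Im (f t)) ->
  measurable_fun [set: measurableTypeR R] (fun t => cabs (curve_deriv f t) : measurableTypeR R).
Proof.
move=> c1 c2; have m1 := measurable_derive1 c1; have m2 := measurable_derive1 c2.
under eq_fun do rewrite cabsE /=.
apply: measurableT_comp; first by apply: continuous_measurable_fun; exact: sqrt_continuous.
by apply: measurable_funD; apply: measurable_funX.
Qed.

Lemma measurable_D : measurable_fun [set: measurableTypeR R] (fun t => D t : measurableTypeR R).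
Proof. by apply: measurable_cabs_deriv; [exact: continuous_ReB|exact: continuous_ImB]. Qed.

Lemma measurable_Dpow (q : R) :
  measurable_fun [set: measurableTypeR R] (fun t => D t `^ q : measurableTypeR R).
Proof. apply: (measurableT_comp (measurable_powR _)); exact: measurable_D. Qed.

Lemma cvg_Re (F : set_system nat) (p : nat -> cplane R) (c : cplane R) : Filter F ->
  p n @[n --> F] --> c -> complex.Re (p n) @[n --> F] --> complex.Re c.
Proof. by move=> FF pc; apply: (cvg_comp _ _ pc); exact: continuous_Re. Qed.

Lemma cvg_cabs (F : set_system nat) (p : nat -> cplane R) (c : cplane R) : Filter F ->
  p n @[n --> F] --> c -> cabs (p n) @[n --> F] --> cabs c.
Proof. by move=> FF pc; apply: (cvg_comp _ _ pc); exact: continuous_cabs. Qed.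

Lemma cabs_le_cvg (p : nat -> cplane R) (c : cplane R) :
  (forall n, cabs (p n) <= (L + 2) * complex.Re (p n)) -> p n @[n --> \oo] --> c ->
  cabs c / (L + 2) <= complex.Re c.
Proof.
move=> H pc; rewrite ler_pdivrMr ?ltr_wpDl// mulrC.
apply: (@ler_cvg_to nat \oo _ R (fun n => cabs (p n)) (fun n => (L + 2) * complex.Re (p n))).
- exact: cvg_cabs.
- by apply: cvgMr; exact: cvg_Re.
- exact: nearW.
Qed.

Let T2 (T : R) : 0 < pi * (1 + T ^+ 2).
Proof. by rewrite mulr_gt0// ?pi_gt0// ltr_pwDl// sqr_ge0. Qed.

Lemma int_deriv_le (x y T : R) : 0 < y -> 0 < T ->
  (\int[mu]_(t in `[(x - T * y)%R, (x + T * y)%R]) (D t / (L + 2))%:E <=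
   (pi * (1 + T ^+ 2) * y * cabs (dPhi (x +i* y)))%:E)%E.
Proof.
move=> y0 TT0; apply: le_trans (_ : (pi * (1 + T ^+ 2) * y * complex.Re (dPhi (x +i* y)))%:E <= _)%E.
  apply: (@poisson_boundary R dPhi x y T (fun t => D t / (L + 2)) y0 TT0); first exact: holomorphic_dPhi.
  - by move=> z zU; apply: cabs_le_ge0; exact: deriv_cabs.
  - by apply: measurable_funTS; apply: measurable_funM => //; exact: measurable_D.
  - by move=> t; rewrite divr_ge0 ?cabs_ge0// addr_ge0.
  have [N [mN N0 sN]] := ae_bdry.
  exists N; split => // t tN; apply: sN => /= -[_ _ H]; apply: tN => p pt.
  exists (complex.Re (curve_deriv (bdry Phi) t)); first by apply: cvg_Re; exact: H.
  apply: (cabs_le_cvg _ (H _ pt)) => n; apply: deriv_cabs; by case: pt.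
rewrite lee_fin; apply: ler_wpM2l; first by rewrite ltW// mulr_gt0.
exact: le_trans (ler_norm _) (Re_le_cabs _).
Qed.

Lemma int_inv_deriv_le (x y T : R) : 0 < y -> 0 < T ->
  (\int[mu]_(t in `[(x - T * y)%R, (x + T * y)%R]) ((D t)^-1 / (L + 2))%:E <=
   (pi * (1 + T ^+ 2) * y * (cabs (dPhi (x +i* y)))^-1)%:E)%E.
Proof.
move=> y0 TT0; apply: le_trans (_ : (pi * (1 + T ^+ 2) * y * complex.Re (dPhi (x +i* y))^-1)%:E <= _)%E.
  apply: (@poisson_boundary R (fun z => (dPhi z)^-1) x y T (fun t => (D t)^-1 / (L + 2)) y0 TT0); first exact: holomorphic_dPhiV.
  - by move=> z zU; apply: cabs_le_ge0; exact: inv_deriv_cabs.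
  - apply: measurable_funTS; apply: measurable_funM => //.
    rewrite (_ : (fun t => (D t)^-1) = (fun t => D t `^ (-1))); last first.
      by apply/funext => t; rewrite powR_inv1// cabs_ge0.
    exact: measurable_Dpow.
  - by move=> t; rewrite divr_ge0 ?invr_ge0 ?cabs_ge0// addr_ge0.
  have [N [mN N0 sN]] := ae_bdry.
  exists N; split => // t tN; apply: sN => /= -[_ c0 H]; apply: tN => p pt.
  have cV : (dPhi (p n))^-1 @[n --> \oo] --> ((curve_deriv (bdry Phi) t)^-1 : cplane R).
    exact: (@cvgV R[i] nat \oo _ (fun n => dPhi (p n)) _ c0 (H _ pt)).
  exists (complex.Re (curve_deriv (bdry Phi) t)^-1); first by apply: cvg_Re; exact: cV.
  rewrite -cabsV; apply: (cabs_le_cvg _ cV) => n; apply: inv_deriv_cabs; by case: pt.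
rewrite lee_fin -cabsV; apply: ler_wpM2l; first by rewrite ltW// mulr_gt0.
exact: le_trans (ler_norm _) (Re_le_cabs _).
Qed.

Let lift (e : R) (t : R) : cplane R := t +i* e.

Lemma cvg_X_line (t : R) : complex.Re (Phi (lift n.+2%:R^-1 t)) @[n --> \oo] --> X t.
Proof.
apply: cvg_Re; apply: (@cvg_conformal nat \oo (fun n => lift n.+2%:R^-1 t)).
- exact: closed_uhp_real.
- by move=> n; rewrite /closed_uhp /= invr_ge0.
by apply: cvg_complex; [exact: cvg_cst|exact: cvg_inv_succ2].
Qed.

Lemma continuous_dPhi_line (e t : R) : 0 < e ->
  {for t, continuous (fun t => complex.Re (dPhi (lift e t)))}.
Proof.
move=> e0; apply: ccont_Re.
apply: (@continuous_comp _ _ _ (fun t => lift e t) dPhi).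
  by apply: (@ccont_complex R R id (fun=> e)); [exact: cvg_id|exact: cst_continuous].
by apply: derivable_ccont; exact: holomorphic_dPhi.
Qed.

Lemma rint_line (a b e : R) : a <= b -> 0 < e ->
  rint a b (fun t => complex.Re (dPhi (lift e t))) =
  complex.Re (Phi (lift e b)) - complex.Re (Phi (lift e a)).
Proof.
move=> ab e0; apply: (@rint_FTC R (fun t => complex.Re (Phi (lift e t)))) => // t _; last first.
  exact: continuous_dPhi_line.
have lE s : lift e s = (0 +i* e) + s%:C * 1.
  by apply: complex_eq; rewrite /= ?mulr1 ?mulr0 ?mul0r ?subr0 ?add0r ?addr0.
have -> : (fun t => complex.Re (Phi (lift e t))) = (fun t => complex.Re (Phi ((0 +i* e) + t%:C * 1))).
  by apply/funext => s; rewrite lE.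
have := @is_derive_line R Phi (0 +i* e) 1 (dPhi (lift e t)) t.
rewrite -lE mulr1; case => //.
by apply: DeriveDef => //; apply: (conformal_holo Hc).
Qed.

Lemma Re_dPhi_ge0 z : uhp z -> 0 <= complex.Re (dPhi z).
Proof. by move=> zU; apply: cabs_le_ge0; exact: deriv_cabs. Qed.

(** On the line at height [n.+2%:R^-1] the integral of [Re Phi'] is an increment of [Re Phi]. Let
    the height tend to 0 with Fatou's lemma, and compare [D] with the real part by the sector
    condition. Monotonicity of the abscissa and the lower bound on arc length both come from
    here. *)
Lemma int_deriv_X (a b : R) : a <= b ->
  (\int[mu]_(t in `[a, b]) (D t / (L + 2))%:E <= (X b - X a)%:E)%E.
Proof.
move=> ab; apply: (@fatou_rint R _ _ (fun n t => complex.Re (dPhi (lift n.+2%:R^-1 t)))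
  (fun n => complex.Re (Phi (lift n.+2%:R^-1 b)) - complex.Re (Phi (lift n.+2%:R^-1 a)))
  (X b - X a) (fun t => D t / (L + 2))).
- by move=> n t _; apply: continuous_dPhi_line; rewrite invr_gt0.
- by move=> n t _; apply: Re_dPhi_ge0; rewrite /uhp /= invr_gt0.
- by move=> n; rewrite rint_line ?invr_gt0.
- by apply: cvgB; exact: cvg_X_line.
- by apply: measurable_funTS; apply: measurable_funM => //; exact: measurable_D.
- by move=> t; rewrite divr_ge0 ?cabs_ge0// addr_ge0.
have [N [mN N0 sN]] := ae_bdry.
exists N; split => // t tN; apply: sN => /= -[_ _ H]; apply: tN => _.
have pt : nontangential t (fun n => lift n.+2%:R^-1 t).
  split=> [n|e e0|]; first by rewrite /uhp /= invr_gt0.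
    by apply: nearW => n /=; rewrite subrr normr0 mulr_ge0 ?invr_ge0// ltW.
  by apply: cvg_complex; [exact: cvg_cst|exact: cvg_inv_succ2].
exists (complex.Re (curve_deriv (bdry Phi) t)); first by apply: cvg_Re; exact: H.
apply: (cabs_le_cvg _ (H _ pt)) => n; apply: deriv_cabs; by case: pt.
Qed.
Lemma cvg_dPhi (F : set_system nat) (p : nat -> cplane R) (c : cplane R) : Filter F -> uhp c ->
  p n @[n --> F] --> c -> dPhi (p n) @[n --> F] --> dPhi c.
Proof.
move=> FF cU pc; have cd : {for c, continuous dPhi} := derivable_ccont (holomorphic_dPhi cU).
exact: (cvg_comp _ _ pc cd).
Qed.

(** The translate of [Phi'] by [0 +i* e] is continuous up to the real line, and its boundary values
    are those of [Phi'] at height [e]; [poisson_boundary] applies to it. *)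
Lemma rint_line_le (x y T e : R) : 0 < y -> 0 < T -> 0 < e ->
  rint (x - T * y) (x + T * y) (fun t => complex.Re (dPhi (lift e t))) <=
  pi * (1 + T ^+ 2) * y * complex.Re (dPhi (lift (y + e) x)).
Proof.
move=> y0 TT0 e0.
have ci t : x - T * y <= t <= x + T * y ->
  {for t, continuous (fun t => complex.Re (dPhi (lift e t)))}.
  by move=> _; exact: continuous_dPhi_line.
have := cont_integrable ci => ii.
have eU t : uhp (lift e t) by [].
have hU z : uhp z -> uhp (z + (0 +i* e)).
  by rewrite /uhp /= => z0; rewrite cImD addr_gt0.
have := @poisson_boundary R (fun z => dPhi (z + (0 +i* e))) x y T
  (fun t => complex.Re (dPhi (lift e t))) y0 TT0.
rewrite (_ : \int[mu]_(t in _) _ = (rint (x - T * y) (x + T * y) (fun t => complex.Re (dPhi (lift e t))))%:E)%E; last first.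
  by rewrite /rint /Rintegral fineK//; apply: integrable_fin_num.
rewrite lee_fin (_ : x +i* y + (0 +i* e) = lift (y + e) x); last first.
  by apply: complex_eq; rewrite /= ?addr0.
apply.
- move=> z zU; apply: (@cderivable_comp R dPhi (fun z => z + (0 +i* e))).
    by apply: (@cderivableD R id (fun=> 0 +i* e)); [exact: cderivable_id|exact: cderivable_cst].
  by apply: holomorphic_dPhi; exact: hU.
- by move=> z /hU; exact: Re_dPhi_ge0.
- by have /integrableP[/measurable_EFinP] := ii.
- by move=> t; exact: Re_dPhi_ge0.
apply: aeW => t p [_ _ pt]; exists (complex.Re (dPhi (lift e t))) => //.
have pe : p n + (0 +i* e) @[n --> \oo] --> lift e t.
  rewrite (_ : lift e t = t%:C + (0 +i* e)).
    exact: (@cvgD R[i] (cplane R) nat \oo _ p (fun=> 0 +i* e) _ _ pt (@cvg_cst _ _ nat \oo _)).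
  by apply: complex_eq; rewrite /= ?addr0 ?add0r.
exact: (@cvg_Re \oo (fun n => dPhi (p n + (0 +i* e))) _ _ (@cvg_dPhi \oo (fun n => p n + (0 +i* e)) _ _ (eU t) pe)).
Qed.

(** Fatou's lemma bounds the integral of the boundary derivative by the increment, which is the
    wrong direction here. At positive height the increment equals the integral, so the bound is
    proved there and only the endpoints and the point [x +i* (y + e)] pass to the limit. *)
Lemma X_increment_le (x y T : R) : 0 < y -> 0 < T ->
  X (x + T * y) - X (x - T * y) <= pi * (1 + T ^+ 2) * y * cabs (dPhi (x +i* y)).
Proof.
move=> y0 TT0; have Ty : 0 < T * y by rewrite mulr_gt0.
apply: (@le_trans _ _ (pi * (1 + T ^+ 2) * y * complex.Re (dPhi (x +i* y)))); last first.
  apply: ler_wpM2l; first by rewrite ltW// mulr_gt0.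
  exact: le_trans (ler_norm _) (Re_le_cabs _).
apply: (@ler_cvg_to nat \oo _ R
  (fun n => complex.Re (Phi (lift n.+2%:R^-1 (x + T * y))) - complex.Re (Phi (lift n.+2%:R^-1 (x - T * y))))
  (fun n => pi * (1 + T ^+ 2) * y * complex.Re (dPhi (lift (y + n.+2%:R^-1) x)))).
- by apply: cvgB; exact: cvg_X_line.
- have yc : y + n.+2%:R^-1 @[n --> \oo] --> y.
    have := @cvgD R R nat \oo _ (fun=> y) (fun n => n.+2%:R^-1) y 0 (@cvg_cst _ y nat \oo _) (@cvg_inv_succ2 R).
    by rewrite addr0; exact.
  have pc : lift (y + n.+2%:R^-1) x @[n --> \oo] --> (x +i* y : cplane R).
    by apply: cvg_complex; [exact: cvg_cst|exact: yc].
  apply: cvgMr; exact: (@cvg_Re \oo (fun n => dPhi (lift (y + n.+2%:R^-1) x)) _ _ (@cvg_dPhi \oo (fun n => lift (y + n.+2%:R^-1) x) (x +i* y) _ y0 pc)).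
apply: nearW => n; rewrite -rint_line ?invr_gt0//; last by move: (T * y) Ty => u u0; lra.
by apply: rint_line_le => //; rewrite invr_gt0.
Qed.

End conformal_boundary.

(** * Covering, layer cake and Muckenhoupt weights *)

Section vitali_covering_measure.
Context {R : realType}.
Variable mu : {measure set (measurableTypeR R) -> \bar R}.
Implicit Types (S : set (R * R)) (A : R * R -> set (measurableTypeR R)) (E : set (measurableTypeR R)).

Let le_mu (A B : set (measurableTypeR R)) : measurable A -> measurable B -> A `<=` B -> (mu A <= mu B)%E.
Proof. by move=> mA mB; apply: le_measure; rewrite inE. Qed.

Lemma measurable_bigcup_ball S : measurable (\bigcup_(z in S) ball z.1 z.2 : set (measurableTypeR R)).
Proof.
apply: open_measurable; apply: bigcup_open => z _; exact: (@ball_open R R).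
Qed.

(** Vitali's lemma selects disjoint closed balls whose fivefold enlargements cover the union. The
    sets [A z] of the selected balls are disjoint subsets of [E], so their measures add up to at
    most [mu E]. *)
Let vitali_bounded S A E (C r : R) :
  (forall z, S z -> 0 < z.2) -> (forall z, S z -> z.2 <= r) -> 0 <= C ->
  (forall z, S z -> measurable (A z)) -> (forall z, S z -> A z `<=` E) ->
  (forall z, S z -> A z `<=` closed_ball z.1 z.2) -> measurable E ->
  (forall z, S z -> mu `[(z.1 - 5 * z.2)%R, (z.1 + 5 * z.2)%R]%classic <= C%:E * mu (A z))%E ->
  (mu (\bigcup_(z in S) ball z.1 z.2) <= C%:E * mu E)%E.
Proof.
move=> S0 Sr C0 mA AE AB mE HS.
(* The covering lemma asks for a genuine ball at every index, hence the dummy radius 1 outside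
   [S]. *)
pose B (z : R * R) : set R := ball z.1 (if 0 < z.2 then z.2 else 1).
have B0 z : 0 < (if 0 < z.2 then z.2 else 1) :> R by case: ifP.
have BS z : S z -> B z = ball z.1 z.2 by move=> /S0 h; rewrite /B h.
have rB z : (radius (B z))%:num = if 0 < z.2 then z.2 else 1.
  by rewrite radius_ball_num// ltW.
have [||z Sz|D [cD DS tD SD]] := @vitali_lemma_infinite_cover R (R * R)%type B S r.
- by move=> z; exact: is_ball_ball.
- by move=> z; rewrite rB.
- by rewrite rB S0//; exact: Sr.
have /countable_injP[f finj] := cD.
(* The countable selection is enumerated through an injection [f] into [nat]; indices not attained
   carry the empty set. *)
pose P n := `[< exists z, D z /\ f z = n >].
pose e n := xget (0, 0) [set z | D z /\ f z = n].
have Pe n : P n -> D (e n) /\ f (e n) = n.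
  by move=> /asboolP[z hz]; rewrite /e; case: xgetP => [w -> //|/(_ z)].
pose I' n : set (measurableTypeR R) := if P n then `[(e n).1 - 5 * (e n).2, (e n).1 + 5 * (e n).2]%classic else set0.
pose A' n : set (measurableTypeR R) := if P n then A (e n) else set0.
have mI n : measurable (I' n) by rewrite /I'; case: ifP.
have mA' n : measurable (A' n).
  by rewrite /A'; case: ifP => // /Pe[De _]; apply: mA; exact: DS.
have tA : trivIset setT A'.
  apply/trivIsetP => i j _ _ ij; rewrite /A'; case: ifP => [/Pe[Di fi]|]; last by rewrite set0I.
  case: ifP => [/Pe[Dj fj]|]; last by rewrite setI0.
  apply/seteqP; split=> // t [ti tj].
  have ne : e i != e j by apply: contra ij => /eqP eij; rewrite -fi -fj eij.
  have := tD _ _ Di Dj; rewrite /= => H; case/eqP: ne; apply: H; exists t; split.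
    by rewrite BS ?closure_ballE; [apply: AB => //|]; exact: DS.
  by rewrite BS ?closure_ballE; [apply: AB => //|]; exact: DS.
have UI : \bigcup_(z in S) ball z.1 z.2 `<=` \bigcup_n I' n.
  move=> t [z Sz zt]; have [|w Dw /= wt] := SD t.
    by exists z => //=; rewrite BS//; exact: subset_closure.
  have w0 := S0 _ (DS _ Dw).
  have Pw : P (f w) by apply/asboolP; exists w.
  exists (f w) => //; rewrite /I' Pw.
  have -> : e (f w) = w by have [De fe] := Pe _ Pw; apply: finj; rewrite ?inE.
  move: wt; rewrite BS; last exact: DS.
  by rewrite scale_ballE// closure_ballE closed_ball_itv// mulr_gt0.
have := @measure_sigma_subadditive _ _ _ mu _ _ mI (measurable_bigcup_ball S) UI; move=> /le_trans; apply.
have HI n : (mu (I' n) <= C%:E * mu (A' n))%E.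
  rewrite /I' /A'; case: ifP => [/Pe[De _]|_]; first by apply: HS; exact: DS.
  by rewrite measure0 mule0.
apply: le_trans (lee_nneseries _ (fun n _ => HI n)) _ => //.
rewrite nneseriesZl//; apply: lee_wpmul2l; first by rewrite lee_fin.
rewrite -measure_semi_bigcup//; last exact: bigcupT_measurable.
apply: le_mu => //; first exact: bigcupT_measurable.
by move=> t [n _]; rewrite /A'; case: ifP => // /Pe[De _]; apply: AE; exact: DS.
Qed.

(** The radii of the shadows are unbounded, whereas Vitali's lemma needs a bound. Restrict to radii
    at most [n] and use continuity from below. *)
Lemma vitali_weak S A E (C : R) :
  (forall z, S z -> 0 < z.2) -> 0 <= C ->
  (forall z, S z -> measurable (A z)) -> (forall z, S z -> A z `<=` E) ->
  (forall z, S z -> A z `<=` closed_ball z.1 z.2) -> measurable E ->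
  (forall z, S z -> mu `[(z.1 - 5 * z.2)%R, (z.1 + 5 * z.2)%R]%classic <= C%:E * mu (A z))%E ->
  (mu (\bigcup_(z in S) ball z.1 z.2) <= C%:E * mu E)%E.
Proof.
move=> S0 C0 mA AE AB mE HS.
pose U n : set (measurableTypeR R) := \bigcup_(z in [set z | S z /\ z.2 <= n%:R]) ball z.1 z.2.
have UE : \bigcup_(z in S) ball z.1 z.2 = \bigcup_n U n.
  apply/seteqP; split=> t; last by move=> [n _ [z [Sz _] zt]]; exists z.
  move=> [z Sz zt]; have [n zn] : exists n, z.2 <= n%:R.
    by exists (Num.truncn z.2).+1; rewrite ltW// truncnS_gt.
  by exists n => //; exists z.
have : mu (U n) @[n --> \oo] --> mu (\bigcup_n U n).
  apply: nondecreasing_cvg_mu => //.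
  - by move=> n; exact: measurable_bigcup_ball.
  - by rewrite -UE; exact: measurable_bigcup_ball.
  by move=> m n mn; apply/subsetPset => t [z [Sz zm] zt]; exists z => //; split=> //; apply: le_trans zm _; rewrite ler_nat.
rewrite UE => cU; rewrite -(cvg_lim _ cU)//; apply: lime_le; first by apply/cvg_ex; eexists; exact: cU.
apply: nearW => n; apply: (@vitali_bounded _ A E C n%:R) => //.
- by move=> z [/S0].
- by move=> z [].
- by move=> z [Sz _]; exact: mA.
- by move=> z [Sz _]; exact: AE.
- by move=> z [Sz _]; exact: AB.
- by move=> z [Sz _]; exact: HS.
Qed.

End vitali_covering_measure.

(** * A layer-cake inequality through Riemann sums *)

Section layer_cake.
Context d (T : measurableType d) {R : realType}.
Variable mu : {measure set T -> \bar R}.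
Implicit Types f h : T -> \bar R.

(** Counts the integers from 1 to [M] that lie below [w]; up to scaling, this is [step] at a point
    where [f] is finite. *)
Let cnt (M : nat) (w : R) : R := \sum_(k < M) (if k.+1%:R < w then 1 else 0).

Let cnt_le M w : 0 <= w -> cnt M w <= w /\ cnt M w <= M%:R.
Proof.
move=> w0; rewrite /cnt; elim: M => [|M [IH1 IH2]]; first by rewrite big_ord0.
rewrite big_ord_recr /=; have [h|h] := ltP M.+1%:R w; last first.
  by rewrite addr0; split=> //; apply: le_trans IH2 _; rewrite ler_nat.
have h2 : \sum_(i < M) (if i.+1%:R < w then 1 else 0) + 1 <= M.+1%:R :> R by rewrite -natr1 lerD2r.
by split=> //; apply: le_trans (ltW h).
Qed.

Let cnt_ge M w : Num.min M%:R (w - 1) <= cnt M w.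
Proof.
rewrite /cnt; elim: M => [|M IH]; first by rewrite big_ord0 ge_min lexx.
rewrite big_ord_recr /=; have [h|h] := ltP M.+1%:R w.
  move: IH; rewrite minEle ifT; last by rewrite lerBrDr natr1 ltW.
  by move=> IH; rewrite ge_min -natr1 lerD2r IH.
have h3 : w - 1 <= M%:R by rewrite lerBlDr natr1.
by move: IH; rewrite addr0 (min_r h3) ge_min => ->; rewrite orbT.
Qed.

Let N (n : nat) : R := n.+1%:R.

Let lev (f : T -> \bar R) (c : R) := [set x | (c%:E < f x)%E].

(** A Riemann sum, of mesh [1 / n.+1] and with levels up to [n.+1], for the integral over [l] of the
    indicator of [f > l]. *)
Let step (f : T -> \bar R) n (x : T) : \bar R :=
  (\sum_(k < (n.+1 * n.+1)%N) ((N n)^-1)%R%:E * (\1_(lev f (k.+1%:R / N n)%R) x)%:E)%E.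

Let N0 n : 0 < N n. Proof. by rewrite ltr0n. Qed.

Let step_fin f n x (v : R) : f x = v%:E ->
  step f n x = (cnt (n.+1 * n.+1)%N (v * N n) / N n)%:E.
Proof.
move=> fx; rewrite /step /cnt mulrC mulr_sumr -sumEFin; apply: eq_bigr => k _.
rewrite -EFinM; congr (_ * _)%:E; rewrite indicE.
have -> : (x \in lev f (k.+1%:R / N n)) = (k.+1%:R < v * N n).
  by apply/idP/idP; rewrite inE /lev /= fx lte_fin ltr_pdivrMr.
by case: ifP.
Qed.

Let step_infty f n x : f x = +oo%E -> step f n x = (N n)%:E.
Proof.
move=> fx; rewrite /step (eq_bigr (fun=> ((N n)^-1)%:E)); last first.
  by move=> k _; rewrite indicE mem_set ?mule1//= /lev /= fx ltry.
rewrite sumEFin big_const_ord iter_addr_0 -mulr_natr natrM mulrA mulVf ?mul1r//.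
by rewrite gt_eqF.
Qed.

Let step_le f n x : (0 <= f x)%E -> (step f n x <= f x)%E.
Proof.
case fx: (f x) => [v| |] // v0; last by rewrite leey.
rewrite (@step_fin _ _ _ v)// lee_fin ler_pdivrMr//.
by apply: (cnt_le _ _).1; rewrite mulr_ge0// ltW.
Qed.

Let step_cvg f x : (0 <= f x)%E -> (step f n x) @[n --> \oo] --> f x.
Proof.
case fx: (f x) => [v| |] // v0; last first.
  under eq_fun do rewrite step_infty//; apply/cvgeryP.
  have := @cvgr_idn R; rewrite -(cvg_shiftS (fun n => n%:R : R)); exact.
under eq_fun do rewrite (@step_fin _ _ _ v)//.
apply: cvg_EFin; first exact: nearW.
apply: (@squeeze_cvgr _ \oo _ R (fun n => v - (N n)^-1) (fun=> v)).
- have [m vm] : exists m, v <= m%:R.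
    by exists (Num.truncn v).+1; rewrite ltW// truncnS_gt.
  exists m => // n /= mn; apply/andP; split; last first.
    by rewrite /= ler_pdivrMr//; apply: (cnt_le _ _).1; rewrite mulr_ge0// ltW.
  rewrite ler_pdivlMr// mulrBl mulVf ?gt_eqF//.
  have := cnt_ge (n.+1 * n.+1) (v * N n); rewrite min_r//.
  rewrite lerBlDr natrM; apply: (@le_trans _ _ (n.+1%:R * n.+1%:R)); last by rewrite lerDl.
  rewrite ler_pM2r//; apply: le_trans vm _; rewrite ler_nat; exact: leq_trans mn _.
- have := @cvgB R R nat \oo _ (fun=> v) (@harmonic R) v 0 (@cvg_cst _ v nat \oo _) (@cvg_harmonic R).
  by rewrite subr0; exact.
- exact: cvg_cst.
Qed.

Let measurable_lev f (c : R) : measurable_fun setT f -> measurable (lev f c).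
Proof.
move=> mf; rewrite -[X in measurable X]setTI.
exact: (emeasurable_fun_o_infty measurableT mf).
Qed.

Let measurable_step f n : measurable_fun setT f -> measurable_fun setT (step f n).
Proof.
move=> mf; apply: emeasurable_sum => k; apply: measurable_funeM.
by apply/measurable_EFinP; apply: measurable_indic; exact: measurable_lev.
Qed.

Let step_ge0 f n x : (0 <= step f n x)%E.
Proof.
apply: sume_ge0 => k _; rewrite -EFinM lee_fin mulr_ge0 ?invr_ge0 ?ler0n//.
Qed.

Let int_step f n : measurable_fun setT f -> (\int[mu]_x step f n x =
  \sum_(k < (n.+1 * n.+1)%N) ((N n)^-1)%R%:E * mu (lev f (k.+1%:R / N n)%R))%E.
Proof.
move=> mf; rewrite ge0_integral_sum//=.
- apply: eq_bigr => k _; rewrite ge0_integralZl_EFin//.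
  + by rewrite integral_indic// ?setIT//; exact: measurable_lev.
  + by apply/measurable_EFinP; apply: measurable_indic; exact: measurable_lev.
  + by rewrite invr_ge0.
- move=> k; apply: measurable_funeM.
  by apply/measurable_EFinP; apply: measurable_indic; exact: measurable_lev.
- by move=> k x _; rewrite -EFinM lee_fin mulr_ge0 ?invr_ge0 ?ler0n.
Qed.

(** The sums [step] lie below the function and converge to it. Fatou's lemma treats [f], the bound
    [step h n <= h] treats [h], and in between finitely many level sets are compared. Nothing here
    needs [mu] to be sigma-finite, unlike Tonelli's theorem. *)
Lemma layer_cake_le f h (C : R) : 0 <= C ->
  measurable_fun setT f -> measurable_fun setT h ->
  (forall x, 0 <= f x)%E -> (forall x, 0 <= h x)%E ->
  (forall l : R, 0 < l -> (mu [set x | (l%:E < f x)%E] <= C%:E * mu [set x | (l%:E < h x)%E])%E) ->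
  (\int[mu]_x f x <= C%:E * \int[mu]_x h x)%E.
Proof.
move=> C0 mf mh f0 h0 H.
have -> : (\int[mu]_x f x = \int[mu]_x limn_einf (fun n => step f n x))%E.
  apply: eq_integral => x _; have := step_cvg (f0 x) => cx.
  by rewrite is_cvg_limn_einfE ?(cvg_lim _ cx)//; apply/cvg_ex; eexists; exact: cx.
apply: le_trans (fatou _ _ _ _) _ => //; first by move=> n; exact: measurable_step.
apply: (@limn_einf_le R _ (fun=> (C%:E * \int[mu]_x h x)%E)); last exact: cvg_cst.
move=> n; apply: (@le_trans _ _ (C%:E * \int[mu]_x step h n x)%E).
  rewrite !int_step// ge0_sume_distrr; last by move=> k _; rewrite mule_ge0// lee_fin invr_ge0.
  apply: lee_sum => k _; rewrite muleCA; apply: lee_wpmul2l; first by rewrite lee_fin invr_ge0.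
  by apply: H; rewrite divr_gt0.
apply: lee_wpmul2l => //; apply: ge0_le_integral => //; first exact: measurable_step.
by move=> x _; exact: step_le.
Qed.

End layer_cake.

(** * Muckenhoupt weights on large subsets of intervals *)

Section muckenhoupt_comparison.
Context {R : realType}.

(* The hypothesis on [l] comes from integrating the pointwise bound
   1 <= l w + (l w)^(-1/s); optimizing [l] replaces Hoelder's inequality. *)
Lemma Ar_real_comparison (s e b a' a S c K : R) : 0 < s -> 0 < c -> 0 < S -> c * S <= e ->
  0 <= b -> 0 <= a' -> 0 < a ->
  (forall l, 0 < l -> e <= l * b + l `^ (- s^-1) * a') ->
  S^-1 * a * (S^-1 * a') `^ s <= K -> a <= K * (2 / c) * (2 / c) `^ s * b.
Proof.
move=> s0 c0 S0 cSe b0 a'0 a0 H HK.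
have e0 : 0 < e by apply: lt_le_trans cSe; rewrite mulr_gt0.
have a'1 : 0 < a'.
  rewrite lt_neqAle a'0 andbT eq_sym; apply/eqP => a'E.
  have l0 : 0 < e / (2 * (b + 1)) by rewrite divr_gt0// mulr_gt0// ltr_wpDl.
  have := H _ l0; rewrite a'E mulr0 addr0 leNgt => /negP; apply.
  rewrite mulrAC ltr_pdivrMr ?mulr_gt0 ?ltr_wpDl// ltr_pM2l//; lra.
(* This value makes the second term of the bound exactly [e / 2], leaving [e / 2 <= l * b]. *)
pose l := (2 * a' / e) `^ s.
have q0 : 0 < 2 * a' / e by rewrite divr_gt0// mulr_gt0.
have l0 : 0 < l by rewrite powR_gt0.
have lV : l `^ (- s^-1) = e / (2 * a').
  by rewrite /l -powRrM mulrN divff ?gt_eqF// powR_inv1 ?invf_div// ltW.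
have := H _ l0; rewrite lV.
have -> : e / (2 * a') * a' = e / 2 by field; rewrite gt_eqF.
move=> h1; have h2 : e / 2 <= l * b by move: h1; move: (l * b) => lb; lra.
set q := (S^-1 * a') `^ s in HK.
have qq : 0 < q by rewrite powR_gt0// mulr_gt0// invr_gt0.
have lq : l <= (2 / c) `^ s * q.
  rewrite /q -powRM; [|by rewrite divr_ge0 ?ltW|by rewrite mulr_ge0 ?invr_ge0 ?ltW].
  apply: ge0_ler_powR; rewrite ?nnegrE; [exact: ltW|exact: ltW|by rewrite ltW// !mulr_gt0 ?invr_gt0|].
  have -> : 2 / c * (S^-1 * a') = 2 * a' / (c * S) by field; rewrite !gt_eqF.
  by rewrite ler_pM2l ?mulr_gt0// lef_pV2 ?posrE// mulr_gt0.
have K0 : 0 <= K by apply: le_trans HK; rewrite !mulr_ge0 ?invr_ge0 ?ltW.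
have aq : a * q <= K * S.
  by move: HK; rewrite -mulrA ler_pdivrMl// mulrC [K * _]mulrC.
rewrite -(ler_pM2r qq); apply: le_trans aq _.
have Sb : S <= 2 / c * (l * b).
  rewrite mulrAC ler_pdivlMr// mulrC; apply: le_trans cSe _.
  by move: h2; move: (l * b) => lb; lra.
have -> : K * (2 / c) * (2 / c) `^ s * b * q = K * (2 / c * ((2 / c) `^ s * q * b)) by ring.
rewrite ler_wpM2l//; apply: le_trans Sb _.
rewrite ler_wpM2l//; first by rewrite divr_ge0// ltW.
by rewrite ler_wpM2r.
Qed.

Context d (T : measurableType d).
Variable sigma : {measure set T -> \bar R}.
Variable intervals : set (set T).

(** The only property of A_infty that is used: a subset with a fixed fraction of the reference
    measure of an interval has a fixed fraction of its weight. [C] depends on [w] and [c] but not on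
    the interval. *)
Lemma muckenhoupt_comparison (r : R) (w : T -> R) (c : R) : 1 < r ->
  muckenhoupt sigma intervals r w -> 0 < c ->
  exists2 C : R, 0 <= C & forall J E, intervals J -> measurable J -> (0 < sigma J < +oo)%E ->
    measurable E -> E `<=` J -> (c%:E * sigma J <= sigma E)%E ->
    (\int[sigma]_(x in J) (w x)%:E <= C%:E * \int[sigma]_(x in E) (w x)%:E)%E.
Proof.
move=> r1 [[mw w0 wn0 wfin] [K HK]] c0; have s0 : 0 < r - 1 by rewrite subr_gt0.
exists (Num.max 0 (K * (2 / c) * (2 / c) `^ (r - 1))); first by rewrite le_max lexx.
move=> J E iJ mJ /andP[sJ0 sJy] mE EJ cE.
set a := (\int[sigma]_(x in J) _)%E; set b := (\int[sigma]_(x in E) _)%E.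
pose w' x := w x `^ (- (r - 1)^-1).
pose a' := (\int[sigma]_(x in J) (w' x)%:E)%E.
have mw' : measurable_fun [set: T] w' by apply: (measurableT_comp (measurable_powR _)).
have mE1 D f : measurable_fun [set: T] f -> measurable_fun D (EFin \o f).
  by move=> mf; apply: measurable_funTS; apply/measurable_EFinP.
have a0 : (0 <= a)%E by apply: integral_ge0 => x _; rewrite lee_fin.
have b0 : (0 <= b)%E by apply: integral_ge0 => x _; rewrite lee_fin.
have a'0 : (0 <= a')%E by apply: integral_ge0 => x _; rewrite lee_fin powR_ge0.
have [->|az] := eqVneq a 0%E.
  by rewrite mule_ge0// lee_fin le_max lexx.
have ba : (b <= a)%E by apply: ge0_subset_integral => //; [exact: mE1|move=> x _; rewrite lee_fin].
have aF : a \is a fin_num by rewrite ge0_fin_numE//; exact: wfin.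
have bF : b \is a fin_num by rewrite ge0_fin_numE//; apply: le_lt_trans ba _; rewrite -ge0_fin_numE.
have SF : sigma J \is a fin_num by rewrite ge0_fin_numE.
have sEJ : (sigma E <= sigma J)%E by apply: le_measure; rewrite ?inE.
have EF : sigma E \is a fin_num by rewrite ge0_fin_numE//; apply: le_lt_trans sEJ _.
have apos : 0 < fine a by rewrite fine_gt0// lt_neqAle eq_sym az a0 -ge0_fin_numE.
have Spos : 0 < fine (sigma J) by rewrite fine_gt0// sJ0.
have HJ := HK _ iJ; rewrite /average -/a -/a' in HJ.
have SV : ((sigma J)^-1 = ((fine (sigma J))^-1)%:E)%E.
  by rewrite -{1}(fineK SF) inver gt_eqF.
rewrite SV -(fineK aF) in HJ.
(* An infinite dual integral would make the Muckenhoupt product infinite, the average of [w] being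
   positive. *)
have a'F : a' \is a fin_num.
  rewrite ge0_fin_numE// ltey; apply/eqP => a'y.
  move: HJ; rewrite a'y gt0_muley ?lte_fin ?invr_gt0// poweRyr ?gt_eqF//.
  by rewrite gt0_muley ?lee_fin// -EFinM lte_fin mulr_gt0 ?invr_gt0.
rewrite -(fineK a'F) -!EFinM lee_fin /= in HJ.
have HL l : 0 < l -> fine (sigma E) <= l * fine b + l `^ (- (r - 1)^-1) * fine a'.
  move=> l0; rewrite -lee_fin EFinD !EFinM !fineK//.
  have -> : sigma E = (\int[sigma]_(x in E) 1)%E by rewrite integral_cst// mul1e.
  apply: (@le_trans _ _ (\int[sigma]_(x in E) (l%:E * (w x)%:E + (l `^ (- (r - 1)^-1))%:E * (w' x)%:E))%E).
    apply: ae_ge0_le_integral => //.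
    - by move=> x _; rewrite -!EFinM -EFinD lee_fin addr_ge0// mulr_ge0 ?powR_ge0// ltW.
    - by apply: emeasurable_funD; apply: measurable_funeM; exact: mE1.
    (* Where [w] vanishes, [powR] with a negative exponent is 0 and the pointwise bound fails; this
       set is null by [is_weight]. Elsewhere one of the two terms is at least 1. *)
    exists [set x | w x = 0]; split => //.
      by rewrite -[X in measurable X]setTI; exact: (mw measurableT [set 0] (measurable_set1 0)).
    move=> x /=; apply: contra_notP => /eqP wx _.
    have wp : 0 < w x by rewrite lt_neqAle eq_sym wx w0.
    rewrite -!EFinM -EFinD lee_fin /w' -powRM//; last exact: ltW.
    have lw : 0 < l * w x by rewrite mulr_gt0.
    have [h|h] := leP 1 (l * w x); first by rewrite ler_wpDr// powR_ge0.
    apply: ler_wpDl; first exact: ltW.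
    rewrite powRN -[leLHS]invr1 lef_pV2 ?posrE ?powR_gt0//.
    have e1 : 1 `^ (r - 1)^-1 = 1 :> R by rewrite powR1.
    apply: le_trans (_ : 1 `^ (r - 1)^-1 <= _); last by rewrite e1.
    by apply: ge0_ler_powR; rewrite ?nnegrE ?invr_ge0//; exact: ltW.
  rewrite ge0_integralD//; last 4 first.
  - by move=> x _; rewrite -EFinM lee_fin mulr_ge0// ltW.
  - by apply: measurable_funeM; exact: mE1.
  - by move=> x _; rewrite -EFinM lee_fin mulr_ge0 ?powR_ge0.
  - by apply: measurable_funeM; exact: mE1.
  rewrite [X in (X + _)%E]ge0_integralZl_EFin//; [|by move=> x _; rewrite lee_fin|exact: mE1|exact: ltW].
  rewrite ge0_integralZl_EFin//; [|by move=> x _; rewrite lee_fin /w' powR_ge0|exact: mE1|exact: powR_ge0].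
  rewrite leeD2l// lee_wpmul2l ?lee_fin ?powR_ge0//.
  by apply: ge0_subset_integral => //; [exact: mE1|move=> x _; rewrite lee_fin powR_ge0].
have := @Ar_real_comparison (r - 1) (fine (sigma E)) (fine b) (fine a') (fine a) (fine (sigma J)) c K s0 c0 Spos.
move=> /(_ _ _ _ apos HL HJ) H.
rewrite -(fineK aF) -(fineK bF) -EFinM lee_fin.
apply: (le_trans (H _ _ _)); rewrite ?fine_ge0//.
  by rewrite -lee_fin EFinM !fineK.
by rewrite ler_wpM2r ?fine_ge0// le_max lexx orbT.
Qed.
End muckenhoupt_comparison.

(** * Parametrization of the graph by the boundary *)

(** The measures of the statement are bare set functions. An equality of functions with a packed
    measure lets the integration lemmas be used after rewriting. *)
Lemma exists_measure d (T : measurableType d) (R : realType) (m : set T -> \bar R) :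
  m set0 = 0%E -> (forall E, (0 <= m E)%E) -> semi_sigma_additive m ->
  exists m' : {measure set T -> \bar R}, (m' : set T -> \bar R) = m.
Proof.
move=> m0 mge madd.
pose m' : {measure set T -> \bar R} := HB.pack m (isMeasure.Build d T R m m0 mge madd).
by exists m'.
Qed.

Lemma exists_density d d' (T : measurableType d) (T' : measurableType d') (R : realType)
    (mu : {measure set T -> \bar R}) (h : T -> T') (f : T -> \bar R) :
  measurable_fun setT h -> measurable_fun setT f -> (forall x, 0 <= f x)%E ->
  exists m : {measure set T' -> \bar R},
    (m : set T' -> \bar R) = (fun E => \int[mu]_(x in h @^-1` E) f x)%E.
Proof.
move=> mh mf f0; apply: exists_measure.
- by rewrite preimage_set0 integral_set0.
- by move=> E; apply: integral_ge0.
move=> F mF tF mUF; rewrite preimage_bigcup.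
have mhF i : measurable (h @^-1` F i) by rewrite -[_ @^-1` _]setTI; exact: mh.
rewrite ge0_integral_bigcup//; last 2 first.
- by apply: measurable_funTS.
- by apply/trivIsetP => i j _ _ ij; rewrite -preimage_setI; move/trivIsetP: tF => -> //; rewrite preimage_set0.
by apply: is_cvg_nneseries => n _ _; exact: integral_ge0.
Qed.

Lemma exists_image_measure d d' (T : measurableType d) (T' : measurableType d') (R : realType)
    (nu : {measure set T' -> \bar R}) (h : T -> T') : injective h ->
  (forall E, measurable E -> measurable (h @` E)) ->
  exists m : {measure set T -> \bar R}, (m : set T -> \bar R) = (fun E => nu (h @` E)).
Proof.
move=> hi mh; apply: exists_measure; first by rewrite image_set0 measure0.
  by move=> E; exact: measure_ge0.
move=> F mF tF mUF; rewrite image_bigcup.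
apply: measure_semi_sigma_additive.
- by move=> i; exact: mh.
- apply/trivIsetP => i j _ _ ij; apply/seteqP; split=> // _ [[x Fx <-] [y Fy /hi yx]].
  have Fij : F i `&` F j = set0 by move/trivIsetP: tF; exact.
  have : (F i `&` F j) x; last by rewrite Fij.
  split => //; by rewrite -yx.
- by rewrite -image_bigcup; exact: mh.
Qed.
(** Lebesgue measure is an infimum over countable covers by half-open intervals, so the comparison
    extends from these by subadditivity of [m]. *)
Lemma le_lebesgue_measure (R : realType) (m : {measure set (measurableTypeR R) -> \bar R}) :
  (forall a b : R, a < b -> (m `]a, b]%classic <= (b - a)%:E)%E) ->
  forall B, measurable B -> (m B <= @lebesgue_measure R B)%E.
Proof.
move=> H B mB; rewrite /lebesgue_measure /lebesgue_stieltjes_measure /measure_extension /=.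
apply: le_ereal_inf_tmp => _ [A [mA BA] <-].
have mA' n : measurable (A n : set (measurableTypeR R)) by apply: sub_sigma_algebra; exact: mA.
apply: le_trans (@measure_sigma_subadditive _ _ _ m B A mA' mB BA) _.
apply: lee_nneseries => // n _; have [[a b] _ <-] := mA n.
have [ab|ba] := ltP a b; last by rewrite set_itv_ge ?measure0 ?wlength0// bnd_simp -leNgt.
by rewrite (wlength_itv_bnd idfun _ _ (ltW ab)); exact: H.
Qed.

Lemma continuous_borelC (R : realType) (f : cplane R -> R) : continuous f ->
  measurable_fun [set: borelC R] (f : borelC R -> measurableTypeR R).
Proof.
move=> cf; apply: (measurability _ (RGenOInfty.measurableE R)).
move=> _ [_ [a ->] <-]; rewrite setTI; apply: sub_sigma_algebra.
move/continuousP: cf; apply; exact: interval_open.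
Qed.

Section boundary_parametrization.
Context {R : realType} (gamma : R -> R) (L x0 : R) (Phi : cplane R -> cplane R).
Hypotheses (lip : L.-lipschitz gamma) (Hc : conformal_map gamma Phi x0).
Notation mu := (@lebesgue_measure R).
Notation X t := (complex.Re (bdry Phi t)).

Lemma continuous_lipschitz : continuous gamma.
Proof.
move=> x; apply/cvgrPdist_lt => e e0; have L0 := lipschitz_ge0 lip.
apply/nbhs_ballP; exists (e / (L + 1)); first by rewrite /= divr_gt0// ltr_wpDl.
move=> y; rewrite /ball /= => xy; apply: le_lt_trans (lipschitzE lip x y) _.
apply: le_lt_trans (_ : (L + 1) * `|x - y| < e); first by rewrite ler_wpM2r// lerDl.
by rewrite mulrC -ltr_pdivlMr// ltr_wpDl.
Qed.

Lemma continuous_height : continuous (fun z : cplane R => complex.Im z - gamma (complex.Re z)).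
Proof.
move=> w; apply: (@continuousB R R _ (fun z : cplane R => complex.Im z) (fun z => gamma (complex.Re z))).
  exact: continuous_Im.
by apply: (@continuous_comp _ _ _ (fun z : cplane R => complex.Re z) gamma); [exact: continuous_Re|exact: continuous_lipschitz].
Qed.

Lemma closure_Omega z : closure (Omega gamma) z -> gamma (complex.Re z) <= complex.Im z.
Proof.
have cl : closed [set z : cplane R | 0 <= complex.Im z - gamma (complex.Re z)].
  apply: (@preimage_closed _ _ (fun z : cplane R => complex.Im z - gamma (complex.Re z)) [set y | 0 <= y]).
    by move=> w _; exact: continuous_height.
  exact: closed_ge.
rewrite -subr_ge0 => /closure_subset; move/(_ [set z : cplane R | 0 <= complex.Im z - gamma (complex.Re z)]).
rewrite -(closure_id _).1//; apply => w /= h; rewrite subr_ge0; exact: ltW.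
Qed.

Lemma eta_closure u : closure (Omega gamma) (eta gamma u).
Proof.
move=> A /nbhs_cplaneP[e e0 eA]; exists (u +i* (gamma u + e / 2)); split.
  by rewrite /Omega /= ltrDl divr_gt0.
apply: eA; have -> : u +i* (gamma u + e / 2) - eta gamma u = 0 +i* (e / 2).
  by apply: complex_eq; rewrite /= ?subrr// addrAC subrr add0r.
rewrite cabsE /= expr0n add0r sqrtr_sqr gtr0_norm ?divr_gt0//; lra.
Qed.

(** A boundary value lies in the closure of the domain. Strictly above the graph it would also be
    the image of a point of the open half-plane, against injectivity on the closed one. *)
Lemma bdry_eta t : bdry Phi t = eta gamma (X t).
Proof.
have [H1 H2 H3] := conformal_closure_bij Hc; have [K1 K2 K3] := conformal_bij Hc.
have tU := @closed_uhp_real R t.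
have := closure_Omega (H1 _ tU); rewrite le_eqVlt => /predU1P[e|].
  by apply: complex_eq => //=; rewrite e.
move=> /K3[w wU wt]; have := H2 w (t%:C); rewrite !inE => /(_ (sub_closed_uhp wU) tU wt) wE.
by move: wU; rewrite wE /uhp /= ltxx.
Qed.

Let Psi : cplane R -> cplane R := projT1 (cid2 (conformal_inv_cont Hc)).

Let PsiK z : closed_uhp z -> Psi (Phi z) = z.
Proof. by rewrite /Psi; case: cid2 => /= P PK cP; exact: PK. Qed.

Let cPsi : {within closure (Omega gamma), continuous Psi}.
Proof. by rewrite /Psi; case: cid2. Qed.

(** The inverse of [t |-> X t]: go up to the graph point over [u], then back by the inverse of
    [Phi]. *)
Definition bdry_inv (u : R) : R := complex.Re (Psi (eta gamma u)).

Lemma bdryK t : bdry_inv (X t) = t.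
Proof. by rewrite /bdry_inv -bdry_eta /bdry PsiK//; exact: closed_uhp_real. Qed.

Lemma bdry_invK u : X (bdry_inv u) = u.
Proof.
have [H1 H2 H3] := conformal_closure_bij Hc; have [z zU zE] := H3 _ (@eta_closure u).
have z0 : complex.Im z = 0.
  apply/eqP; rewrite eq_le zU andbT leNgt; apply/negP => z0.
  have [K1 _ _] := conformal_bij Hc; have := K1 _ z0.
  by rewrite zE /Omega /= ltxx.
have zr : z = (complex.Re z)%:C by apply: complex_eq.
by rewrite /bdry_inv -zE PsiK// /bdry -zr zE.
Qed.

Lemma continuous_bdry_inv : continuous bdry_inv.
Proof.
move=> u; have := cPsi => /subspace_continuousP/(_ _ (@eta_closure u)) H.
have ce : eta gamma s @[s --> u] --> eta gamma u.
  by apply: cvg_complex; [exact: cvg_id|exact: continuous_lipschitz].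
have cP : Psi (eta gamma s) @[s --> u] --> Psi (eta gamma u).
  apply: (cvg_comp _ _ _ H) => U; rewrite /within /= => UU.
  by have := ce _ UU; rewrite !near_simpl; apply: filterS => s; apply; exact: eta_closure.
exact: (ccont_Re cP).
Qed.

Lemma X_le a b : a <= b -> X a <= X b.
Proof.
move=> ab; have := int_deriv_X lip Hc ab; have L0 := lipschitz_ge0 lip.
rewrite -subr_ge0 -lee_fin; apply: le_trans; apply: integral_ge0 => t _.
by rewrite lee_fin divr_ge0 ?cabs_ge0// addr_ge0.
Qed.

Lemma X_lt a b : a < b -> X a < X b.
Proof.
move=> ab; rewrite lt_neqAle (X_le (ltW ab)) andbT; apply/eqP => e.
by move: ab; rewrite -(bdryK a) e bdryK ltxx.
Qed.

Lemma bdry_inv_le u v : (bdry_inv u <= v) = (u <= X v).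
Proof.
apply/idP/idP => h; first by rewrite -(bdry_invK u); exact: X_le.
by rewrite leNgt; apply/negP => /X_lt; rewrite bdry_invK ltNge h.
Qed.

Lemma le_bdry_inv u v : (u <= bdry_inv v) = (X u <= v).
Proof.
apply/idP/idP => h; first by rewrite -(bdry_invK v); exact: X_le.
by rewrite leNgt; apply/negP => /X_lt; rewrite bdry_invK ltNge h.
Qed.

(** The image is rewritten as a closed set intersected with a preimage under a continuous map, which
    makes its measurability immediate. *)
Lemma bdry_image (E : set R) : bdry Phi @` E =
  [set z | complex.Im z = gamma (complex.Re z)] `&` ((fun z => bdry_inv (complex.Re z)) @^-1` E).
Proof.
apply/seteqP; split=> [_ [t Et <-]|z [zg zE]] /=.
  by rewrite bdryK; split=> //; rewrite {1}bdry_eta.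
exists (bdry_inv (complex.Re z)) => //; rewrite bdry_eta bdry_invK.
by apply: complex_eq => //=.
Qed.

Lemma bdry_segment (a b : R) : bdry Phi @` `[a, b]%classic = eta gamma @` `[X a, X b]%classic.
Proof.
apply/seteqP; split=> [_ [t /= + <-]|_ [u /= + <-]]; rewrite in_itv /= => /andP[h1 h2].
  by exists (X t); [rewrite /= in_itv /= !X_le|rewrite -bdry_eta].
by exists (bdry_inv u); [rewrite /= in_itv /= le_bdry_inv bdry_inv_le h1|rewrite bdry_eta bdry_invK].
Qed.

Lemma measurable_bdry (E : set (measurableTypeR R)) : measurable E ->
  measurable (bdry Phi @` E : set (borelC R)).
Proof.
move=> mE; rewrite bdry_image; apply: measurableI.
  have := continuous_borelC continuous_height => /(_ measurableT [set 0] (measurable_set1 0)).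
  rewrite setTI; congr measurable; apply/seteqP; split=> z /= => [/eqP|->].
    by rewrite subr_eq0 => /eqP.
  by rewrite subrr.
have cb : continuous (fun z : cplane R => bdry_inv (complex.Re z)).
  by move=> w; apply: (@continuous_comp _ _ _ (fun z : cplane R => complex.Re z) bdry_inv); [exact: continuous_Re|exact: continuous_bdry_inv].
by have := continuous_borelC cb measurableT mE; rewrite setTI.
Qed.

Lemma eta_bdry_image (E : set R) : eta gamma @^-1` (bdry Phi @` E) = bdry_inv @^-1` E.
Proof.
rewrite bdry_image; apply/seteqP; split=> u /=; first by case.
by move=> h; split.
Qed.

Lemma bdry_inj : injective (bdry Phi).
Proof. by move=> s t e; rewrite -(bdryK s) e bdryK. Qed.

End boundary_parametrization.

(** * Arc length of a Lipschitz graph *)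

Section graph_arc_length.
Context {R : realType} (gamma : R -> R) (L : R).
Hypotheses (lip : L.-lipschitz gamma).
Notation mu := (@lebesgue_measure R).

Lemma derive1_lipschitz t : `|derive1 gamma t| <= L.
Proof.
rewrite /derive1; set q := (fun h : R => _).
have qL : \forall h \near (0 : R)^', `|q h| <= L.
  apply/nbhs_ballP; exists 1 => //= h _ h0.
  rewrite /q normrZ normfV ler_pdivrMl ?normr_gt0// mulrC.
  by have := lipschitzE lip (h + t) t; rewrite addrK.
have [cq|ncq] := pselect (cvg (q h @[h --> (0 : R)^'])).
  apply: (@cvgr_to_le _ _ _ _ (fun h => `|q h|) _ _ _ qL); exact: cvg_norm cq.
(* Where [gamma] is not differentiable, [derive1] is the default value 0, so the bound holds at
   every point. *)
by rewrite (dvgP ncq) /point /= normr0; exact: lipschitz_ge0 lip.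
Qed.

Lemma curve_deriv_eta t : curve_deriv (eta gamma) t = 1 +i* derive1 gamma t.
Proof. by rewrite /curve_deriv; congr (_ +i* _); rewrite derive1E derive_id. Qed.

Lemma cabs_deriv_eta t : 1 <= cabs (curve_deriv (eta gamma) t) <= 1 + L.
Proof.
rewrite curve_deriv_eta; apply/andP; split.
  by apply: le_trans (Re_le_cabs _); rewrite /= normr1.
by apply: le_trans (cabs_le_ReIm _) _; rewrite /= normr1 lerD2l derive1_lipschitz.
Qed.

Lemma measurable_eta : measurable_fun [set: measurableTypeR R] (eta gamma : measurableTypeR R -> borelC R).
Proof.
have H := @measurability _ _ (measurableTypeR R) (borelC R) [set: measurableTypeR R] (eta gamma)
  (@open (cplane R)) erefl.
apply: H => _ [A oA <-]; rewrite setTI.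
apply: open_measurable; move: A oA; apply/continuousP => u.
by apply: cvg_complex; [exact: cvg_id|exact: (continuous_lipschitz lip)].
Qed.

Lemma measurable_cabs_eta :
  measurable_fun [set: measurableTypeR R] (fun t => cabs (curve_deriv (eta gamma) t) : measurableTypeR R).
Proof.
apply: measurable_cabs_deriv => t; first exact: cvg_id.
exact: (continuous_lipschitz lip).
Qed.

Lemma exists_arc_length : exists s : {measure set (borelC R) -> \bar R},
  (s : set (borelC R) -> \bar R) = arc_length gamma.
Proof.
apply: exists_density; first exact: measurable_eta.
  by apply/measurable_EFinP; exact: measurable_cabs_eta.
by move=> t; rewrite lee_fin cabs_ge0.
Qed.

Lemma arc_length_bounds (E : set (borelC R)) : measurable E ->
  (mu (eta gamma @^-1` E) <= arc_length gamma E)%E /\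
  (arc_length gamma E <= (1 + L)%:E * mu (eta gamma @^-1` E))%E.
Proof.
move=> mE; have mP : measurable (eta gamma @^-1` E : set (measurableTypeR R)).
  by rewrite -[_ @^-1` _]setTI; exact: measurable_eta.
have L0 := lipschitz_ge0 lip.
have mc D : measurable_fun D (fun t => (cabs (curve_deriv (eta gamma) t))%:E).
  by apply: measurable_funTS; apply/measurable_EFinP; exact: measurable_cabs_eta.
rewrite /arc_length; split.
  rewrite -[leLHS]mul1e -integral_cst//; apply: ge0_le_integral => //; first exact: mc.
  by move=> t _; rewrite lee_fin; have /andP[] := cabs_deriv_eta t.
rewrite -integral_cst//; apply: ge0_le_integral => //.
- by move=> t _; rewrite lee_fin cabs_ge0.
- exact: mc.
by move=> t _; rewrite lee_fin; have /andP[] := cabs_deriv_eta t.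
Qed.

End graph_arc_length.

(** * Arc length of images of boundary sets *)

Section boundary_measure.
Context {R : realType} (gamma : R -> R) (L x0 : R) (Phi : cplane R -> cplane R).
Hypotheses (lip : L.-lipschitz gamma) (Hc : conformal_map gamma Phi x0).
Notation mu := (@lebesgue_measure R).
Notation X t := (complex.Re (bdry Phi t)).
Notation D t := (cabs (curve_deriv (bdry Phi) t)).

Let L0 : 0 <= L := lipschitz_ge0 lip.

Lemma lebesgue_bdry_inv (E : set (measurableTypeR R)) : measurable E ->
  (\int[mu]_(t in E) (D t / (L + 2))%:E <= mu (bdry_inv Hc @^-1` E))%E.
Proof.
move=> mE.
have mD : measurable_fun [set: measurableTypeR R] (fun t => (D t / (L + 2))%:E).
  by apply/measurable_EFinP; apply: measurable_funM => //; exact: (measurable_D Hc).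
have D0 t : (0 <= (D t / (L + 2))%:E)%E by rewrite lee_fin divr_ge0 ?cabs_ge0// addr_ge0.
have mX : measurable_fun [set: measurableTypeR R] (fun t => X t : measurableTypeR R).
  by apply: continuous_measurable_fun; exact: (continuous_ReB Hc).
have [m mE'] := exists_density mu mX mD D0.
have mg : measurable (bdry_inv Hc @^-1` E : set (measurableTypeR R)).
  rewrite -[_ @^-1` _]setTI; apply: (continuous_measurable_fun _ measurableT mE).
  exact: (continuous_bdry_inv lip).
have := @le_lebesgue_measure R m _ _ mg; rewrite mE' -comp_preimage.
rewrite (_ : bdry_inv Hc \o (fun t => X t) = id); last by apply/funext => t /=; rewrite (bdryK lip).
apply => a b ab.
have ab' : bdry_inv Hc a <= bdry_inv Hc b.
  by rewrite (bdry_inv_le lip) bdry_invK ltW.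
apply: (@le_trans _ _ (\int[mu]_(t in `[bdry_inv Hc a, bdry_inv Hc b]) (D t / (L + 2))%:E)%E).
  apply: ge0_subset_integral => //.
  - by rewrite -[_ @^-1` _]setTI; exact: mX.
  - exact: measurable_funTS.
  by move=> t; rewrite /= !in_itv /= => /andP[h1 h2]; rewrite (le_bdry_inv lip) (bdry_inv_le lip) h2 ltW.
by apply: le_trans (int_deriv_X lip Hc ab') _; rewrite !bdry_invK.
Qed.

Lemma arc_bdry_ge (E : set (measurableTypeR R)) : measurable E ->
  (\int[mu]_(t in E) (D t / (L + 2))%:E <= arc_length gamma (bdry Phi @` E))%E.
Proof.
move=> mE; apply: le_trans (lebesgue_bdry_inv mE) _.
rewrite -(eta_bdry_image lip Hc); apply: (arc_length_bounds lip _).1.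
exact: (measurable_bdry lip Hc).
Qed.

Lemma arc_bdry_segment (a b : R) : a < b ->
  (0 < arc_length gamma (bdry Phi @` `[a, b]%classic))%E /\
  (arc_length gamma (bdry Phi @` `[a, b]%classic) <= ((1 + L) * (X b - X a))%:E)%E.
Proof.
move=> ab; have Xab := X_lt lip Hc ab.
have ms : measurable (`[a, b]%classic : set (measurableTypeR R)) by [].
have := arc_length_bounds lip (measurable_bdry lip Hc ms); rewrite (eta_bdry_image lip Hc).
have -> : bdry_inv Hc @^-1` `[a, b]%classic = `[X a, X b]%classic.
  by apply/seteqP; split=> u; rewrite /= !in_itv /= (le_bdry_inv lip) (bdry_inv_le lip).
rewrite lebesgue_measure_cc ?(ltW Xab)// EFinM => -[h1 h2]; split => //.
by apply: lt_le_trans h1; rewrite lte_fin subr_gt0.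
Qed.

Lemma exists_image_nu (nu : {measure set (borelC R) -> \bar R}) :
  exists m : {measure set (measurableTypeR R) -> \bar R},
    (m : set (measurableTypeR R) -> \bar R) = image_measure Phi nu.
Proof.
apply: exists_image_measure; first exact: (bdry_inj lip Hc).
exact: (measurable_bdry lip Hc).
Qed.

End boundary_measure.

(** * Good sets and doubling *)

Section good_set.
Context {R : realType} (gamma : R -> R) (L x0 : R) (Phi : cplane R -> cplane R).
Hypotheses (lip : L.-lipschitz gamma) (Hc : conformal_map gamma Phi x0).
Variable T : R.
Hypothesis T0 : 0 < T.
Notation mu := (@lebesgue_measure R).
Notation D t := (cabs (curve_deriv (bdry Phi) t)).
Notation dPhi := ('D_1 Phi).

Let L0 : 0 <= L := lipschitz_ge0 lip.

(** With this value the Chebyshev error terms add up to exactly [T * y], half the length of the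
    interval. *)
Definition good_const : R := 2 * (L + 2) * (pi * (1 + T ^+ 2)) / T.

(** For [T = tan alpha] the interval consists of the boundary points whose cone contains
    [x +i* y]. *)
Definition good_set (x y : R) : set (measurableTypeR R) :=
  `]x - T * y, x + T * y[%classic `&`
  [set t | cabs (dPhi (x +i* y)) <= good_const * D t /\
           D t <= good_const * cabs (dPhi (x +i* y))].

Lemma good_const_gt0 : 0 < good_const.
Proof.
have h1 : 0 < L + 2 by rewrite ltr_wpDl.
have h2 : 0 < 1 + T ^+ 2 by rewrite ltr_pwDl// sqr_ge0.
by rewrite /good_const divr_gt0// !mulr_gt0 ?pi_gt0.
Qed.

Lemma measurable_good_set x y : measurable (good_set x y).
Proof.
apply: measurableI => //.
have mD := measurable_D Hc.
have m1 := measurable_funM (@measurable_cst _ _ (measurableTypeR R) (measurableTypeR R) setT good_const) mD.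
rewrite (_ : mkset _ = (fun t => good_const * D t) @^-1` `[cabs (dPhi (x +i* y)), +oo[%classic `&`
  (fun t => D t) @^-1` `]-oo, good_const * cabs (dPhi (x +i* y))]%classic); last first.
  by apply/seteqP; split=> t /=; rewrite !in_itv /= andbT.
by apply: measurableI; rewrite -[_ @^-1` _]setTI; [apply: m1|apply: mD].
Qed.

(* Chebyshev: with d = |Phi'(x + iy)| one has, almost everywhere on the
   interval, 1 <= 1_good + (D / d + d / D) / good_const. *)
Lemma good_set_large x y : 0 < y -> ((T * y)%:E <= mu (good_set x y))%E.
Proof.
move=> y0; have zU : uhp (x +i* y : cplane R) by [].
set d := cabs (dPhi (x +i* y)); set K := good_const.
have d0 : 0 < d by rewrite /d cabs_gt0; exact: (conformal_deriv_neq0 lip Hc).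
have K0 : 0 < K by exact: good_const_gt0.
have L20 : 0 < L + 2 by rewrite ltr_wpDl.
have Ty : 0 < T * y by rewrite mulr_gt0.
set I := `]x - T * y, x + T * y[%classic : set (measurableTypeR R).
have mI : measurable I by exact: measurable_itv.
have mA := measurable_good_set x y.
have mD := measurable_D Hc.
have mDV : measurable_fun [set: measurableTypeR R] (fun t => (D t)^-1 : measurableTypeR R).
  rewrite (_ : (fun t => (D t)^-1) = (fun t => D t `^ (-1))); first exact: (measurable_Dpow Hc).
  by apply/funext => t; rewrite powR_inv1// cabs_ge0.
have muI : mu I = (2 * (T * y))%:E.
  rewrite /I lebesgue_measure_itv /= lte_fin ifT; last by move: (T * y) Ty => u u0; lra.
  by rewrite -EFinB; congr EFin; ring.
pose f1 t := (D t / (L + 2))%:E; pose f2 t := ((D t)^-1 / (L + 2))%:E.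
have mf1 S : measurable_fun (S : set (measurableTypeR R)) f1.
  by apply: measurable_funTS; apply/measurable_EFinP; apply: measurable_funM => //; exact: mD.
have mf2 S : measurable_fun (S : set (measurableTypeR R)) f2.
  by apply: measurable_funTS; apply/measurable_EFinP; apply: measurable_funM => //; exact: mDV.
have f10 t : (0 <= f1 t)%E by rewrite lee_fin divr_ge0 ?cabs_ge0// ltW.
have f20 t : (0 <= f2 t)%E by rewrite lee_fin divr_ge0 ?invr_ge0 ?cabs_ge0// ltW.
set P := pi * (1 + T ^+ 2) * y.
have sI f : (forall t, 0 <= f t)%E -> (forall S, measurable_fun (S : set (measurableTypeR R)) f) ->
  (\int[mu]_(t in I) f t <= \int[mu]_(t in `[(x - T * y)%R, (x + T * y)%R]) f t)%E.
  move=> f0 mf; apply: ge0_subset_integral => //.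
  by move=> t; rewrite /I /= !in_itv /= => /andP[h1 h2]; rewrite !ltW.
have I1 : (\int[mu]_(t in I) f1 t <= (P * d)%:E)%E.
  by apply: le_trans (sI _ f10 mf1) _; exact: (int_deriv_le lip Hc).
have I2 : (\int[mu]_(t in I) f2 t <= (P * d^-1)%:E)%E.
  by apply: le_trans (sI _ f20 mf2) _; exact: (int_inv_deriv_le lip Hc).
pose c1 := (L + 2) / d / K; pose c2 := (L + 2) * d / K.
have c10 : 0 <= c1 by apply: divr_ge0; [apply: divr_ge0|]; exact: ltW.
have c20 : 0 <= c2 by apply: divr_ge0; [apply: mulr_ge0|]; exact: ltW.
have H : (mu I <= mu (good_set x y) + (c1%:E * (P * d)%:E + c2%:E * (P * d^-1)%:E))%E.
  rewrite -[leLHS]mul1e -integral_cst//.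
  apply: (@le_trans _ _ (\int[mu]_(t in I) ((\1_(good_set x y) t)%:E + (c1%:E * f1 t + c2%:E * f2 t)))%E).
    apply: ae_ge0_le_integral => //.
    - by move=> t _; rewrite !adde_ge0 ?mule_ge0// lee_fin.
    - apply: emeasurable_funD; first by apply: measurable_funTS; apply/measurable_EFinP; exact: measurable_indic.
      by apply: emeasurable_funD; apply: measurable_funeM.
    have [N [mN N0 sN]] := ae_bdry Hc.
    exists N; split => // t tN; apply: sN => /= -[_ c0 _]; apply: tN => It.
    have Dt : 0 < D t by rewrite cabs_gt0.
    rewrite /f1 /f2 indicE -!EFinM -!EFinD lee_fin.
    have -> : c1 * (D t / (L + 2)) = D t / (K * d) by rewrite /c1; field; rewrite !gt_eqF.
    have -> : c2 * ((D t)^-1 / (L + 2)) = d / (K * D t) by rewrite /c2; field; rewrite !gt_eqF.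
    have u0 : 0 <= D t / (K * d) by apply: divr_ge0; [|apply: mulr_ge0]; exact: ltW.
    have v0 : 0 <= d / (K * D t) by apply: divr_ge0; [|apply: mulr_ge0]; exact: ltW.
    have [h1|h1] := leP (D t) (K * d); last first.
      have : 1 <= D t / (K * d) by rewrite (ler_pdivlMr _ _ (mulr_gt0 K0 d0)) mul1r ltW.
      have : 0 <= (t \in good_set x y)%:R :> R by rewrite ler0n.
      by move: v0; move: (d / _) (D t / _) (_%:R) => u v w; lra.
    have [h2|h2] := leP d (K * D t); last first.
      have : 1 <= d / (K * D t) by rewrite (ler_pdivlMr _ _ (mulr_gt0 K0 Dt)) mul1r ltW.
      have : 0 <= (t \in good_set x y)%:R :> R by rewrite ler0n.
      by move: u0; move: (d / _) (D t / _) (_%:R) => u v w; lra.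
    by rewrite mem_set ?lerDl ?addr_ge0.
  rewrite ge0_integralD//; last 3 first.
  - by apply: measurable_funTS; apply/measurable_EFinP; exact: measurable_indic.
  - by move=> t _; rewrite adde_ge0 ?mule_ge0// lee_fin.
  - by apply: emeasurable_funD; apply: measurable_funeM.
  apply: leeD; first by rewrite integral_indic//; apply: le_measure; rewrite ?inE//; exact: measurableI.
  rewrite ge0_integralD//; last 4 first.
  - by move=> t _; rewrite mule_ge0// lee_fin.
  - by apply: measurable_funeM.
  - by move=> t _; rewrite mule_ge0// lee_fin.
  - by apply: measurable_funeM.
  by rewrite !ge0_integralZl_EFin//; apply: leeD; apply: lee_wpmul2l; rewrite ?lee_fin.
have e : c1 * (P * d) + c2 * (P * d^-1) = T * y.
  rewrite /c1 /c2 /P /K /good_const; have := pi_gt0 R; move: (pi : R) => p p0.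
  by field; rewrite !gt_eqF//= ltr_pwDl// sqr_ge0.
move: H; rewrite -!EFinM -EFinD e muI -leeBlDr// -EFinB => /(le_trans _); apply.
by rewrite lee_fin; move: (T * y) => u; lra.
Qed.

End good_set.

Section good_set_doubling.
Context {R : realType} (gamma : R -> R) (L x0 : R) (Phi : cplane R -> cplane R).
Hypotheses (lip : L.-lipschitz gamma) (Hc : conformal_map gamma Phi x0).
Variable T : R.
Hypothesis T0 : 0 < T.
Notation mu := (@lebesgue_measure R).
Notation D t := (cabs (curve_deriv (bdry Phi) t)).
Notation dPhi := ('D_1 Phi).
Notation A := (good_set L Phi T).

Let L0 : 0 <= L := lipschitz_ge0 lip.

Let A_sub x y : 0 < y -> A x y `<=` `[x - 5 * (T * y), x + 5 * (T * y)]%classic.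
Proof.
move=> y0 t [+ _]; have : 0 < T * y by rewrite mulr_gt0.
by rewrite /= !in_itv /=; move: (T * y) => u u0 /andP[h1 h2]; apply/andP; split; lra.
Qed.

(** The factor 5 is the enlargement in Vitali's lemma; this is the hypothesis of [vitali_weak] for
    the family of good sets. *)
Definition doubling_on_good_sets (m : set (measurableTypeR R) -> \bar R) :=
  exists2 C : R, 0 <= C & forall x y, 0 < y ->
    (m `[(x - 5 * (T * y))%R, (x + 5 * (T * y))%R]%classic <= C%:E * m (A x y))%E.

Lemma good_set_doubling_line (m : set (measurableTypeR R) -> \bar R) :
  Ainfty_line m -> doubling_on_good_sets m.
Proof.
move=> [w [r r1 wA] mE].
(* The good set has Lebesgue measure at least [T * y], and the enlarged interval has length
   [10 * (T * y)]. *)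
have c0 : 0 < 10^-1 :> R by [].
have [C C0 H] := muckenhoupt_comparison r1 wA c0.
exists C => // x y y0; have Ty : 0 < T * y by rewrite mulr_gt0.
have mA : measurable (A x y) by apply: measurable_good_set; exact: Hc.
rewrite !mE//; apply: H => //.
- exists (x - 5 * (T * y)), (x + 5 * (T * y)); split => //.
  by move: (T * y) Ty => u u0; lra.
- have : (0 < mu `[(x - 5 * (T * y))%R, (x + 5 * (T * y))%R]%classic < +oo)%E; last exact.
  rewrite lebesgue_measure_cc ?lte_fin ?ltry ?andbT; last by move: (T * y) Ty => u u0; lra.
  by move: (T * y) Ty => u u0; lra.
- exact: A_sub.
have : ((10^-1)%:E * mu `[(x - 5 * (T * y))%R, (x + 5 * (T * y))%R]%classic <= mu (A x y))%E; last exact.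
rewrite lebesgue_measure_cc; last by move: (T * y) Ty => u u0; lra.
apply: le_trans (good_set_large lip Hc T0 x y0); rewrite -EFinM lee_fin.
by move: (T * y) Ty => u u0; lra.
Qed.

(** Let [d] be the modulus of [Phi'] at [x +i* y]. On the good set [D >= d / K], so its image has
    arc length at least [d / K / (L + 2) * (T * y)]. The image of the enlarged interval has arc
    length at most [(1 + L) * C5 * y * d], by [X_increment_le] with [5 * T]. *)
Lemma good_set_doubling_graph (nu : {measure set (borelC R) -> \bar R}) :
  Ainfty_graph gamma nu -> doubling_on_good_sets (image_measure Phi nu).
Proof.
have [s sE] := exists_arc_length lip; rewrite /Ainfty_graph -sE.
move=> [w [r r1 wA] nE].
set K := good_const L T; have K0 : 0 < K := good_const_gt0 lip T0.
pose C5 := pi * (1 + (5 * T) ^+ 2).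
have C50 : 0 < C5 by rewrite mulr_gt0 ?pi_gt0// ltr_pwDl// sqr_ge0.
have L20 : 0 < L + 2 by rewrite ltr_wpDl.
have L10 : 0 < 1 + L by rewrite ltr_pwDl.
(* The quotient of the two arc length bounds, in which [d] and [y] cancel. *)
pose c := T / (K * (L + 2) * ((1 + L) * C5)).
have c0 : 0 < c.
  by apply: divr_gt0 => //; apply: mulr_gt0; [exact: mulr_gt0 K0 L20|exact: mulr_gt0 L10 C50].
have [C C0 H] := muckenhoupt_comparison r1 wA c0.
exists C => // x y y0; have Ty : 0 < T * y by rewrite mulr_gt0.
have mA : measurable (A x y) by apply: measurable_good_set; exact: Hc.
have ab : x - 5 * (T * y) < x + 5 * (T * y) by move: (T * y) Ty => u u0; lra.
have mJ : measurable (`[x - 5 * (T * y), x + 5 * (T * y)]%classic : set (measurableTypeR R)) by exact: measurable_itv.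
have [J1 J2] := arc_bdry_segment lip Hc ab.
rewrite /image_measure !nE; [|exact: (measurable_bdry lip Hc)|exact: (measurable_bdry lip Hc)].
apply: H.
- rewrite (bdry_segment lip Hc); do 2 eexists; split; last by [].
  exact: (X_lt lip Hc).
- exact: (measurable_bdry lip Hc).
- by rewrite sE J1 (le_lt_trans J2)// ltry.
- exact: (measurable_bdry lip Hc).
- exact: image_subset (A_sub y0).
have XI := X_increment_le lip Hc x y0 (mulr_gt0 (ltr0n R 5) T0).
rewrite -!mulrA in XI.
set d := cabs (dPhi (x +i* y)) in XI *.
have d0 : 0 <= d / K / (L + 2).
  by apply: divr_ge0; [apply: divr_ge0; [exact: cabs_ge0|exact: ltW]|exact: ltW].
rewrite sE; apply: (@le_trans _ _ (d / K / (L + 2) * (T * y))%:E); last first.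
  apply: le_trans (arc_bdry_ge lip Hc mA).
  apply: (@le_trans _ _ (\int[mu]_(t in A x y) (d / K / (L + 2))%:E)%E).
    rewrite integral_cst// EFinM; apply: lee_wpmul2l.
      by rewrite lee_fin.
    exact: (good_set_large lip Hc T0 x y0).
  apply: ge0_le_integral => //.
  - apply: measurable_funTS; apply/measurable_EFinP; apply: measurable_funM => //.
    exact: (measurable_D Hc).
  move=> t [_ [h _]]; rewrite lee_fin ler_wpM2r ?invr_ge0 ?(ltW L20)//.
  by rewrite ler_pdivrMr// mulrC.
apply: (@le_trans _ _ (c%:E * ((1 + L) * (C5 * y * d))%:E)%E).
  apply: lee_wpmul2l; first by rewrite lee_fin ltW.
  apply: le_trans J2 _; rewrite lee_fin ler_wpM2l ?(ltW L10)//.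
  by rewrite /C5 -!mulrA.
rewrite -EFinM lee_fin le_eqVlt; apply/orP; left; apply/eqP.
have e (u v p q : R) : 0 < u -> 0 < v -> 0 < p -> 0 < q ->
    T / (v * p * (q * u)) * (q * (u * y * d)) = d / v / p * (T * y).
  by move=> u0 v0 p0 q0; field; rewrite !gt_eqF.
exact: e.
Qed.

End good_set_doubling.

(** * Comparison of maximal functions through good sets *)

Section maximal_comparison.
Context {R : realType}.
Implicit Types (F G : cplane R -> cplane R) (alpha l p : R).

Lemma poweR_level (u : \bar R) (p l : R) : (0 <= u)%E -> 0 < p -> 0 < l ->
  ((l%:E < u `^ p) = ((l `^ p^-1)%:E < u))%E.
Proof.
case: u => [u| |] // u0 p0 l0; last by rewrite poweRyr ?gt_eqF// !ltry.
rewrite poweR_EFin !lte_fin.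
have lE : l = (l `^ p^-1) `^ p by rewrite -powRrM mulVf ?gt_eqF// powRr1// ltW.
rewrite {1}lE; apply/idP/idP => h; last first.
  by apply: gt0_ltr_powR => //; rewrite ?nnegrE ?powR_ge0//.
rewrite ltNge; apply/negP => h2; move: h; rewrite ltNge => /negP; apply.
by apply: ge0_ler_powR => //; rewrite ?nnegrE ?powR_ge0 ?(ltW p0).
Qed.

(** A point of the half-plane is encoded by the centre and radius of its shadow on the line, the
    radius being [tan alpha] times the height. Besides preparing Vitali's lemma, this shows that
    level sets are open, hence that maximal functions are measurable. *)
Lemma maximal_level alpha F l : 0 < tan alpha ->
  [set x | (l%:E < maximal_fun alpha F x)%E] =
  \bigcup_(z in [set z : R * R | 0 < z.2 /\ l < cabs (F (z.1 +i* (z.2 / tan alpha)))])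
    ball z.1 z.2.
Proof.
move=> T0; apply/seteqP; split=> t /=.
  move=> /ereal_sup_gt[_ [z [z0 zt] <-]]; rewrite lte_fin => lz.
  exists (complex.Re z, tan alpha * complex.Im z) => /=.
    split; first by rewrite mulr_gt0.
    rewrite [X in X / _]mulrC mulfK ?gt_eqF//.
    by have -> : complex.Re z +i* complex.Im z = z by apply: complex_eq.
  by rewrite /ball /= distrC.
move=> [[x r] /= [r0 lF]]; rewrite /ball /= distrC => xt.
apply: (@lt_le_trans _ _ (cabs (F (x +i* (r / tan alpha))))%:E); first by rewrite lte_fin.
apply: ereal_sup_ubound; exists (x +i* (r / tan alpha)) => //.
have e : tan alpha * (r / tan alpha) = r by rewrite mulrC divfK ?gt_eqF.
by split; [exact: divr_gt0|rewrite -[complex.Im _]/(r / tan alpha) e].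
Qed.

Lemma maximal_ge0 alpha F x : 0 < tan alpha -> (0 <= maximal_fun alpha F x)%E.
Proof.
move=> T0; apply: (@le_trans _ _ (cabs (F (x +i* 1)))%:E); first by rewrite lee_fin cabs_ge0.
by apply: ereal_sup_ubound; exists (x +i* 1) => //; split; rewrite /= ?subrr ?normr0 ?mulr1.
Qed.

Lemma measurable_maximal alpha F : 0 < tan alpha ->
  measurable_fun [set: measurableTypeR R] (maximal_fun alpha F : measurableTypeR R -> \bar R).
Proof.
move=> T0; apply: lower_semicontinuous_measurable; apply/lower_semicontinuousP => l.
rewrite maximal_level//; apply: bigcup_open => z _; exact: (@ball_open R R).
Qed.

Lemma poweR_maximal_comparison (m : {measure set (measurableTypeR R) -> \bar R})
    (A : R -> R -> set R) alpha (p C K : R) (rho : R -> R) F G :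
  0 < tan alpha -> 0 < p -> 0 <= C -> 0 < K ->
  measurable_fun [set: measurableTypeR R] (rho : measurableTypeR R -> measurableTypeR R) ->
  (forall t, 0 <= rho t) ->
  (forall x y, measurable (A x y : set (measurableTypeR R))) ->
  (forall x y, A x y `<=` `]x - tan alpha * y, x + tan alpha * y[%classic) ->
  (forall x y, 0 < y -> (m `[(x - 5 * (tan alpha * y))%R, (x + 5 * (tan alpha * y))%R]%classic
     <= C%:E * m (A x y))%E) ->
  (forall x y t, 0 < y -> A x y t -> 
     cabs (F (x +i* y)) <= K * (cabs (G (x +i* y)) * rho t)) ->
  (\int[m]_x maximal_fun alpha F x `^ p <=
   (C * K `^ p)%:E * \int[m]_x (maximal_fun alpha G x `^ p * (rho x `^ p)%:E))%E.
Proof.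
move=> T0 p0 C0 K0 mrho rho0 mA AI Am FG; set T := tan alpha.
have AI' x y t : A x y t -> `|t - x| < T * y by move=> /AI; rewrite /= in_itv /= ltr_distl.
have TrT r : T * (r / T) = r by rewrite mulrC divfK ?gt_eqF.
pose g x := (maximal_fun alpha G x `^ p * (rho x `^ p)%:E)%E.
have mN H : measurable_fun [set: measurableTypeR R] (fun x => maximal_fun alpha H x `^ p)%E.
  by apply: (measurableT_comp (measurable_poweR p)); exact: measurable_maximal.
have mg : measurable_fun [set: measurableTypeR R] g.
  apply: emeasurable_funM => //; apply/measurable_EFinP.
  exact: (measurableT_comp (measurable_powR _) mrho).
have g0 x : (0 <= g x)%E by rewrite mule_ge0 ?poweR_ge0// lee_fin powR_ge0.
have KK : 0 < K `^ p by rewrite powR_gt0.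
rewrite EFinM -muleA -ge0_integralZl_EFin//; [|by move=> x _; exact: g0|exact: ltW].
apply: layer_cake_le => //.
- by apply: measurable_funeM.
- by move=> x; exact: poweR_ge0.
- by move=> x; apply: mule_ge0; [rewrite lee_fin ltW|exact: g0].
move=> l l0.
have -> : [set x | (l%:E < maximal_fun alpha F x `^ p)%E] =
    [set x | ((l `^ p^-1)%:E < maximal_fun alpha F x)%E].
  by apply/seteqP; split=> x /=; rewrite poweR_level// maximal_ge0.
rewrite maximal_level//.
apply: (@vitali_weak _ m _ (fun z => A z.1 (z.2 / T))) => //.
- by move=> z [].
- move=> [x r] /= [r0 lF] t At /=.
  have y0 : 0 < r / T by rewrite divr_gt0.
  have h := FG _ _ _ y0 At.
  have lt : (l `^ p^-1) < K * (cabs (G (x +i* (r / T))) * rho t) by exact: lt_le_trans lF h.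
  have lE : l = (l `^ p^-1) `^ p by rewrite -powRrM mulVf ?gt_eqF// powRr1// ltW.
  apply: (@lt_le_trans _ _ ((K * (cabs (G (x +i* (r / T))) * rho t)) `^ p)%:E).
    by rewrite lte_fin {1}lE; apply: gt0_ltr_powR => //; rewrite ?nnegrE ?powR_ge0// !mulr_ge0 ?cabs_ge0// ltW.
  rewrite powRM; [|exact: ltW|by rewrite mulr_ge0 ?cabs_ge0].
  rewrite powRM ?cabs_ge0// !EFinM; apply: lee_wpmul2l; first by rewrite lee_fin ltW.
  rewrite /g; apply: lee_wpmul2r; first by rewrite lee_fin powR_ge0.
  rewrite -poweR_EFin; apply: gt0_ler_poweR; rewrite ?(ltW p0)//.
  + by rewrite in_itv /= leey andbT lee_fin cabs_ge0.
  + by rewrite in_itv /= leey andbT maximal_ge0.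
  apply: ereal_sup_ubound; exists (x +i* (r / T)) => //.
  by split; [exact: y0|exact: AI' At].
- move=> [x r] /= [r0 _] t At; rewrite closed_ball_itv//= in_itv /=.
  by move: (AI' _ _ _ At); rewrite TrT ltr_distl => /andP[/ltW -> /ltW ->].
- have := emeasurable_fun_o_infty measurableT (measurable_funeM (K `^ p)%:E mg) l%:E.
  by rewrite setTI.
move=> [x r] /= [r0 _]; have y0 : 0 < r / T by rewrite divr_gt0.
have := Am x _ y0; rewrite -/T.
by rewrite TrT.
Qed.

End maximal_comparison.

(** * Integration against a density *)

Import HBNNSimple.

Section integral_density.
Context d (T : measurableType d) (R : realType).
Variables (mu m : {measure set T -> \bar R}) (h : T -> R).
Hypotheses (mh : measurable_fun setT h) (h0 : forall x, 0 <= h x).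
Hypothesis mE : forall E, measurable E -> m E = (\int[mu]_(x in E) (h x)%:E)%E.

(** By simple functions and monotone convergence from an explicit density, since neither measure is
    assumed sigma-finite. *)
Lemma integral_density (g : T -> \bar R) : measurable_fun setT g -> (forall x, 0 <= g x)%E ->
  (\int[m]_x g x = \int[mu]_x (g x * (h x)%:E))%E.
Proof.
have mf : measurable_fun setT (EFin \o h) by exact/measurable_EFinP.
have f0 x : (0 <= (h x)%:E)%E by rewrite lee_fin.
move=> mg g0; pose g_ := nnsfun_approx measurableT mg.
transitivity (limn (fun n => \int[m]_x (g_ n x)%:E)%E).
  rewrite -monotone_convergence//.
  - apply: eq_integral => y _; apply/esym/cvg_lim => //.
    exact: cvg_nnsfun_approx.
  - by move=> n; exact/measurable_EFinP/measurable_funP.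
  - by move=> n y _; rewrite lee_fin.
  - by move=> y _ n k nk; rewrite lee_fin; exact/lefP/nd_nnsfun_approx.
rewrite [X in limn X](_ : _ = (fun n => \int[mu]_x ((g_ n x)%:E * (h x)%:E))%E).
  rewrite -monotone_convergence//.
  - apply: eq_integral => x _; apply/cvg_lim => //.
    by apply: cvgeZr => //; exact: cvg_nnsfun_approx.
  - move=> n; apply: emeasurable_funM => //; exact/measurable_EFinP/measurable_funP.
  - by move=> n x _; rewrite mule_ge0// lee_fin.
  - move=> x _ n k nk; apply: lee_wpmul2r => //; rewrite lee_fin; exact/lefP/nd_nnsfun_approx.
apply/funext => n.
under eq_integral do rewrite fimfunE -fsumEFin//.
under [RHS]eq_integral do rewrite fimfunE -fsumEFin//.
rewrite ge0_integral_fsum//; last 2 first.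
- move=> r; under eq_fun do rewrite EFinM; apply: measurable_funeM.
  by apply/measurable_EFinP; exact: measurable_indic.
- by move=> r x _; rewrite EFinM nnfun_muleindic_ge0.
rewrite [in RHS](_ : (fun x => _) = (fun x => \sum_(r \in range (g_ n)) ((r * \1_(g_ n @^-1` [set r]) x)%:E * (h x)%:E))%E); last first.
  apply/funext => x; rewrite ge0_mule_fsuml// => r.
  by rewrite EFinM nnfun_muleindic_ge0.
rewrite ge0_integral_fsum//; last 2 first.
- move=> r; apply: emeasurable_funM => //; apply/measurable_EFinP; apply: measurable_funM => //.
- by move=> r x _; rewrite mule_ge0// EFinM nnfun_muleindic_ge0.
apply: eq_fsbigr => r _; have [r0|r0] := ltP r 0.
  rewrite preimage_nnfun0//; under eq_integral do rewrite indic0 mulr0.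
  by under [RHS]eq_integral do rewrite indic0 mulr0 mul0e; rewrite !integral0.
have mA : measurable (g_ n @^-1` [set r]) by [].
under eq_integral do rewrite EFinM.
rewrite ge0_integralZl_EFin//; last by apply/measurable_EFinP.
rewrite integral_indic// setIT mE//.
under [RHS]eq_integral do rewrite EFinM -muleA.
rewrite [RHS]ge0_integralZl_EFin//; last 2 first.
- by move=> x _; rewrite mule_ge0// lee_fin.
- by apply: emeasurable_funM => //; exact/measurable_EFinP.
congr (_ * _)%E; rewrite integral_mkcond epatch_indic.
by apply: eq_integral => x _; rewrite muleC.
Qed.

End integral_density.

(** * Comparison of the Hardy norms *)

Section hardy_comparison.
Context {R : realType} (gamma : R -> R) (L x0 : R) (Phi : cplane R -> cplane R).
Hypotheses (lip : L.-lipschitz gamma) (Hc : conformal_map gamma Phi x0).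
Variables (nu : {measure set (borelC R) -> \bar R}) (p alpha : R).
Hypotheses (alpha0 : 0 < alpha) (alpha1 : alpha < pi / 2) (p1 : 1 <= p).
Notation D t := (cabs (curve_deriv (bdry Phi) t)).
Notation dPhi := ('D_1 Phi).
Notation mu2 := (image_measure Phi nu).
Notation mu1 := (deriv_weighted Phi (- p) mu2).
Notation quot F := (fun z : cplane R => F z * (dPhi z)^-1 : cplane R).
Notation K := (good_const L (tan alpha)).

Let p0 : 0 < p. Proof. exact: lt_le_trans p1. Qed.

Let T0 : 0 < tan alpha.
Proof.
rewrite divr_gt0 ?sin_gt0_pihalf ?cos_gt0_pihalf ?alpha0//.
by rewrite alpha1 andbT; move: alpha0 (pi_gt0 R); move: (pi : R) => q a0 q0; lra.
Qed.

Let K0 : 0 < K. Proof. exact: (good_const_gt0 lip T0). Qed.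

Let d0 z : uhp z -> 0 < cabs (dPhi z).
Proof. by move=> zU; rewrite cabs_gt0; exact: (conformal_deriv_neq0 lip Hc). Qed.

Let A_sub x y : good_set L Phi (tan alpha) x y `<=` `]x - tan alpha * y, x + tan alpha * y[%classic.
Proof. by move=> t []. Qed.

Let weighted_measures :
  exists m2 m1 : {measure set (measurableTypeR R) -> \bar R},
  [/\ (m2 : set _ -> \bar R) = mu2, (m1 : set _ -> \bar R) = mu1 &
  forall g : R -> \bar R, measurable_fun [set: measurableTypeR R] g -> (forall x, 0 <= g x)%E ->
  (\int[m1]_x g x = \int[m2]_x (g x * (D x `^ (- p))%:E))%E].
Proof.
have [m2 m2E] := exists_image_nu lip Hc nu.
have mh := measurable_Dpow Hc (- p).
have h0 x : 0 <= D x `^ (- p) by exact: powR_ge0.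
have mh' : measurable_fun [set: measurableTypeR R] (fun x => (D x `^ (- p))%:E).
  exact/measurable_EFinP.
have [m1 m1E] := @exists_density _ _ (measurableTypeR R) (measurableTypeR R) R m2 id
  (fun x => (D x `^ (- p))%:E) (@measurable_id _ _ setT) mh' (fun x => h0 x).
exists m2, m1; split => //; first by rewrite m1E /deriv_weighted -m2E.
move=> g mg g0; apply: integral_density => //.
by move=> E mE; rewrite m1E.
Qed.

Let measurable_maximal_pow F :
  measurable_fun [set: measurableTypeR R] (fun x => maximal_fun alpha F x `^ p)%E.
Proof. by apply: (measurableT_comp (measurable_poweR p)); exact: measurable_maximal. Qed.

Let int_le_root (a b : \bar R) (C : R) : (0 <= a)%E -> (0 <= b)%E -> 0 <= C -> (a <= C%:E * b)%E ->
  (a `^ p^-1 <= (C `^ p^-1)%:E * b `^ p^-1)%E.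
Proof.
move=> a0 b0 C0 ab; rewrite -poweR_EFin -poweRM ?lee_fin//.
apply: gt0_ler_poweR => //; rewrite ?invr_ge0 ?(ltW p0)//.
  by rewrite in_itv /= leey andbT.
by rewrite in_itv /= leey andbT mule_ge0.
Qed.

(** Here [rho] is the inverse of [D], through the upper bound [D <= K * |Phi'(z)|] on good sets. The
    density of [mu1] with respect to [mu2] is exactly [rho ^ p]. *)
Lemma hardy_norm_quot_le : doubling_on_good_sets L Phi (tan alpha) mu2 ->
  exists2 C : R, 0 <= C & forall F : cplane R -> cplane R,
    (hardy_norm alpha p mu2 (quot F) <= C%:E * hardy_norm alpha p mu1 F)%E.
Proof.
have [m2 [m1 [m2E m1E dens]]] := weighted_measures.
rewrite -m1E -m2E => -[C C0 HC]; exists ((C * K `^ p) `^ p^-1); first exact: powR_ge0.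
move=> F; apply: int_le_root; rewrite ?mulr_ge0 ?powR_ge0//; do ?by apply: integral_ge0 => x _; exact: poweR_ge0.
rewrite dens//; last by move=> x; exact: poweR_ge0.
have -> : (fun x => maximal_fun alpha F x `^ p * (D x `^ (- p))%:E)%E =
    (fun x => maximal_fun alpha F x `^ p * ((D x `^ (-1)) `^ p)%:E)%E.
  by apply/funext => x; rewrite -powRrM mulN1r.
apply: (@poweR_maximal_comparison R m2 (good_set L Phi (tan alpha)) alpha p C K
  (fun x => D x `^ (-1)) (quot F) F) => //.
- exact: (measurable_Dpow Hc).
- by move=> t; exact: powR_ge0.
- by move=> x y; apply: measurable_good_set; exact: Hc.
move=> x y t y0 [_ [h1 h2]]; have dz : 0 < cabs (dPhi (x +i* y)) by exact: d0.
have Dt : 0 < D t by rewrite -(pmulr_rgt0 _ K0); exact: lt_le_trans h1.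
rewrite powR_inv1 ?cabs_ge0// cabsM cabsV mulrCA ler_wpM2l ?cabs_ge0//.
by rewrite ler_pdivlMr// mulrC ler_pdivrMr.
Qed.

(** Here [rho] is [D], through the lower bound [|Phi'(z)| <= K * D] on good sets. The factor [D ^ p]
    then cancels the density of [mu1] with respect to [mu2]. *)
Lemma hardy_norm_le_quot : doubling_on_good_sets L Phi (tan alpha) mu1 ->
  exists2 C : R, 0 <= C & forall F : cplane R -> cplane R,
    (hardy_norm alpha p mu1 F <= C%:E * hardy_norm alpha p mu2 (quot F))%E.
Proof.
have [m2 [m1 [m2E m1E dens]]] := weighted_measures.
rewrite -m1E -m2E => -[C C0 HC]; exists ((C * K `^ p) `^ p^-1); first exact: powR_ge0.
move=> F; apply: int_le_root; rewrite ?mulr_ge0 ?powR_ge0//; do ?by apply: integral_ge0 => x _; exact: poweR_ge0.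
have mDp : measurable_fun [set: measurableTypeR R] (fun x => (D x `^ p)%:E).
  by apply/measurable_EFinP; exact: (measurable_Dpow Hc).
have mDN : measurable_fun [set: measurableTypeR R] (fun x => (D x `^ (- p))%:E).
  by apply/measurable_EFinP; exact: (measurable_Dpow Hc).
apply: (@le_trans _ _ ((C * K `^ p)%:E *
    \int[m1]_x (maximal_fun alpha (quot F) x `^ p * (D x `^ p)%:E))%E).
  apply: (@poweR_maximal_comparison R m1 (good_set L Phi (tan alpha)) alpha p C K
    (fun x => D x) F (quot F)) => //.
  - exact: (measurable_D Hc).
  - by move=> t; exact: cabs_ge0.
  - by move=> x y; apply: measurable_good_set; exact: Hc.
  move=> x y t y0 [_ [h1 h2]]; have dz : 0 < cabs (dPhi (x +i* y)) by exact: d0.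
  rewrite cabsM cabsV -mulrA mulrCA -[leLHS]mulr1 ler_wpM2l ?cabs_ge0//.
  by rewrite mulrCA mulrC ler_pdivlMr// mul1r.
apply: lee_wpmul2l; first by rewrite lee_fin mulr_ge0 ?powR_ge0.
rewrite dens; last 2 first.
- by apply: emeasurable_funM.
- by move=> x; rewrite mule_ge0 ?poweR_ge0// lee_fin powR_ge0.
apply: ge0_le_integral => //.
- by move=> x _; rewrite !mule_ge0 ?poweR_ge0// lee_fin powR_ge0.
- by apply: emeasurable_funM => //; apply: emeasurable_funM.
move=> x _; rewrite -muleA -[leRHS]mule1; apply: lee_wpmul2l; first exact: poweR_ge0.
(* Where [D] vanishes the product of the two powers is 0 rather than 1; the inequality needs only
   that it is at most 1. *)
rewrite -EFinM lee_fin powRN; have [->|Dx] := eqVneq (D x `^ p) 0; first by rewrite mul0r.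
by rewrite divff.
Qed.

Lemma holomorphic_quot (F : cplane R -> cplane R) :
  holomorphic_on (@uhp R) F <-> holomorphic_on (@uhp R) (quot F).
Proof.
split=> hF z zU.
  apply: (@cderivableM R F (fun z => (dPhi z)^-1)); first exact: hF.
  exact: (holomorphic_dPhiV lip Hc).
have [r r0 rU] := copen_uhp zU.
apply: (@near_eq_cderivable R (fun z => F z * (dPhi z)^-1 * dPhi z) F z r r0).
  by move=> w /ltW/rU wU; rewrite mulfVK//; exact: (conformal_deriv_neq0 lip Hc).
apply: (@cderivableM R (fun z => F z * (dPhi z)^-1) dPhi); first exact: hF.
exact: (holomorphic_dPhi Hc).
Qed.

End hardy_comparison.

Theorem corollary4p15 (R : realType) (gamma : R -> R) (L x0 : R)
    (Phi : cplane R -> cplane R) (nu : {measure set (borelC R) -> \bar R})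
    (p alpha : R) :
  L.-lipschitz gamma ->
  gamma 0 < x0 ->
  conformal_map gamma Phi x0 ->
  0 < alpha -> alpha < pi / 2 ->
  1 <= p ->
  Ainfty_graph gamma nu ->
  Ainfty_line (deriv_weighted Phi (- p) (image_measure Phi nu)) ->
  let mu1 := deriv_weighted Phi (- p) (image_measure Phi nu) in
  let mu2 := image_measure Phi nu in
  let quot (F : cplane R -> cplane R) : cplane R -> cplane R :=
    fun z => F z * ('D_1 Phi z)^-1 in
  (forall F : cplane R -> cplane R,
     hardy alpha p mu1 F <-> hardy alpha p mu2 (quot F)) /\
  exists c C : R, [/\ 0 < c, 0 < C &
    forall F : cplane R -> cplane R, hardy alpha p mu1 F ->
      (c%:E * hardy_norm alpha p mu1 F <= hardy_norm alpha p mu2 (quot F))%E /\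
      (hardy_norm alpha p mu2 (quot F) <= C%:E * hardy_norm alpha p mu1 F)%E].
Proof.
move=> lip _ Hc a0 a1 p1 nuA mu1A mu1 mu2 quot.
have T0 : 0 < tan alpha.
  rewrite divr_gt0 ?sin_gt0_pihalf ?cos_gt0_pihalf ?a0//.
  by rewrite a1 andbT; move: a0 (pi_gt0 R); move: (pi : R) => q a0 q0; lra.
(* Each A_infty hypothesis yields one direction: the one on the line bounds [F] by the quotient, the
   one on the graph bounds the quotient by [F]. *)
have [C1 C10 H1] := hardy_norm_le_quot lip Hc a0 a1 p1 (good_set_doubling_line lip Hc T0 mu1A).
have [C2 C20 H2] := hardy_norm_quot_le lip Hc a0 a1 p1 (good_set_doubling_graph lip Hc T0 nuA).
have n0 m F : (0 <= hardy_norm alpha p m F)%E by exact: poweR_ge0.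
have lin (C : R) (u v : \bar R) : (u <= C%:E * v)%E -> (v < +oo)%E -> (0 <= v)%E -> (u < +oo)%E.
  move=> uv vy v0; apply: le_lt_trans uv _; rewrite -(@fineK _ v) ?ge0_fin_numE//.
  by rewrite -EFinM ltry.
split.
  move=> F; split=> -[hF nF]; split.
  - exact: (holomorphic_quot lip Hc F).1.
  - exact: lin (H2 F) nF (n0 _ _).
  - exact: (holomorphic_quot lip Hc F).2.
  - exact: lin (H1 F) nF (n0 _ _).
have C1p : 0 < C1 + 1 by rewrite ltr_wpDl.
(* [C1] and [C2] are only known to be non-negative; adding 1 makes both constants strictly
   positive. *)
exists (C1 + 1)^-1, (C2 + 1); split; [by rewrite invr_gt0|by rewrite ltr_wpDl|move=> F _; split].
  rewrite lee_pdivrMl//; apply: le_trans (H1 F) _; apply: lee_wpmul2r; first exact: n0.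
  by rewrite lee_fin lerDl.
by apply: le_trans (H2 F) _; apply: lee_wpmul2r; [exact: n0|rewrite lee_fin lerDl].
Qed.
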